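(* Let $k\ge 1$ be an integer, let $\alpha\in(0,1/2]$, and let $\xi$ be an $\alpha$-balanced random integer. For each $n\ge 1$ let $M_1,\dots,M_k$ be $k$ independent random $n\times n$ integral matrices whose entries are iid copies of $\xi$. Let $B_1,\dots,B_k$ be finite abelian groups and let $P$ be a finite set of primes including every prime that divides $|B_i|$ for some $1\le i\le k$. Then $$\lim_{n\to\infty}\mathbf{P}\big(\mathrm{Cok}(M_1\cdots M_j)[P]\simeq B_j \text{ for all } 1\le j\le k\big)=\Big(\prod_{p\in P}(p^{-1};p^{-1})_\infty^k\Big)\prod_{i=1}^k\frac{\#\mathrm{Sur}(B_i,B_{i-1})}{\#\mathrm{Aut}(B_i)},$$ where $B_0=0$ is the trivial group.
   Context: A random integer $\xi$ is $\alpha$-balanced (for a real $\alpha\in(0,1/2]$) if for every prime $p$, $\max_{r\in\mathbb{Z}/p\mathbb{Z}}\mathbf{P}(\xi\equiv r \bmod p)\le 1-\alpha$. For $M\in\mathrm{Mat}_n(\mathbb{Z})$, $\mathrm{Cok}(M):=\mathbb{Z}^n/M\mathbb{Z}^n$. For an abelian group $G$ and a prime $p$, $G[p^\infty]$ denotes the $p$-Sylow subgroup (the $p^\infty$-torsion, i.e. elements of $p$-power order), and for a finite set $P$ of primes $G[P]:=\bigoplus_{p\in P}G[p^\infty]$. $\mathrm{Sur}(G,H)$ is the set of surjective group homomorphisms $G\to H$. The $q$-Pochhammer symbol is $(a;q)_\infty:=\prod_{i\ge 0}(1-aq^i)$. *)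

(* Defs.v *)
From HB Require Import structures.
From mathcomp Require Import all_boot all_order all_algebra finmap.
From mathcomp Require Import ring_quotient.
From mathcomp Require Import all_classical all_reals all_analysis.

Set Implicit Arguments.
Unset Strict Implicit.
Unset Printing Implicit Defensive.

Import Order.TTheory GRing.Theory Num.Theory.
Import numFieldNormedType.Exports.

Local Open Scope classical_set_scope.
Local Open Scope ring_scope.

HB.instance Definition _ := isPointed.Build int 0.
HB.instance Definition _ := @isMeasurable.Build default_measure_display
  int discrete_measurable discrete_measurable0
  discrete_measurableC discrete_measurableU.

Section Probability.
Context {R : realType} {d : measure_display} {T : measurableType d}.
Variable P : probability T R.

(* The residue classes mod p are enumerated by 0, ..., p - 1. *)
Definition balanced (alpha : R) (xi : {RV P >-> int}) : Prop :=
  forall p : nat, prime p ->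
    (\big[maxe/-oo]_(r < p) P [set w | (xi w = r%:Z %[mod p%:Z])%Z]
      <= (1 - alpha)%:E)%E.

Definition mutually_independent {d' : measure_display}
    {T' : measurableType d'} (I : finType) (X : I -> {RV P >-> T'}) : Prop :=
  forall (J : {set I}) (A : I -> set T'), (forall i, measurable (A i)) ->
    (P (\bigcap_(i in [set` J]) X i @^-1` A i)
      = \prod_(i in J) P (X i @^-1` A i))%E.

End Probability.

Definition identically_distributed {R : realType}
    {d1 d2 d' : measure_display}
    {T1 : measurableType d1} {T2 : measurableType d2} {T' : measurableType d'}
    (P1 : probability T1 R) (P2 : probability T2 R)
    (X1 : {RV P1 >-> T'}) (X2 : {RV P2 >-> T'}) : Prop :=
  forall A : set T', measurable A ->
    distribution P1 X1 A = distribution P2 X2 A.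

Section Cokernel.
Variables (n : nat) (M : 'M[int]_n).

Definition mximage : {pred 'cV[int]_n} :=
  [pred v | `[< exists w : 'cV[int]_n, v = M *m w >]].

Lemma mximage_zmod_closed : zmod_closed mximage.
Proof.
split; first by apply/asboolP; exists 0; rewrite mulmx0.
move=> _ _ /asboolP[x ->] /asboolP[y ->].
by apply/asboolP; exists (x - y); rewrite mulmxBr.
Qed.

HB.instance Definition _ :=
  GRing.isZmodClosed.Build 'cV[int]_n mximage mximage_zmod_closed.

Definition Cok : zmodType := Quotient.quot mximage.

End Cokernel.

Section PrimaryPart.
Variable G : zmodType.

Definition primary_torsion (p : nat) : {pred G} :=
  [pred x | `[< exists e : nat, x *+ (p ^ e)%N = 0 >]].

Lemma primary_torsion_zmod_closed (p : nat) : zmod_closed (primary_torsion p).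
Proof.
split; first by apply/asboolP; exists 0%N; rewrite mul0rn.
move=> x y /asboolP[e xe] /asboolP[f yf]; apply/asboolP; exists (e + f)%N.
by rewrite mulrnBl expnD mulrnA xe mul0rn mulnC mulrnA yf mul0rn subrr.
Qed.

HB.instance Definition _ (p : nat) :=
  GRing.isZmodClosed.Build G (primary_torsion p) (primary_torsion_zmod_closed p).

Variable P : {fset nat}.

(* The direct sum of the G[p^oo], p in P, realised inside the functions from
   P to G (P being finite, direct sum and direct product coincide). *)
Definition primary_family : {pred {ffun P -> G}} :=
  [pred f : {ffun P -> G} | [forall p : P, f p \in primary_torsion (val p)]].

Lemma primary_family_zmod_closed : zmod_closed primary_family.
Proof.
split; first by apply/forallP => p; rewrite ffunE rpred0.
move=> f g /forallP ff /forallP gg; apply/forallP => p.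
by rewrite !ffunE rpredB ?ff ?gg.
Qed.

HB.instance Definition _ :=
  GRing.isZmodClosed.Build {ffun P -> G} primary_family
    primary_family_zmod_closed.

Record primary_part := PrimaryPart {
  primary_part_val :> {ffun P -> G};
  primary_part_valP : primary_part_val \in primary_family
}.

HB.instance Definition _ := [isSub for primary_part_val].
HB.instance Definition _ := [Choice of primary_part by <:].
HB.instance Definition _ := [SubChoice_isSubZmodule of primary_part by <:].

End PrimaryPart.

Definition zmod_isomorphic (G H : zmodType) : Prop :=
  exists f : {additive G -> H}, bijective f.

Definition Sur (G H : finZmodType) : {set {ffun G -> H}} :=
  [set f : {ffun G -> H} |
    [forall x, forall y, f (x + y) == f x + f y]
    && [forall z, exists x, f x == z]].

Definition qpochhammer {R : realType} (a q : R) : R :=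
  limn (fun m : nat => \prod_(i < m) (1 - a * q ^+ i)).

(* Main.v *)
Require Import Defs.
From HB Require Import structures.
From mathcomp Require Import all_boot all_order all_algebra all_fingroup all_solvable all_character.
From mathcomp Require Import finmap generic_quotient ring_quotient boolp.
From mathcomp Require Import ring lra zify.

Set Implicit Arguments.
Unset Strict Implicit.
Unset Printing Implicit Defensive.

Import Order.TTheory GRing.Theory Num.Theory.
Local Open Scope ring_scope.

(** Put [C = B k] and choose [N] whose prime divisors are exactly the primes of [P], with [N %/ p]
    killing every [B i] for each prime [p] dividing [N]. For a nonsingular integer matrix [M], the
    [P]-part of its cokernel is isomorphic to [B] exactly when there is a surjection from [Z^n] to
    [B] whose kernel is [sat N M], the vectors having a multiple prime to [N] in the image of [M]
    ([primary_projection], [iso_exact]). Such a surjection is called exact, and if there is one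
    there are [#|Aut B|] of them ([card_exacts], [card_Aut_Sur]). So, for nonsingular matrices, the
    product over [i] of the numbers of exact maps for [M_1 ... M_i] onto [B i] is the product of the
    orders of the automorphism groups if the event holds, and 0 otherwise. The theorem follows from
    the limit of the expectation of this product.

    Given [F] onto [C] exact for the full product, exact maps at lower levels are the composites of
    [F] with surjections ([sum_exact]), and a composite is exact precisely when
    [F (M_1 ... M_j Z^n)] is the kernel of [C -> B j] ([kerz_compf]). Hence the product is a sum
    over towers of surjections [B k -> ... -> B 0] of the number of exact [F] with prescribed images
    of the partial products ([tower_sum_exact_id]). There are as many towers as the product of the
    [#|Sur (B i) (B i.-1)|], and it remains to see that each tower contributes [gam ^ k] in the
    limit, where [gam] is the product of the q-Pochhammer symbols.

    By a Nakayama argument, exactness for a product splits into one condition per factor that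
    involves only residues modulo [N]: if [F_j] is [F_(j-1)] composed with [M_j], the kernel of
    [F_(j-1)] must lie in the column span of [M_j] ([kers_kerz], [kerz_kers]). The contribution of a
    tower is therefore a sum over chains [F_0, ..., F_k] of products of the one-step probabilities
    [pair_prob] ([chain_probE]). If [pair_prob] from [f] is about [gam / #|A| ^ n] when [f] has
    image [A], and about [#|A| ^ n] forms have image [A], each link multiplies the sum by [gam]
    ([chain_limits]).

    The estimate of [pair_prob] ([pair_limit]) holds for codes: forms whose image is generated by
    values repeated a number of times proportional to [n]. Contraction of random walks on finite
    abelian groups makes the value of a code at a random column nearly uniform ([prg_popular],
    [prg_code]), while the other forms have negligible total weight ([sum_noncode], [card_noncode]).
    The first [n - r] columns have full rank modulo each prime up to a small probability, by a union
    bound over sparse relations and a first moment of kernel vectors ([prob_sparse],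
    [prob_rank_deficient]). The last [r] columns are then nearly uniform modulo a subgroup of
    bounded index, and they complete the matrix with the density of invertible [r] by [r] matrices
    ([last_columns]), which tends to [gam] as [r] grows.

    Singular matrices must be excluded. A singular matrix kills [2 ^ e] surjections onto the
    integers modulo [2 ^ e.+1], whereas the expected number of killed surjections is eventually at
    most 3; Markov's inequality gives probability tending to 0 ([singular_hits], [hit_sum_bound],
    [prob_singular]). On singular matrices the weight stays bounded, so expectation and event
    probability can be compared ([expect_close]). *)

Section Expectation.

(** * Expectations over finitely many independent letters *)

Variable R : archiRealFieldType.

(** Independent letters with common weight [w]; total mass one is not built in and is assumed only
    where it matters. Until the passage to random variables, all probabilities are such finite
    sums. *)
Definition expect (I T : finType) (w : T -> R) (F : {ffun I -> T} -> R) : R :=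
  \sum_(g : {ffun I -> T}) (\prod_i w (g i)) * F g.

Section Basic.
Variables (I T : finType) (w : T -> R).
Hypothesis w_ge0 : forall t, 0 <= w t.

Lemma expect_weight_ge0 (g : {ffun I -> T}) : 0 <= \prod_i w (g i).
Proof. by apply: prodr_ge0. Qed.

Lemma le_expect (F G : {ffun I -> T} -> R) :
  (forall g, F g <= G g) -> expect w F <= expect w G.
Proof.
move=> FG; apply: ler_sum => g _; apply: ler_wpM2l => //.
exact: expect_weight_ge0.
Qed.

Lemma expect_ge0 (F : {ffun I -> T} -> R) :
  (forall g, 0 <= F g) -> 0 <= expect w F.
Proof.
by move=> F0; apply: sumr_ge0 => g _; rewrite mulr_ge0 ?expect_weight_ge0.
Qed.

Lemma eq_expect (F G : {ffun I -> T} -> R) : F =1 G -> expect w F = expect w G.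
Proof. by move=> FG; apply: eq_bigr => g _; rewrite FG. Qed.

Lemma expectZ (a : R) (F : {ffun I -> T} -> R) :
  expect w (fun g => a * F g) = a * expect w F.
Proof. by rewrite /expect mulr_sumr; apply: eq_bigr => g _; rewrite mulrCA. Qed.

Lemma expectD (F G : {ffun I -> T} -> R) :
  expect w (fun g => F g + G g) = expect w F + expect w G.
Proof. by rewrite -big_split; apply: eq_bigr => g _; rewrite mulrDr. Qed.

Lemma expect_sum (J : Type) (r : seq J) (Q : pred J) (F : J -> {ffun I -> T} -> R) :
  expect w (fun g => \sum_(j <- r | Q j) F j g)
  = \sum_(j <- r | Q j) expect w (F j).
Proof.
by rewrite exchange_big; apply: eq_bigr => g _; rewrite mulr_sumr.
Qed.

Lemma expect_prod (F : I -> T -> R) :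
  expect w (fun g => \prod_i F i (g i)) = \prod_i \sum_t w t * F i t.
Proof.
by rewrite bigA_distr_bigA; apply: eq_bigr => g _; rewrite big_split.
Qed.

Lemma expect_cst (a : R) : \sum_t w t = 1 -> expect w (fun _ : {ffun I -> T} => a) = a.
Proof.
move=> w1; rewrite /expect -mulr_suml -(bigA_distr_bigA (fun=> w)).
by rewrite big1 ?mul1r // => i _; apply: w1.
Qed.

End Basic.

Lemma expect_reindex (I J T : finType) (w : T -> R) (h : I -> J) (h' : J -> I)
    (F : {ffun J -> T} -> R) : cancel h h' -> cancel h' h ->
  expect w F = expect w (fun g : {ffun I -> T} => F [ffun j => g (h' j)]).
Proof.
move=> hK h'K; rewrite /expect.
rewrite (reindex (fun g : {ffun I -> T} => [ffun j => g (h' j)])) /=; last first.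
  exists (fun g : {ffun J -> T} => [ffun i => g (h i)]) => g _;
    by apply/ffunP => i; rewrite !ffunE ?hK ?h'K.
apply: eq_bigr => g _; congr (_ * _).
rewrite (reindex h) /=; first by apply: eq_bigr => i _; rewrite ffunE hK.
by exists h' => i _.
Qed.

Definition ffun_join (I J T : finType) (a : {ffun I -> T}) (b : {ffun J -> T}) :
  {ffun I + J -> T} := [ffun s => match s with inl i => a i | inr j => b j end].

Lemma expect_sumtype (I J T : finType) (w : T -> R) (F : {ffun I + J -> T} -> R) :
  expect w F = expect w (fun a : {ffun I -> T} =>
                 expect w (fun b : {ffun J -> T} => F (ffun_join a b))).
Proof.
rewrite /expect.
under [RHS]eq_bigr => a _ do rewrite mulr_sumr.
rewrite pair_big /=.
rewrite (reindex (fun p : {ffun I -> T} * {ffun J -> T} => ffun_join p.1 p.2)) /=.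
  apply: eq_bigr => -[a b] _ /=; rewrite mulrA; congr (_ * _).
  rewrite big_sumType /=; congr (_ * _); apply: eq_bigr => i _;
    by rewrite ffunE.
exists (fun g : {ffun I + J -> T} => ([ffun i => g (inl i)], [ffun j => g (inr j)])).
  by move=> [a b] _ /=; congr pair; apply/ffunP => i; rewrite !ffunE.
by move=> g _; apply/ffunP => -[i|j]; rewrite !ffunE.
Qed.

Lemma expect_ord0 (T : finType) (w : T -> R) (F : {ffun 'I_0 -> T} -> R) g0 :
  expect w F = F g0.
Proof.
rewrite /expect (bigD1 g0) //= big_ord0 mul1r big1 ?addr0 // => g.
by case/eqP; apply/ffunP => -[].
Qed.

Definition ffun_cons (n : nat) (T : finType) (a : T) (g : {ffun 'I_n -> T}) :
  {ffun 'I_n.+1 -> T} := [ffun i => oapp g a (unlift ord0 i)].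

Lemma ffun_cons0 n (T : finType) (a : T) (g : {ffun 'I_n -> T}) :
  ffun_cons a g ord0 = a.
Proof. by rewrite ffunE unlift_none. Qed.

Lemma ffun_consS n (T : finType) (a : T) (g : {ffun 'I_n -> T}) i :
  ffun_cons a g (lift ord0 i) = g i.
Proof. by rewrite ffunE liftK. Qed.

Lemma expect_ordS n (T : finType) (w : T -> R) (F : {ffun 'I_n.+1 -> T} -> R) :
  expect w F = \sum_a w a * expect w (fun g => F (ffun_cons a g)).
Proof.
rewrite /expect; under [RHS]eq_bigr => a _ do rewrite mulr_sumr.
rewrite pair_big /=.
rewrite (reindex (fun p : T * {ffun 'I_n -> T} => ffun_cons p.1 p.2)) /=.
  apply: eq_bigr => -[a b] _ /=; rewrite mulrA; congr (_ * _).
  rewrite big_ord_recl ffun_cons0; congr (_ * _); apply: eq_bigr => i _.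
  by rewrite ffun_consS.
exists (fun g : {ffun 'I_n.+1 -> T} => (g ord0, [ffun i => g (lift ord0 i)])).
  move=> [a b] _ /=; rewrite ffun_cons0; congr pair.
  by apply/ffunP => i; rewrite ffunE ffun_consS.
move=> g _; apply/ffunP => i /=; rewrite ffunE.
by case: unliftP => [j|] -> //=; rewrite ffunE.
Qed.

End Expectation.

(** * Random walks on finite abelian groups *)

Section ZpValues.
Variable N : nat.
Hypothesis N_gt1 : (1 < N)%N.

Lemma Zp_natr (k : nat) : nat_of_ord (k%:R : 'Z_N) = (k %% N)%N.
Proof. by rewrite val_Zp_nat. Qed.

Lemma Zp_natK (x : 'Z_N) : (x : nat)%:R = x.
Proof. exact: natr_Zp. Qed.

Lemma val_Zp_add (x y : 'Z_N) : nat_of_ord (x + y) = ((x + y) %% N)%N.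
Proof. by move: (Zp_cast N_gt1) => E; congr (_ %% _)%N. Qed.

Lemma Zp_natN : (N%:R : 'Z_N) = 0.
Proof. by rewrite -(Zp_nat_mod N_gt1) modnn. Qed.

End ZpValues.

Section Walk.
Variables (R : archiRealFieldType) (N : nat).
Hypothesis N_gt1 : (1 < N)%N.
Variable q : 'Z_N -> R.
Hypothesis q_ge0 : forall r, 0 <= q r.
Hypothesis q_sum1 : \sum_r q r = 1.

Section Operators.
Variable gT : finGroupType.
Hypothesis gT_abel : forall x y : gT, commute x y.
Hypothesis gT_exp : forall x : gT, (x ^+ N = 1)%g.

(** Averaging operator of one step of the walk, in which the letter [c] gets a random exponent. In
    an abelian group these operators commute, so the letters of a walk may be reordered. *)
Definition step (c : gT) (h : gT -> R) (x : gT) : R :=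
  \sum_r q r * h (x * c ^+ (r : nat))%g.

Definition walk (l : seq gT) (h : gT -> R) : gT -> R := foldr step h l.

Lemma walk_cat l1 l2 h : walk (l1 ++ l2) h = walk l1 (walk l2 h).
Proof. by rewrite /walk foldr_cat. Qed.

Lemma eq_step c h1 h2 : h1 =1 h2 -> step c h1 =1 step c h2.
Proof. by move=> h12 x; apply: eq_bigr => r _; rewrite h12. Qed.

Lemma stepC c d h : step c (step d h) =1 step d (step c h).
Proof.
move=> x; rewrite /step; under eq_bigr do rewrite mulr_sumr.
under [RHS]eq_bigr do rewrite mulr_sumr.
rewrite exchange_big; apply: eq_bigr => r _; apply: eq_bigr => s _.
by rewrite mulrCA -!mulgA; congr (_ * (_ * h (_ * _)%g)); apply: gT_abel.
Qed.

Lemma walk_step_comm l c h : walk l (step c h) =1 step c (walk l h).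
Proof.
elim: l => //= d l IH x; rewrite (eq_step _ IH).
exact: stepC.
Qed.

Lemma walk_perm l1 l2 h : perm_eq l1 l2 -> walk l1 h =1 walk l2 h.
Proof.
elim: l1 l2 => [|c l1 IH] l2.
  by move=> /perm_size /esym/eqP/nilP ->.
move=> P12.
have cl2 : c \in l2 by rewrite -(perm_mem P12) mem_head.
have /perm_to_rem P2 := cl2.
have P1 : perm_eq l1 (rem c l2) by rewrite -(perm_cons c) (perm_trans P12).
have [a [b E]] : exists a b, l2 = a ++ c :: b.
  by case/splitPr: cl2 => a b; exists a, b.
have P3 : perm_eq l1 (a ++ b).
  rewrite -(perm_cons c) (perm_trans P12) // E.
  by rewrite -cat1s perm_catCA.
move=> x /=; rewrite (eq_step _ (IH _ P3)) E !walk_cat /=.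
by rewrite -(walk_step_comm a).
Qed.

Lemma le_step c h1 h2 : (forall x, h1 x <= h2 x) ->
  forall x, step c h1 x <= step c h2 x.
Proof. by move=> h12 x; apply: ler_sum => r _; apply: ler_wpM2l. Qed.

Lemma step_cst c (a : R) : step c (fun=> a) =1 (fun=> a).
Proof. by move=> x; rewrite /step -mulr_suml q_sum1 mul1r. Qed.

(* [h] varies by at most [e] on each coset of [D]. *)
Definition osc (D : {set gT}) (h : gT -> R) (e : R) : Prop :=
  forall x d, d \in D -> h (x * d)%g - h x <= e.

Lemma osc_step D c h e : osc D h e -> osc D (step c h) e.
Proof.
move=> he x d dD; rewrite /step -sumrB.
rewrite -[leRHS]mul1r -q_sum1 mulr_suml; apply: ler_sum => r _.
rewrite -mulrBr ler_wpM2l //.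
rewrite -mulgA (gT_abel d) mulgA; exact: he.
Qed.

Lemma osc_walk D l h e : osc D h e -> osc D (walk l h) e.
Proof. by move=> he; elim: l => //= c l IH; apply: osc_step. Qed.

(* The product [\prod_i c_i ^+ r_i] is reached with positive probability. *)
Fixpoint reach (l : seq gT) (d : gT) : Prop :=
  if l is c :: l' then
    exists r : 'Z_N, 0 < q r /\ exists2 d', reach l' d' & d = (c ^+ (r : nat) * d')%g
  else d = 1%g.

Lemma reach_cat l1 l2 d1 d2 : reach l1 d1 -> reach l2 d2 ->
  reach (l1 ++ l2) (d1 * d2)%g.
Proof.
elim: l1 d1 => [|c l1 IH] d1 /=; first by move=> ->; rewrite mul1g.
move=> [r [qr [d' Hd' ->]]] H2; exists r; split=> //.
by exists (d' * d2)%g; [apply: IH | rewrite mulgA].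
Qed.

(** Some trajectory ending at [x * d] has weight at least [t ^+ size l]; on all others [h] is at
    most [b], because the walk stays in the coset of [D]. *)
Lemma walk_reach (t : R) l h x d b : 0 <= t -> t <= 1 ->
  (forall r, 0 < q r -> t <= q r) ->
  (forall D : {group gT}, d \in D -> [set c | c \in l] \subset D ->
    (forall y, y \in D -> h (x * y)%g <= b) ->
    reach l d -> walk l h x <= (1 - t ^+ size l) * b + t ^+ size l * h (x * d)%g).
Proof.
move=> t0 t1 tq.
elim: l x d => [|c l IH] x d D dD lD hb /=.
  by move=> ->; rewrite expr0 subrr mul0r add0r mul1r mulg1.
have cD : c \in D by apply: (subsetP lD); rewrite inE mem_head.
have lD' : [set c | c \in l] \subset D.
  by apply/subsetP => y; rewrite inE => yl; apply: (subsetP lD); rewrite inE in_cons yl orbT.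
move=> [r0 [qr0 [d' Hd' Ed]]].
have ub : forall r : 'Z_N, walk l h (x * c ^+ (r : nat))%g <= b.
  have W : forall l' y, [set c | c \in l'] \subset D -> y \in D -> walk l' h (x * y)%g <= b.
    elim=> [|c' l' IH'] y sD yD /=; first exact: hb.
    rewrite -(step_cst c' b x) /step; apply: ler_sum => r _; apply: ler_wpM2l => //.
    rewrite -mulgA; apply: IH'.
      by apply/subsetP => z; rewrite inE => zl; apply: (subsetP sD); rewrite inE in_cons zl orbT.
    rewrite groupM // groupX //; apply: (subsetP sD); by rewrite inE mem_head.
  by move=> r; apply: W => //; rewrite groupX.
have d'D : d' \in D by move: dD; rewrite Ed groupMl // groupX.
have hdb : h (x * d)%g <= b by apply: hb.
have main : walk l h (x * c ^+ (r0 : nat))%g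
    <= (1 - t ^+ size l) * b + t ^+ size l * h (x * d)%g.
  rewrite Ed mulgA; apply: (IH _ _ D) => // y yD.
  by rewrite -mulgA; apply: hb; rewrite groupM // groupX.
rewrite /step (bigD1 r0) //=.
apply: (@le_trans _ _ (q r0 * ((1 - t ^+ size l) * b + t ^+ size l * h (x * d)%g)
   + (1 - q r0) * b)).
  apply: lerD; first by apply: ler_wpM2l.
  have -> : 1 - q r0 = \sum_(r | r != r0) q r.
    by rewrite -q_sum1 (bigD1 r0) //= addrAC subrr add0r.
  rewrite mulr_suml.
  by apply: ler_sum => r _; apply: ler_wpM2l.
have tl0 : 0 <= t ^+ size l by apply: exprn_ge0.
have key : 0 <= (q r0 - t) * t ^+ size l * (b - h (x * d)%g).
  by rewrite !mulr_ge0 // subr_ge0 // tq.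
rewrite exprS; lra.
Qed.

(** Doeblin's contraction: from every point of a coset, the walk meets the point where [h] is
    minimal on that coset with weight at least [t ^+ size l]. *)
Lemma osc_reach (D : {group gT}) (t : R) l h e : 0 <= t -> t <= 1 ->
  (forall r, 0 < q r -> t <= q r) ->
  [set c | c \in l] \subset D -> (forall d, d \in D -> reach l d) ->
  osc D h e -> osc D (walk l h) ((1 - t ^+ size l) * e).
Proof.
move=> t0 t1 tq lD Hr he x d dD.
pose z := [arg min_(z < 1%g in D) h (x * z)%g]%O.
have [zD zmin] : z \in D /\ forall y, y \in D -> h (x * z)%g <= h (x * y)%g.
  rewrite /z; case: arg_minP => // i iD Hi; split=> //.
have hub y : y \in D -> h (x * y)%g <= h (x * z)%g + e.
  move=> yD; have := he (x * z)%g (z^-1 * y)%g; rewrite groupM ?groupV // => /(_ isT).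
  by rewrite -mulgA mulKVg; lra.
have lb : h (x * z)%g <= walk l h x.
  have W : forall l' y, [set c | c \in l'] \subset D -> y \in D ->
      h (x * z)%g <= walk l' h (x * y)%g.
    elim=> [|c' l' IH'] y sD yD /=; first exact: zmin.
    rewrite -(step_cst c' (h (x * z)%g) x) /step; apply: ler_sum => r _; apply: ler_wpM2l => //.
    rewrite -mulgA; apply: IH'.
      by apply/subsetP => u; rewrite inE => zl; apply: (subsetP sD); rewrite inE in_cons zl orbT.
    rewrite groupM // groupX //; apply: (subsetP sD); by rewrite inE mem_head.
  by have := W l 1%g lD (group1 D); rewrite mulg1.
have dzD : (d^-1 * z)%g \in D by rewrite groupM // groupV.
have /(_ (h (x * z)%g + e)) := @walk_reach t l h (x * d)%g (d^-1 * z)%g _ t0 t1 tq D dzD lD _ (Hr _ dzD).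
have ux : forall y, y \in D -> h (x * d * y)%g <= h (x * z)%g + e.
  by move=> y yD; rewrite -mulgA; apply: hub; rewrite groupM.
move=> /(_ ux); rewrite -mulgA mulKVg => ub.
have tl0 : 0 <= t ^+ size l by apply: exprn_ge0.
nra.
Qed.

Lemma expg_Zp_add (c : gT) (r s : 'Z_N) :
  (c ^+ (r + s : 'Z_N)%R = c ^+ (r : nat) * c ^+ (s : nat))%g.
Proof.
rewrite -expgD val_Zp_add //.
by rewrite {2}(divn_eq (r + s) N) expgD mulnC expgM gT_exp expg1n mul1g.
Qed.

Lemma reach_nseq (c : gT) (s : seq 'Z_N) : all (fun r => 0 < q r) s ->
  reach (nseq (size s) c) (c ^+ ((\sum_(r <- s) r)%R : 'Z_N))%g.
Proof.
elim: s => [|r s IH] /=; first by rewrite big_nil expg0.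
move=> /andP[qr qs]; exists r; split=> //; exists (c ^+ ((\sum_(r <- s) r)%R : 'Z_N))%g.
  exact: IH.
by rewrite big_cons expg_Zp_add.
Qed.

(** Every letter is repeated [L] times so that its exponents can add up to any residue; a block then
    reaches the whole subgroup generated by its letters. *)
Definition block (L : nat) (ys : seq gT) := flatten [seq nseq L y | y <- ys].

Lemma reach_block L ys d :
  (forall x : 'Z_N, exists2 s, size s = L /\ all (fun r => 0 < q r) s & \sum_(r <- s) r = x) ->
  d \in <<[set y | y \in ys]>>%g -> reach (block L ys) d.
Proof.
move=> HL; elim: ys d => [|y ys IH] d /=.
  have -> : [set y | y \in Nil gT] = set0 by apply/setP => z; rewrite !inE.
  by rewrite gen0 => /set1P.
have -> : [set z | z \in y :: ys] = [set y] :|: [set z | z \in ys].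
  by apply/setP => z; rewrite !inE.
rewrite -joingE -joing_idr -joing_idl cent_joinEl; last first.
  by apply/centsP => u _ v _; apply: gT_abel.
case/mulsgP => u v /cycleP[k ->] vY ->.
apply: reach_cat; last exact: IH.
have [s [sz qs] sE] := HL (inZp k); rewrite -sz.
have := reach_nseq y qs; rewrite sE /=.
suff -> : (y ^+ (inZp k : 'Z_N))%g = (y ^+ k)%g by [].
have -> : nat_of_ord (inZp k : 'Z_N) = (k %% N)%N by rewrite /= Zp_cast.
by rewrite {2}(divn_eq k N) expgD mulnC expgM gT_exp expg1n mul1g.
Qed.

Lemma size_block L ys : size (block L ys) = (L * size ys)%N.
Proof.
by rewrite /block size_flatten /shape -map_comp; elim: ys => [|y ys IH] /=;
  rewrite ?muln0 // size_nseq IH mulnS.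
Qed.

Lemma count_block L ys z : uniq ys ->
  count_mem z (block L ys) = (L * (z \in ys))%N.
Proof.
elim: ys => [|y ys IH] /=; first by rewrite muln0.
move=> /andP[yN uys]; rewrite count_cat IH // count_nseq in_cons /= eq_sym.
case: eqVneq => [->|_] /=; last by rewrite mul0n.
by rewrite (negPf yN) muln0 addn0 mulnC.
Qed.

Lemma sub_count_perm (a l : seq gT) : (forall y, count_mem y a <= count_mem y l)%N ->
  exists r, perm_eq l (a ++ r).
Proof.
move=> /count_subseqP[b bl ab].
have [r Hr] : exists r, perm_eq l (b ++ r).
  elim: l b bl {ab} => [|y l IH] [|z b] //=; first by exists [::].
    by move=> _; exists (y :: l).
  case: eqVneq => [->|_] /IH [r Hr].
    by exists r; rewrite perm_cons.
  exists (y :: r).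
  have := perm_catCA (z :: b) [:: y] r => /permPl; rewrite perm_sym => P2.
  by apply: perm_trans P2; rewrite /= perm_cons.
exists r; rewrite (perm_trans Hr) // perm_cat2r perm_sym //.
Qed.

(* Group the letters into [s %/ L] blocks, each of which reaches all of the
   subgroup generated by the letters occurring [s] times: every block shrinks
   the oscillation by a fixed factor. *)
Lemma osc_popular (c L s : nat) (t : R) l h e : 0 <= t -> t <= 1 -> (0 < L)%N ->
  (forall r, 0 < q r -> t <= q r) ->
  (forall x : 'Z_N, exists2 s, size s = L /\ all (fun r => 0 < q r) s & \sum_(r <- s) r = x) ->
  (#|gT| <= c)%N -> 0 <= e ->
  osc <<[set y | (s <= count_mem y l)%N]>>%g h e ->
  osc <<[set y | (s <= count_mem y l)%N]>>%g (walk l h) ((1 - t ^+ (L * c)) ^+ (s %/ L) * e).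
Proof.
move=> t0 t1 L0 tq HL cc e0; set Y := [set y | _].
set D := <<Y>>%g => he.
set w := block L (enum Y).
have wY : [set y | y \in enum Y] = Y by apply/setP => y; rewrite inE mem_enum.
have [r Hr] : exists r, perm_eq l (flatten (nseq (s %/ L) w) ++ r).
  apply: sub_count_perm => y.
  have -> : count_mem y (flatten (nseq (s %/ L) w)) = (s %/ L * (L * (y \in Y)))%N.
    elim: (s %/ L)%N => //= k IH.
    by rewrite count_cat IH count_block ?enum_uniq // mem_enum mulSn.
  case: (boolP (y \in Y)) => [|_]; last by rewrite !muln0.
  by rewrite inE muln1; apply: leq_trans; rewrite leq_trunc_div.
have step1 k : osc D (walk (flatten (nseq k w)) (walk r h)) ((1 - t ^+ (L * c)) ^+ k * e).
  elim: k => [|k IH] /=; first by rewrite expr0 mul1r; apply: osc_walk.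
  have bnd : (1 - t ^+ size w) * ((1 - t ^+ (L * c)) ^+ k * e)
      <= (1 - t ^+ (L * c)) ^+ k.+1 * e.
    rewrite exprS -mulrA ler_wpM2r //.
      by rewrite mulr_ge0 // exprn_ge0 // subr_ge0 exprn_ile1.
    rewrite lerD2l lerN2; apply: ler_wiXn2l => //.
    rewrite size_block leq_mul2l -cardE; apply/orP; right.
    by rewrite (leq_trans _ cc) // max_card.
  rewrite walk_cat => x d dD; apply: le_trans bnd.
  apply: (@osc_reach [group of D]) => // [|u uD].
    apply/subsetP => y; rewrite inE => yw; apply: mem_gen.
    case/flattenP: yw => a /mapP[z]; rewrite mem_enum => zY ->.
    by move=> /nseqP[-> _].
  by apply: reach_block => //; rewrite wY.
move=> x d dD; rewrite !(walk_perm _ Hr) !walk_cat.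
exact: step1.
Qed.

End Operators.

Section Support.
Variable alpha : R.
Hypothesis alpha_gt0 : 0 < alpha.
Hypothesis q_bal : forall p, prime p -> (p %| N)%N -> forall r : nat,
  \sum_(x : 'Z_N | (x %% p)%N == r) q x <= 1 - alpha.

(** By Bezout the subgroup contains the gcd [d] of [N] and all the differences. If [d] exceeded 1, a
    prime [p] dividing it would confine all the mass to the class of [x0] modulo [p], against
    balance. *)
Lemma support_gen (x0 : 'Z_N) : 0 < q x0 ->
  <<[set x - x0 | x in [set x | 0 < q x]]>>%g = [set: 'Z_N].
Proof.
move=> qx0; set A := [set _ | _ in _]; set H := <<A>>%g.
have HD x y : x \in H -> y \in H -> x + y \in H by apply: groupM.
have HN x : x \in H -> - x \in H by rewrite -FinRing.zmodVgE groupV.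
have H0 : 0 \in H by apply: group1.
have HM x k : x \in H -> x *+ k \in H.
  by move=> xH; elim: k => [|k IH]; rewrite ?mulr0n // mulrS HD.
have Hg a b : a%:R \in H -> b%:R \in H -> (gcdn a b)%:R \in H.
  case: (posnP a) => [->|a0] aH bH; first by rewrite gcd0n.
  have [u _ /dvdnP[v E]] := Bezoutl b a0.
  have -> : (gcdn a b)%:R = a%:R *+ v - b%:R *+ u :> 'Z_N.
    apply: (addIr (b%:R *+ u)); rewrite subrK -!mulrnA -mulrnDr.
    by rewrite [(b * u)%N]mulnC E mulnC.
  by apply: HD; [apply: HM | apply: HN; apply: HM].
pose d := \big[gcdn/N]_(x in A) (x : nat).
have dH : d%:R \in H.
  rewrite /d; apply: (big_ind (fun k => k%:R \in H)).
  - by rewrite Zp_natN.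
  - exact: Hg.
  - by move=> x xA; rewrite Zp_natK mem_gen.
have dN : (d %| N)%N.
  rewrite /d; elim: index_enum => [|a r IH]; first by rewrite big_nil.
  by rewrite big_cons; case: ifP => // _; rewrite (dvdn_trans _ IH) // dvdn_gcdr.
have dA x : x \in A -> (d %| x)%N.
  move=> xA; rewrite /d (bigD1 x) //=; exact: dvdn_gcdl.
have d0 : (0 < d)%N by rewrite (dvdn_gt0 _ dN) // ltnW.
case: (ltngtP d 1%N) => [|d1|d1].
- by rewrite ltnS leqNgt d0.
- have pp := pdiv_prime d1; set p := pdiv d in pp.
  have pd : (p %| d)%N := pdiv_dvd d.
  have := q_bal pp (dvdn_trans pd dN) (x0 %% p)%N.
  suff -> : \sum_(x : 'Z_N | (x %% p)%N == (x0 %% p)%N) q x = 1.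
    by rewrite lerBrDr gerDl leNgt alpha_gt0.
  rewrite -q_sum1 [RHS](bigID (fun x : 'Z_N => (x %% p)%N == (x0 %% p)%N)) /=.
  rewrite [X in _ + X]big1 ?addr0 // => x xp.
  apply: contraNeq xp => qx.
  have xA : x - x0 \in A.
    by apply: imset_f; rewrite inE lt_neqAle eq_sym qx q_ge0.
  have /dvdnP[k Ek] := dvdn_trans pd (dA _ xA).
  have -> : nat_of_ord x = (((x - x0)%R + x0) %% N)%N by rewrite -val_Zp_add // subrK.
  by rewrite modn_dvdm ?(dvdn_trans pd) // Ek modnMDl.
apply/setP => x; rewrite inE -[x]Zp_natK.
by have := HM _ (x : nat) dH; rewrite d1 mulr1n.
Qed.

(** Write [x - x0 *+ L] as a sum of differences [r - x0] and pad with copies of [x0]. The padding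
    contributes zero differences, so one length [L] serves all residues. *)
Lemma support_reach : exists2 L, (0 < L)%N & forall x : 'Z_N,
  exists2 s, size s = L /\ all (fun r => 0 < q r) s & \sum_(r <- s) r = x.
Proof.
have [x0 qx0] : exists x0, 0 < q x0.
  apply/existsP; apply: contraT; rewrite negb_exists => /forallP h.
  suff : \sum_r q r = 0 by rewrite q_sum1 => /eqP; rewrite oner_eq0.
  by apply: big1 => r _; apply/eqP; rewrite eq_le q_ge0 leNgt h.
have H x : exists n, exists2 s : seq 'Z_N, size s = n /\ all (fun r => 0 < q r) s &
    \sum_(r <- s) (r - x0) = x.
  have : x \in [set: 'Z_N] by rewrite inE.
  rewrite -(support_gen qx0) => /gen_prodgP[n [c Hc ->]]; exists n.
  have Hc' i : exists r, (0 < q r) && (c i == r - x0).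
    by have /imsetP[r] := Hc i; rewrite inE => qr ->; exists r; rewrite qr eqxx.
  exists [seq xchoose (Hc' i) | i <- enum 'I_n].
    rewrite size_map size_enum_ord; split=> //.
    by apply/allP => _ /mapP[i _ ->]; have /andP[] := xchooseP (Hc' i).
  rewrite big_map big_enum /=; apply: eq_bigr => i _.
  by have /andP[_ /eqP] := xchooseP (Hc' i).
have /fin_all_exists [n Hn] := H.
exists (\max_x n x).+1 => // x; set L := (\max_x n x).+1.
set y := x - x0 *+ L.
have [s [sz qs] sE] := Hn y.
have sL : (n y <= L)%N by apply: ltnW; rewrite ltnS; apply: leq_bigmax.
exists (s ++ nseq (L - size s) x0).
  rewrite size_cat size_nseq sz subnKC // all_cat qs; split=> //=.
  by apply/allP => _ /nseqP[-> _].
rewrite big_cat /= big_nseq iter_addr_0.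
move: sE; rewrite sumrB big_const_seq count_predT iter_addr_0 => /eqP.
rewrite subr_eq => /eqP ->.
by rewrite -addrA sz -mulrnDr subnKC // /y subrK.
Qed.

Lemma q_min : exists t : R, [/\ 0 < t, t <= 1 & forall r, 0 < q r -> t <= q r].
Proof.
(* All weights are at most 1, so the product of the positive ones is below each of them. *)
exists (\prod_(r | 0 < q r) q r).
have q1 r : q r <= 1.
  by rewrite -q_sum1 (bigD1 r) //= lerDl sumr_ge0.
split; first by apply: prodr_gt0.
  by apply: prodr_ile1 => r _; rewrite q_ge0 q1.
move=> r qr; rewrite (bigD1 r) //= -[leRHS]mulr1 ler_wpM2l //.
by apply: prodr_ile1 => s _; rewrite q_ge0 q1.
Qed.

(** The point is uniformity: [rho] and [L] depend on the law and on the bound [c] for the order of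
    the group, but not on the group, the letters or their number. *)
Lemma osc_walk_popular (c : nat) : exists2 rho : R, 0 <= rho < 1 &
  exists2 L, (0 < L)%N &
  forall (gT : finGroupType), (forall x y : gT, commute x y) ->
    (forall x : gT, x ^+ N = 1)%g -> (#|gT| <= c)%N ->
  forall (s : nat) (l : seq gT) h e, 0 <= e ->
  osc <<[set y | (s <= count_mem y l)%N]>>%g h e ->
  osc <<[set y | (s <= count_mem y l)%N]>>%g (walk l h) (rho ^+ (s %/ L) * e).
Proof.
have [t [t0 t1 tq]] := q_min.
have [L L0 HL] := support_reach.
have tt : 0 < t ^+ (L * c) <= 1.
  by rewrite exprn_gt0 //= exprn_ile1 // ltW.
exists (1 - t ^+ (L * c)); first by apply/andP; split; lra.
exists L => // gT cT eT gc s l h e e0 he.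
by apply: osc_popular => //; apply: ltW.
Qed.

End Support.
End Walk.

(** * Linear combinations of independent balanced entries *)

Section Columns.
Variables (R : archiRealFieldType) (N : nat).
Hypothesis N_gt1 : (1 < N)%N.
Variable q : 'Z_N -> R.
Hypothesis q_ge0 : forall r, 0 <= q r.
Hypothesis q_sum1 : \sum_r q r = 1.

Definition wcol (n : nat) (v : 'cV['Z_N]_n) : R := \prod_i q (v i ord0).

Lemma wcol_ge0 n (v : 'cV['Z_N]_n) : 0 <= wcol v.
Proof. exact: prodr_ge0. Qed.

Lemma sum_wcol n (F : 'cV['Z_N]_n -> R) :
  \sum_v wcol v * F v = expect q (fun u : {ffun 'I_n -> 'Z_N} => F (\col_i u i)).
Proof.
rewrite /expect (reindex (fun u : {ffun 'I_n -> 'Z_N} => \col_i u i)) /=.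
  apply: eq_bigr => u _; congr (_ * _); apply: eq_bigr => i _.
  by rewrite mxE.
exists (fun v : 'cV['Z_N]_n => [ffun i => v i ord0]) => v _.
  by apply/ffunP => i; rewrite ffunE mxE.
by apply/colP => i; rewrite mxE ffunE.
Qed.

Lemma sum_wcol1 n : \sum_(v : 'cV['Z_N]_n) wcol v = 1.
Proof.
under eq_bigr do rewrite -[wcol _]mulr1.
by rewrite (sum_wcol (fun=> 1)) expect_cst.
Qed.

Section Group.
Variable gT : finGroupType.
Hypothesis gT_abel : forall x y : gT, commute x y.
Hypothesis gT_exp : forall x : gT, (x ^+ N = 1)%g.

Definition gprod n (f : 'I_n -> gT) (v : 'cV['Z_N]_n) : gT :=
  (\prod_i f i ^+ (v i ord0 : nat))%g.

Lemma walk_law n (f : 'I_n -> gT) h x :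
  \sum_(v : 'cV['Z_N]_n) wcol v * h (x * gprod f v)%g
  = walk q [seq f i | i <- enum 'I_n] h x.
Proof.
rewrite (sum_wcol (fun v => h (x * gprod f v)%g)).
have E (u : {ffun 'I_n -> 'Z_N}) :
    gprod f (\col_i u i) = (\prod_i f i ^+ (u i : nat))%g.
  by apply: eq_bigr => i _; rewrite mxE.
under eq_expect do rewrite E.
elim: n f x {E} => [|n IH] f x.
  rewrite (expect_ord0 _ _ [ffun i : 'I_0 => 0]) big_ord0 mulg1.
  by rewrite (size0nil (_ : size [seq f i | i <- enum 'I_0] = 0%N)) // size_map size_enum_ord.
rewrite expect_ordS enum_ordSl /= /step; apply: eq_bigr => a _.
congr (_ * _); rewrite -map_comp /= -(IH (fun i => f (lift ord0 i))).
apply: eq_bigr => g _; congr (_ * h _).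
rewrite big_ord_recl ffun_cons0 mulgA; congr (_ * _)%g.
by apply: eq_bigr => i _; rewrite ffun_consS.
Qed.

Definition prg n (f : 'I_n -> gT) (x : gT) : R :=
  \sum_(v | gprod f v == x) wcol v.

Lemma prg_walk n (f : 'I_n -> gT) (x y : gT) :
  prg f (x^-1 * y)%g = walk q [seq f i | i <- enum 'I_n] (fun z => (z == y)%:R) x.
Proof.
rewrite -walk_law /prg [RHS](bigID (fun v => gprod f v == (x^-1 * y)%g)) /=.
rewrite [X in _ + X]big1 ?addr0; last first.
  move=> v /negPf vN; suff -> : (x * gprod f v == y)%g = false by rewrite mulr0.
  by apply: contraFF vN => /eqP <-; rewrite mulKg.
by apply: eq_bigr => v /eqP ->; rewrite mulKVg eqxx mulr1.
Qed.

Lemma prg_ge0 n (f : 'I_n -> gT) x : 0 <= prg f x.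
Proof. by apply: sumr_ge0 => v _; apply: wcol_ge0. Qed.

Lemma sum_prg n (f : 'I_n -> gT) (A : {set gT}) :
  \sum_(x in A) prg f x = \sum_(v | gprod f v \in A) wcol v.
Proof.
rewrite /prg (partition_big (gprod f) (mem A)) //=.
apply: eq_bigr => x xA; apply: eq_bigl => v.
by case: eqP => [->|]; rewrite ?xA ?andbF.
Qed.

Definition popular n (f : 'I_n -> gT) (s : nat) : {set gT} :=
  [set y | (s <= #|[set i | f i == y]|)%N].

Lemma count_mem_codom n (f : 'I_n -> gT) y :
  count_mem y [seq f i | i <- enum 'I_n] = #|[set i | f i == y]|.
Proof.
rewrite -sum1_count big_map big_enum_cond -sum1_card.
by apply: eq_bigl => i; rewrite inE.
Qed.

End Group.

Section Equidistribution.
Variable alpha : R.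
Hypothesis alpha_gt0 : 0 < alpha.
Hypothesis q_bal : forall p, prime p -> (p %| N)%N -> forall r : nat,
  \sum_(x : 'Z_N | (x %% p)%N == r) q x <= 1 - alpha.

Lemma alpha_le1 : alpha <= 1.
Proof.
have H := q_bal (pdiv_prime N_gt1) (pdiv_dvd N) 0%N.
by rewrite -subr_ge0; apply: le_trans H; apply: sumr_ge0.
Qed.

(** Letters repeated many times make the law almost invariant under the subgroup they generate:
    apply the contraction to the indicator of one point. *)
Lemma prg_popular (c : nat) : exists2 rho : R, 0 <= rho < 1 &
  exists2 L, (0 < L)%N &
  forall (gT : finGroupType), (forall x y : gT, commute x y) ->
    (forall x : gT, x ^+ N = 1)%g -> (#|gT| <= c)%N ->
  forall (n s : nat) (f : 'I_n -> gT) x d, d \in <<popular f s>>%g ->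
  `|prg f (x * d)%g - prg f x| <= rho ^+ (s %/ L).
Proof.
have [rho rho01 [L L0 H]] := osc_walk_popular N_gt1 q_ge0 q_sum1 alpha_gt0 q_bal c.
exists rho => //; exists L => // gT cT eT gc n s f x d dD.
have := H _ cT eT gc s [seq f i | i <- enum 'I_n] (fun z => (z == 1%g)%:R) 1 ler01.
have -> : [set y | (s <= count_mem y [seq f i | i <- enum 'I_n])%N] = popular f s.
  by apply/setP => y; rewrite !inE count_mem_codom.
move=> /(_ _) hosc.
have {}hosc : osc <<popular f s>>%g
   (walk q [seq f i | i <- enum 'I_n] (fun z : gT => (z == 1%g)%:R)) (rho ^+ (s %/ L)).
  rewrite -[_ ^+ _]mulr1; apply: hosc => y e eD.
  by case: eqP => _; case: eqP => _ /=; lra.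
have E y : prg f y = walk q [seq f i | i <- enum 'I_n] (fun z : gT => (z == 1%g)%:R) y^-1%g.
  by rewrite -prg_walk // invgK mulg1.
rewrite ler_norml; apply/andP; split; last first.
  rewrite !E invMg (cT d^-1%g); apply: hosc; by rewrite groupV.
rewrite lerNl opprB !E.
have -> : (x^-1 = (x * d)^-1 * d)%g by rewrite invMg -mulgA (cT x^-1%g) mulgA mulVg mul1g.
exact: hosc.
Qed.

(** Condition on all coordinates but [i0]. To land in the given coset, the remaining exponent must
    lie in one class modulo the order of [f i0] modulo [D], hence in one class modulo a prime
    divisor of that order, which divides [N]. *)
Lemma prg_coset_escape (gT : finGroupType) (D : {group gT}) n (f : 'I_n -> gT) x i0 :
  (forall x y : gT, commute x y) -> (forall x : gT, x ^+ N = 1)%g ->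
  f i0 \notin D -> \sum_(d in D) prg f (x * d)%g <= 1 - alpha.
Proof.
move=> cT eT fD.
set l := [seq f i | i <- enum 'I_n].
have nD y : y \in 'N(D)%g.
  apply: (subsetP (cent_sub D)); apply/centP => z _; exact: cT.
pose h (z : gT) : R := ((z^-1 * x)%g \in D)%:R.
have -> : \sum_(d in D) prg f (x * d)%g = walk q l h 1%g.
  rewrite -walk_law.
  have -> : \sum_(d in D) prg f (x * d)%g = \sum_(y in (x *: D)%g) prg f y.
    by rewrite -lcosetE big_imset //= => a b _ _ /mulgI.
  rewrite sum_prg big_mkcond; apply: eq_bigr => v _.
  rewrite /h mul1g mem_lcoset -groupV invMg invgK.
  by case: (_ \in _); rewrite ?mulr1 ?mulr0.
(* Letters commute, so [f i0] may be the first to act on [h]; the bound it gives survives the later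
   averaging. *)
have [l' Hl] : exists l', perm_eq l (l' ++ [:: f i0]).
  exists (rem (f i0) l); rewrite perm_sym perm_catC perm_sym; apply: perm_to_rem.
  by apply: map_f; rewrite mem_enum.
rewrite (walk_perm q cT _ Hl) walk_cat /=.
suff W z : step q (f i0) h z <= 1 - alpha.
  elim: l' {Hl} 1%g => [|c l' IH] y //=.
  rewrite -(step_cst q_sum1 c (1 - alpha) y); apply: le_step => // z; exact: IH.
rewrite /step.
have [r0 hr0|hN] := pickP (fun r : 'Z_N => ((z * f i0 ^+ (r : nat))^-1 * x)%g \in D); last first.
  by rewrite big1 => [|r _]; rewrite /h ?hN ?mulr0 // subr_ge0 alpha_le1.
set m := (#[coset D (f i0)])%g.
have m1 : m != 1%N.
  rewrite /m order_eq1; apply: contra fD => /eqP E.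
  by apply: coset_idr.
have mN : (m %| N)%N by rewrite order_dvdn -morphX // eT morph1.
have m0 : (1 < m)%N by rewrite ltn_neqAle eq_sym m1 order_gt0.
have pm := pdiv_dvd m.
apply: le_trans (q_bal (pdiv_prime m0) (dvdn_trans pm mN) (r0 %% pdiv m)%N).
rewrite [leRHS]big_mkcond; apply: ler_sum => r _.
case: ifP => [_|/negP rN]; first by rewrite ler_piMr // /h; case: (_ \in _); rewrite ?lexx ?ler01.
rewrite /h; case: (boolP (_ \in D)) => hr; last by rewrite mulr0.
case: rN; apply/eqP.
have : (coset D (f i0) ^+ (r : nat) == coset D (f i0) ^+ (r0 : nat))%g.
  rewrite -!morphX //.
  apply/eqP.
  have Dr : (((z * f i0 ^+ (r0 : nat))^-1 * x)^-1 * ((z * f i0 ^+ (r : nat))^-1 * x) \in D)%g.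
    by rewrite groupM // groupV.
  have Er : (((z * f i0 ^+ (r0 : nat))^-1 * x)^-1 * ((z * f i0 ^+ (r : nat))^-1 * x)
     = f i0 ^+ (r0 : nat) * (f i0 ^+ (r : nat))^-1)%g.
    rewrite invMg invgK (cT x^-1%g) (cT _^-1%g x) mulgA mulgKV.
    by rewrite (cT z) (cT z) [((_ * z)^-1)%g]invMg mulgA mulgK.
  move: Dr; rewrite Er => Dr.
  have /mker : (f i0 ^+ (r0 : nat) * (f i0 ^+ (r : nat))^-1)%g \in ('ker (coset D))%g.
    by rewrite ker_coset.
  by rewrite morphM ?morphV ?nD // => /eqP; rewrite -eq_mulgV1 => /eqP ->.
rewrite eq_expg_mod_order -/m => /eqP E.
rewrite -(modn_dvdm r pm) -(modn_dvdm r0 pm); by rewrite E.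
Qed.

End Equidistribution.
End Columns.

(** * Eventual inequalities and geometric decay *)

Definition eventually (P : nat -> Prop) : Prop :=
  exists n0, forall n, (n0 <= n)%N -> P n.

Lemma eventuallyI (P Q : nat -> Prop) :
  eventually P -> eventually Q -> eventually (fun n => P n /\ Q n).
Proof.
move=> [a Pa] [b Qb]; exists (maxn a b) => n; rewrite geq_max => /andP[an bn].
by split; [apply: Pa | apply: Qb].
Qed.

Lemma eventually_impl (P Q : nat -> Prop) :
  (forall n, P n -> Q n) -> eventually P -> eventually Q.
Proof. by move=> PQ [a Pa]; exists a => n an; apply: PQ; apply: Pa. Qed.

Lemma eventually_ge m : eventually (fun n => (m <= n)%N).
Proof. by exists m. Qed.

Section Decay.
Variable R : archiRealFieldType.

Lemma bernoulli (d : R) m : -1 <= d -> 1 + d *+ m <= (1 + d) ^+ m.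
Proof.
move=> d1; elim: m => [|m IH]; first by rewrite mulr0n expr0 addr0.
rewrite exprS; apply: le_trans (_ : (1 + d) * (1 + d *+ m) <= _); last first.
  by rewrite ler_wpM2l //; lra.
rewrite mulrS -[d *+ m]mulr_natl.
have : 0 <= m%:R * (d * d) :> R by rewrite mulr_ge0 // -expr2 sqr_ge0.
lra.
Qed.

Lemma expr_decay (rho : R) (e : R) : 0 <= rho -> rho < 1 -> 0 < e ->
  eventually (fun n => rho ^+ n <= e).
Proof.
move=> r0 r1 e0.
have [->|rn0] := eqVneq rho 0.
  by exists 1%N => -[|n] // _; rewrite expr0n /= ltW.
have rp : 0 < rho by rewrite lt_neqAle eq_sym rn0.
pose d := rho^-1 - 1.
have d0 : 0 < d by rewrite subr_gt0 invf_gt1.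
exists (Num.Def.archi_bound (e^-1 / d)) => n hn.
have H1 : e^-1 / d < n%:R.
  apply: lt_le_trans (archi_boundP _) _; first by rewrite divr_ge0 ?invr_ge0 // ltW.
  by rewrite ler_nat.
have H2 : 1 + d *+ n <= rho ^- n.
  have -> : rho ^- n = (1 + d) ^+ n by rewrite /d addrC subrK exprVn.
  by apply: bernoulli; lra.
have H3 : e^-1 <= rho ^- n.
  apply: le_trans H2; rewrite ltr_pdivrMr // in H1; rewrite -mulr_natl; lra.
by rewrite -lef_pV2 // posrE ?exprn_gt0.
Qed.

(** Bernoulli bounds [k%:R * rho ^+ k] uniformly in [k]; splitting the exponent into two halves
    leaves a spare factor [rho ^+ k]. *)
Lemma mul_expr_decay (rho : R) (e : R) : 0 <= rho -> rho < 1 -> 0 < e ->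
  eventually (fun n => n%:R * rho ^+ n <= e).
Proof.
move=> r0 r1 e0.
have [->|rn0] := eqVneq rho 0.
  by exists 1%N => -[|n] // _; rewrite expr0n /= mulr0 ltW.
have rp : 0 < rho by rewrite lt_neqAle eq_sym rn0.
pose d := rho^-1 - 1.
have d0 : 0 < d by rewrite subr_gt0 invf_gt1.
have bnd k : k%:R * rho ^+ k <= d^-1.
  have H2 : 1 + d *+ k <= rho ^- k.
    have -> : rho ^- k = (1 + d) ^+ k by rewrite /d addrC subrK exprVn.
    by apply: bernoulli; lra.
  rewrite -ler_pdivlMr ?exprn_gt0 // mulrC ler_pdivlMr // mulrC mulr_natr; lra.
pose C := 2 * d^-1 + 1.
have C0 : 0 < C by rewrite /C addr_gt0 // mulr_gt0 // invr_gt0.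
have [k0 H] := expr_decay r0 r1 (divr_gt0 e0 C0).
exists (k0 * 2)%N => n hn; set k := (n %/ 2)%N.
have kk : (k0 <= k)%N by rewrite /k leq_divRL.
have /(_ _ kk) := H; rewrite ler_pdivlMr // => Hk.
apply: le_trans Hk.
have E : n = (k + k + n %% 2)%N by rewrite addnn -muln2 /k -divn_eq.
have rk : 0 <= rho ^+ k by rewrite exprn_ge0.
have r1' m : rho ^+ m <= 1 by rewrite exprn_ile1 // ltW.
have step1 : rho ^+ n <= rho ^+ k * rho ^+ k.
  by rewrite {1}E exprD exprD ler_piMr // mulr_ge0.
have nk : n%:R <= 2 * k%:R + 1 :> R.
  have : (n <= 2 * k + 1)%N by have := ltn_pmod n (isT : 0 < 2)%N; lia.
  by rewrite -(ler_nat R) natrD natrM.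
have p1 : n%:R * rho ^+ n <= (2 * k%:R + 1) * (rho ^+ k * rho ^+ k).
  by apply: ler_pM => //; rewrite exprn_ge0.
apply: le_trans p1 _.
have -> : (2 * k%:R + 1) * (rho ^+ k * rho ^+ k) = rho ^+ k * (2 * (k%:R * rho ^+ k) + rho ^+ k).
  by ring.
apply: ler_wpM2l => //.
have := bnd k; have := r1' k; rewrite /C; lra.
Qed.

Lemma mul_expr_div_decay (rho : R) (b : nat) (e : R) : 0 <= rho -> rho < 1 ->
  (0 < b)%N -> 0 < e -> eventually (fun n => n%:R * rho ^+ (n %/ b) <= e).
Proof.
move=> r0 r1 b0 e0.
have b0' : 0 < (2 * b)%:R :> R by rewrite ltr0n muln_gt0.
have [m0 H] := mul_expr_decay r0 r1 (divr_gt0 e0 b0').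
exists (maxn m0 1 * b)%N => n hn.
have nb : (maxn m0 1 <= n %/ b)%N by rewrite leq_divRL.
have /H : (m0 <= n %/ b)%N by apply: leq_trans nb; rewrite leq_maxl.
rewrite ler_pdivlMr //; apply: le_trans.
rewrite mulrAC ler_wpM2r ?exprn_ge0 // -natrM ler_nat.
have n1 : (1 <= n %/ b)%N by apply: leq_trans nb; rewrite leq_maxr.
have := divn_eq n b; have := ltn_pmod n b0; move: n1.
set k := (n %/ b)%N; set r := (n %% b)%N => n1 rb E.
nia.
Qed.

Lemma expr_div_decay (rho : R) (b : nat) (e : R) : 0 <= rho -> rho < 1 ->
  (0 < b)%N -> 0 < e -> eventually (fun n => rho ^+ (n %/ b) <= e).
Proof.
move=> r0 r1 b0 e0; have [m Hm] := expr_decay r0 r1 e0.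
by exists (m * b)%N => n hn; apply: Hm; rewrite leq_divRL.
Qed.

(** A large block length [b] makes [y * beta ^+ b] at most one half: growth once per block loses
    against decay at every step. *)
Lemma balanced_decay (y beta : R) : 0 <= beta -> beta < 1 -> 1 <= y ->
  exists2 b0, (0 < b0)%N & forall b, (b0 <= b)%N -> forall e, 0 < e ->
    eventually (fun n => y ^+ (n %/ b) * beta ^+ n <= e).
Proof.
move=> r0 r1 y1.
have y0 : 0 < y by apply: lt_le_trans y1.
have h2 : 0 < (2 * y)^-1 by rewrite invr_gt0 mulr_gt0.
have [b0 Hb] := expr_decay r0 r1 h2.
exists (maxn b0 1) => [|b]; first by rewrite leq_max orbT.
rewrite geq_max => /andP[bb b1] e e0.
have half0 : 0 <= 2^-1 :> R by rewrite invr_ge0.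
have half1 : 2^-1 < 1 :> R by rewrite invf_lt1 // ltr1n.
apply: eventually_impl (expr_div_decay half0 half1 b1 e0) => n.
apply: le_trans.
apply: le_trans (_ : (y * beta ^+ b) ^+ (n %/ b) <= _).
  rewrite exprMn ler_wpM2l ?exprn_ge0 ?(ltW y0) //.
  by rewrite -exprM; apply: ler_wiXn2l => //; rewrite ?(ltW r1) // mulnC leq_trunc_div.
apply: lerXn2r; rewrite ?nnegrE ?mulr_ge0 ?exprn_ge0 // ?(ltW y0) //.
have H := Hb _ bb; rewrite invfM in H.
by rewrite mulrC -ler_pdivlMr.
Qed.

(** The product of [(1 + x) ^+ n] and [(1 - x) ^+ n] is at most 1, and the second factor is at least
    [1 - n%:R * x]. *)
Lemma expr1p_le (x : R) n : 0 <= x -> n%:R * x <= 2^-1 ->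
  (1 + x) ^+ n <= 1 + 2 * (n%:R * x).
Proof.
move=> x0 nx.
have [->|n0] := posnP n; first by rewrite expr0 mul0r mulr0 addr0.
have x1 : x <= 2^-1.
  apply: le_trans nx; rewrite ler_peMl // ler1n //.
have b := @bernoulli (- x) n; rewrite mulNrn -mulr_natl in b.
have {}b : 1 - n%:R * x <= (1 - x) ^+ n by apply: b; lra.
set z := n%:R * x in nx b *.
have z0 : 0 <= z by rewrite mulr_ge0.
have p : (1 + x) ^+ n * (1 - x) ^+ n <= 1.
  rewrite -exprMn exprn_ile1 //; nra.
have u0 : 0 <= (1 + x) ^+ n by rewrite exprn_ge0 // addr_ge0.
set u := (1 + x) ^+ n in p u0 *; set w := (1 - x) ^+ n in p b.
have : u * (1 - z) <= 1 by nra.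
nra.
Qed.

Lemma expr1m_ge (x : R) n : x <= 1 -> 1 - n%:R * x <= (1 - x) ^+ n.
Proof.
move=> x1; have b := @bernoulli (- x) n; rewrite mulNrn -mulr_natl in b.
by apply: b; lra.
Qed.

End Decay.

(** * Near-uniform laws of linear forms *)

Section LinearForms.
Variables (N : nat).
Hypothesis N_gt1 : (1 < N)%N.
Variable C : finZmodType.
Hypothesis C_exp : forall x : C, x *+ N = 0.

(** A tuple [f] stands for the homomorphism from columns to [C] with these values on the basis; its
    image is [span f]. *)
Definition act n (f : 'I_n -> C) (v : 'cV['Z_N]_n) : C :=
  \sum_i f i *+ (v i ord0 : nat).

Lemma gprod_act n (f : 'I_n -> C) v : gprod f v = act f v.
Proof. by []. Qed.

Lemma mulrn_Zp_add (c : C) (r s : 'Z_N) :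
  c *+ (r + s : 'Z_N)%R = c *+ (r : nat) + c *+ (s : nat).
Proof.
rewrite -mulrnDr val_Zp_add //.
by rewrite {2}(divn_eq (r + s) N) mulrnDr mulnC mulrnA C_exp mul0rn add0r.
Qed.

Lemma actD n (f : 'I_n -> C) u v : act f (u + v) = act f u + act f v.
Proof.
by rewrite /act -big_split; apply: eq_bigr => i _; rewrite mxE mulrn_Zp_add.
Qed.

Lemma act0 n (f : 'I_n -> C) : act f 0 = 0.
Proof. by rewrite /act big1 // => i _; rewrite mxE mulr0n. Qed.

Lemma actN n (f : 'I_n -> C) v : act f (- v) = - act f v.
Proof. by apply/eqP; rewrite -addr_eq0 -actD addNr act0. Qed.

Lemma actB n (f : 'I_n -> C) u v : act f (u - v) = act f u - act f v.
Proof. by rewrite actD actN. Qed.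

Lemma act_delta n (f : 'I_n -> C) i : act f (delta_mx i ord0) = f i.
Proof.
rewrite /act (bigD1 i) //= mxE !eqxx /= big1 ?addr0 => [|j ji].
  by rewrite modn_small // mulr1n.
by rewrite mxE (negPf ji) mulr0n.
Qed.

Definition span n (f : 'I_n -> C) : {group C} := <<[set f i | i : 'I_n]>>%G.

Lemma act_span n (f : 'I_n -> C) v : act f v \in span f.
Proof.
rewrite /act; apply: (big_ind (fun x => x \in span f)).
- exact: group1.
- by move=> x y; apply: groupM.
by move=> i _; rewrite -FinRing.zmodXgE; apply: groupX; apply: mem_gen; apply: imset_f.
Qed.

Lemma span_act n (f : 'I_n -> C) x : x \in span f -> exists v, act f v = x.
Proof.
move=> /gen_prodgP[m [c Hc ->]].
elim: m c Hc => [|m IH] c Hc; first by exists 0; rewrite act0 big_ord0.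
have [v Hv] := IH (fun i => c (lift ord0 i)) (fun i => Hc _).
have /imsetP[i _ ci] := Hc ord0.
exists (delta_mx i ord0 + v); rewrite actD act_delta Hv -ci.
by rewrite [RHS]big_ord_recl.
Qed.

End LinearForms.

Section Bounds.
Variables (R : archiRealFieldType) (N : nat).
Hypothesis N_gt1 : (1 < N)%N.
Variable q : 'Z_N -> R.
Hypothesis q_ge0 : forall r, 0 <= q r.
Hypothesis q_sum1 : \sum_r q r = 1.
Variable alpha : R.
Hypothesis alpha_gt0 : 0 < alpha.
Hypothesis q_bal : forall p, prime p -> (p %| N)%N -> forall r : nat,
  \sum_(x : 'Z_N | (x %% p)%N == r) q x <= 1 - alpha.

(** The conclusion of [prg_popular] isolated as a property, so that one error [e] can be shared by
    several groups. *)
Definition mixing (gT : finGroupType) (n s : nat) (e : R) : Prop :=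
  forall (f : 'I_n -> gT) x d, d \in <<popular f s>>%g ->
    `|prg q f (x * d)%g - prg q f x| <= e.

Lemma prg_average (gT : finGroupType) n (f : 'I_n -> gT) (D : {group gT}) x e :
  (forall d, d \in D -> `|prg q f (x * d)%g - prg q f x| <= e) ->
  `|prg q f x - #|D|%:R^-1 * \sum_(d in D) prg q f (x * d)%g| <= e.
Proof.
move=> H; have D0 : (0 : R) < #|D|%:R by rewrite ltr0n cardG_gt0.
have -> : prg q f x - #|D|%:R^-1 * \sum_(d in D) prg q f (x * d)%g
    = #|D|%:R^-1 * \sum_(d in D) (prg q f x - prg q f (x * d)%g).
  by rewrite sumrB sumr_const mulrBr -[X in _ = _ * X - _]mulr_natl mulKf ?gt_eqF.
rewrite normrM gtr0_norm ?invr_gt0 // mulrC ler_pdivrMr //.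
apply: le_trans (ler_norm_sum _ _ _) _.
rewrite mulr_natr -sumr_const; apply: ler_sum => d dD; rewrite distrC; exact: H.
Qed.

Section Group.
Variable C : finZmodType.
Hypothesis C_exp : forall x : C, x *+ N = 0.

Lemma C_commute (x y : C) : commute x y.
Proof. exact: addrC. Qed.

(** Popular values generate the whole image, so the law is within [e] of its average over the
    image. *)
Lemma prg_code n s (f : 'I_n -> C) e x : mixing C n s e ->
  span f \subset <<popular f s>>%g -> x \in span f ->
  `|prg q f x - #|span f|%:R^-1| <= e.
Proof.
move=> mix fS xS.
have := @prg_average _ _ f (span f) x e.
suff -> : \sum_(d in span f) prg q f (x * d)%g = 1.
  by rewrite mulr1; apply=> d dS; apply: mix; apply: (subsetP fS).
have -> : \sum_(d in span f) prg q f (x * d)%g = \sum_(d in span f) prg q f d.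
  rewrite (reindex (fun d => x^-1 * d)%g) /=; last first.
    by exists (fun d => x * d)%g => d _; rewrite ?mulKVg ?mulKg.
  apply: eq_big => d; first by rewrite groupMl // groupV.
  by rewrite mulKVg.
rewrite sum_prg -[RHS](sum_wcol1 q_sum1 n); apply: eq_bigl => v.
by rewrite gprod_act act_span.
Qed.

Lemma prg_out_span n (f : 'I_n -> C) x : x \notin span f -> prg q f x = 0.
Proof.
move=> xS; rewrite /prg big1 // => v /eqP vx.
by case/negP: xS; rewrite -vx gprod_act act_span.
Qed.

(** Points of one coset of the popular subgroup are almost equally likely, and the coset carries
    mass at most [1 - alpha] because [f i0] lies outside that subgroup. *)
Lemma prg_noncode n s (f : 'I_n -> C) e x i0 : mixing C n s e ->
  f i0 \notin <<popular f s>>%g ->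
  prg q f x <= (1 - alpha) / #|<<popular f s>>%g|%:R + e.
Proof.
move=> mix fi.
have := @prg_average _ _ f [group of <<popular f s>>%g] x e (fun d => mix f x d).
rewrite ler_norml => /andP[_]; rewrite lerBlDr => /le_trans; apply.
rewrite addrC lerD2r mulrC ler_wpM2r ?invr_ge0 //.
by apply: prg_coset_escape fi => //; apply: C_commute.
Qed.

(** A value taken [2 * t] times by [f] is still taken [t] times where [w] vanishes, so the law of
    the pair is almost invariant under [span f] times the trivial group. This yields the factor
    [#|span f|]; the escape bound for [w] alone yields [1 - alpha]. *)
Lemma prg_low_weight n t p (f : 'I_n -> C) (w : 'I_n -> 'F_p) e (x : C) (y : 'F_p) :
  prime p -> (p %| N)%N -> mixing (C * 'F_p)%type n t e ->
  span f \subset <<popular f (2 * t)>>%g ->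
  (#|[set i | w i != 0%R]| <= t)%N -> (exists i, w i != 0) ->
  \sum_(v | (act f v == x) && (act w v == y)) wcol q v
    <= (1 - alpha) / #|span f|%:R + e.
Proof.
move=> pp pN mix fS wt [i0 wi0].
have w_exp (z : 'F_p) : z *+ N = 0.
  by rewrite -mulr_natr (dvdn_pcharf (pchar_Fp pp)) in pN *; rewrite (eqP pN) mulr0.
pose F i : (C * 'F_p)%type := (f i, w i).
have FE v : gprod F v = (act f v, act w v).
  rewrite /gprod /act; elim/big_rec3: _ => // i a b c _ ->.
  have -> : (F i ^+ (v i ord0 : nat))%g = (f i *+ (v i ord0 : nat), w i *+ (v i ord0 : nat)).
    by elim: (nat_of_ord _) => [|k IH] //; rewrite expgS IH !mulrS.
  by [].
set P := <<popular F t>>%g.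
have dP d : d \in span f -> ((d, 0) : C * 'F_p) \in P.
  move=> dS; have := subsetP fS _ dS => /gen_prodgP[m [c Hc ->]].
  elim: m c Hc => [|m IH] c Hc; first by rewrite big_ord0; apply: group1.
  rewrite big_ord_recl.
  have -> : (((c ord0 * \prod_(i < m) c (lift ord0 i))%g, 0) : C * 'F_p)
      = (((c ord0, 0) : C * 'F_p) * ((\prod_(i < m) c (lift ord0 i))%g, 0))%g.
    by congr pair; rewrite /= -[RHS]/(0 + 0) addr0.
  apply: groupM; last by apply: IH.
  apply: mem_gen; rewrite inE.
  have := Hc ord0; rewrite inE => H.
  have sub : [set i | f i == c ord0] :\: [set i | w i != 0%R] \subset [set i | F i == (c ord0, 0)].
    by apply/subsetP => i; rewrite !inE negbK /F xpair_eqE => /andP[-> ->].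
  apply: leq_trans (subset_leq_card sub).
  rewrite cardsD leq_subRL; last by apply: subset_leq_card; apply: subsetIl.
  apply: leq_trans H; rewrite mul2n -addnn leq_add2r.
  by apply: leq_trans wt; apply: subset_leq_card; apply: subsetIr.
pose D := [group of setX (span f) (1%g : {set 'F_p})].
have DP d : d \in D -> d \in P.
  case: d => d z; rewrite inE /= => /andP[dS /set1P ->]; exact: dP.
have := @prg_average _ _ F D (x, y) e (fun d dD => mix F (x, y) d (DP d dD)).
have -> : #|D| = #|span f| by rewrite cardsX cards1 muln1.
have -> : prg q F (x, y) = \sum_(v | (act f v == x) && (act w v == y)) wcol q v.
  by apply: eq_bigl => v; rewrite FE xpair_eqE.
rewrite ler_norml => /andP[_]; rewrite lerBlDr => /le_trans; apply.
rewrite addrC lerD2r mulrC ler_wpM2r ?invr_ge0 //.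
have -> : \sum_(d in D) prg q F ((x, y) * d)%g
  = \sum_(d in ((x, y) *: D)%g) prg q F d.
  by rewrite -lcosetE big_imset //= => a b _ _ /mulgI.
rewrite sum_prg.
apply: (@le_trans _ _ (\sum_(v | gprod w v == y) wcol q v)).
  rewrite big_mkcond [leRHS]big_mkcond; apply: ler_sum => v _.
  rewrite mem_lcoset FE inE /=.
  case: ifP => [/andP[_ /set1P E]|_]; last by case: ifP => // _; apply: wcol_ge0.
  rewrite gprod_act; have -> : act w v == y.
    by rewrite -subr_eq0 addrC; apply/eqP; exact: E.
  by [].
have := @prg_coset_escape R N N_gt1 q q_ge0 q_sum1 alpha q_bal _ 1%G n w y i0.
rewrite big_set1 mulg1; apply => //; first exact: addrC.
by rewrite inE.
Qed.

End Group.

Section Subgroup.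
Variables (n : nat) (K : {group 'cV['Z_N]_n}).

Lemma cV_exp (x : 'cV['Z_N]_n) : (x ^+ N = 1)%g.
Proof.
rewrite FinRing.zmodXgE; apply/colP => i; rewrite mulmxnE mxE.
by rewrite -mulr_natr Zp_natN // mulr0.
Qed.

Lemma norm_cV (x : 'cV['Z_N]_n) : x \in ('N(K))%g.
Proof.
apply: (subsetP (cent_sub K)); apply/centP => z _; exact: addrC.
Qed.

Lemma coset_surj (y : coset_of K) : exists x, y = coset K x.
Proof. by case: (cosetP y) => x _ ->; exists x. Qed.

Lemma card_coset_of_cV : #|{: coset_of K}| = #|[set: 'cV['Z_N]_n] : K|%g.
Proof.
rewrite -card_quotient; last by apply/subsetP => x _; apply: norm_cV.
rewrite -cardsT; apply: eq_card => y; rewrite inE.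
by have [x ->] := coset_surj y; rewrite mem_quotient ?inE.
Qed.

(** If the popular classes of basis vectors generated a proper subgroup of the quotient, its
    preimage [D] would miss fewer than [s] basis vectors per class, contradicting the hypothesis. So
    they generate the quotient, and the law modulo [K] is nearly uniform. *)
Lemma prg_subgroup s e x : mixing (coset_of K) n s e -> (0 < s)%N ->
  (forall D : {group 'cV['Z_N]_n}, K \subset D -> D :!=: [set: 'cV['Z_N]_n] ->
    (s * #|[set: 'cV['Z_N]_n] : K|%g <= #|[set i | delta_mx i ord0 \notin D]|)%N) ->
  `|\sum_(v | v - x \in K) wcol q v - #|[set: 'cV['Z_N]_n] : K|%g%:R^-1| <= e.
Proof.
move=> mix s0 hK.
have cM u v : coset K (u + v) = (coset K u * coset K v)%g.
  exact: (morphM (coset_morphism K) (norm_cV u) (norm_cV v)).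
pose f i := coset K (delta_mx i ord0 : 'cV['Z_N]_n).
have fE v : gprod f v = coset K v.
  rewrite {2}(_ : v = \sum_i delta_mx i ord0 *+ (v i ord0 : nat)); last first.
    rewrite {1}[v]matrix_sum_delta; apply: eq_bigr => i _; rewrite big_ord1.
    by rewrite -scaler_nat Zp_natK.
  rewrite /gprod; elim/big_rec2: _ => [|i a b _ ->]; first by rewrite morph1.
  by rewrite cM; congr (_ * _)%g; rewrite /f -morphX ?norm_cV.
have popT : <<popular f s>>%g = [set: coset_of K].
  apply/eqP; apply: contraT => popN.
  pose D := (coset K @*^-1 <<popular f s>>)%G.
  have KD : K \subset D by apply: sub_cosetpre.
  have DE v : (v \in D) = (coset K v \in <<popular f s>>%g).
    by rewrite /D /= morphpreE in_setI norm_cV in_set.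
  have DT : D :!=: [set: 'cV['Z_N]_n].
    apply: contra popN => /eqP DT; apply/eqP/setP => y; rewrite inE.
    by have [x' ->] := coset_surj y; rewrite -DE DT inE.
  have := hK _ KD DT; rewrite leqNgt => /negP; case.
  rewrite -card_coset_of_cV.
  have le1 : (#|[set i | delta_mx i ord0 \notin D]|
      <= \sum_(y : coset_of K) s.-1)%N.
    rewrite -sum1_card (partition_big f predT) //=; apply: leq_sum => y _.
    case: (boolP (y \in popular f s)) => yp.
      rewrite big1 // => i; rewrite inE DE -/(f i) => /andP[fi /eqP fy].
      by case/negP: fi; rewrite fy mem_gen.
    rewrite sum1_card -ltnS (prednK s0).
    move: yp; rewrite inE -ltnNge; apply: leq_ltn_trans; apply: subset_leq_card.
    by apply/subsetP => i; rewrite inE unfold_in => /andP[_].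
  apply: leq_ltn_trans le1 _; rewrite sum_nat_const.
  rewrite mulnC ltn_pmul2r ?prednK //.
  by apply/card_gt0P; exists 1%g.
have avg := @prg_average _ _ f [set: coset_of K]%G (coset K x) e _.
have := avg (fun d _ => mix f (coset K x) d _).
rewrite popT => /(_ _) H.
have {}H := H (fun d => in_setT d).
have E1 : prg q f (coset K x) = \sum_(v | v - x \in K) wcol q v.
  apply: eq_bigl => v; rewrite fE -[RHS]groupV.
  apply/eqP/idP => [E|vK].
    have : coset K (v - x) = 1%g.
      by rewrite cM E -cM subrr morph1.
    move=> /coset_idr; rewrite groupV; apply; exact: norm_cV.
  rewrite groupV in vK.
  by rewrite -[v](subrK x) cM coset_id // mul1g.
have E2 : \sum_(d in [set: coset_of K]%G) prg q f (coset K x * d)%g = 1.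
  have -> : \sum_(d in [set: coset_of K]%G) prg q f (coset K x * d)%g
    = \sum_(d in [set: coset_of K]) prg q f d.
    rewrite (reindex (fun d => (coset K x)^-1 * d)%g) /=; last first.
      by exists (fun d => coset K x * d)%g => d _; rewrite ?mulKVg ?mulKg.
    by apply: eq_big => d; rewrite ?inE // mulKVg.
  rewrite sum_prg -[RHS](sum_wcol1 q_sum1 n); apply: eq_bigl => v; by rewrite inE.
by move: H; rewrite E1 E2 mulr1 cardsT card_coset_of_cV.
Qed.

End Subgroup.

(* Weighting the letters outside [A] by [x] turns the count into a product. *)
Lemma card_few_outside (T : finType) (A : {set T}) n k (x : R) : 0 < x -> x <= 1 ->
  #|[set f : {ffun 'I_n -> T} | (#|[set i | f i \notin A]| <= k)%N]|%:R
    <= x^-1 ^+ k * (#|A|%:R + x * #|T|%:R) ^+ n.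
Proof.
move=> x0 x1.
have -> : x^-1 ^+ k = (x ^+ k)^-1 by rewrite exprVn.
rewrite mulrC ler_pdivlMr ?exprn_gt0 //.
apply: (@le_trans _ _ (\sum_(f : {ffun 'I_n -> T}) \prod_i (if f i \in A then 1 else x))).
  rewrite -sum1_card natr_sum mulr_suml [leLHS]big_mkcond; apply: ler_sum => f _.
  rewrite inE; case: ifP => [fk|_]; last first.
    by apply: prodr_ge0 => i _; case: ifP => // _; apply: ltW.
  rewrite mul1r (bigID (fun i => f i \in A)) /= big1 ?mul1r => [|i ->] //.
  rewrite (eq_bigr (fun=> x)) => [|i /negPf ->] //.
  rewrite prodr_const; apply: ler_wiXn2l; rewrite ?(ltW x0) //.
  by rewrite cardsE in fk.
rewrite -(bigA_distr_bigA (fun (_ : 'I_n) t => if t \in A then 1 else x)) /=.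
rewrite prodr_const card_ord; apply: lerXn2r; rewrite ?nnegrE.
- by apply: sumr_ge0 => t _; case: ifP => // _; apply: ltW.
- by rewrite addr_ge0 // mulr_ge0 // ltW.
rewrite (bigID (mem A)) /= (eq_bigr (fun=> 1)) => [|t ->] //.
rewrite sumr_const lerD2l (eq_bigr (fun=> x)) => [|t /negPf ->] //.
apply: (@le_trans _ _ (\sum_(t : T) x)).
  by rewrite big_mkcond; apply: ler_sum => t _; case: ifP => // _; apply: ltW.
by rewrite sumr_const mulr_natr.
Qed.

End Bounds.

(** * Codes and the scarcity of other forms *)

Section Codes.
Variables (R : archiRealFieldType) (N : nat).
Hypothesis N_gt1 : (1 < N)%N.
Variable q : 'Z_N -> R.
Hypothesis q_ge0 : forall r, 0 <= q r.
Hypothesis q_sum1 : \sum_r q r = 1.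
Variable alpha : R.
Hypothesis alpha_gt0 : 0 < alpha.
Hypothesis q_bal : forall p, prime p -> (p %| N)%N -> forall r : nat,
  \sum_(x : 'Z_N | (x %% p)%N == r) q x <= 1 - alpha.

(** The error is exponentially small in [n], so even [n] times it vanishes; products over [n]
    columns can then be controlled. *)
Lemma mixing_error (b c : nat) : (0 < b)%N -> (0 < c)%N ->
  exists e : nat -> R, [/\ forall n, 0 <= e n,
    forall d, 0 < d -> eventually (fun n => n%:R * e n <= d) &
    forall (gT : finGroupType), (forall x y : gT, commute x y) ->
      (forall x : gT, x ^+ N = 1)%g -> (#|gT| <= c)%N ->
      forall n s, ((n %/ b) %/ c <= s)%N -> mixing q gT n s (e n)].
Proof.
move=> b0 c0.
have [rho /andP[r0 r1] [L L0 H]] := prg_popular N_gt1 q_ge0 q_sum1 alpha_gt0 q_bal c.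
exists (fun n => rho ^+ (n %/ b %/ c %/ L)); split.
- by move=> n; rewrite exprn_ge0.
- move=> d d0.
  apply: eventually_impl (mul_expr_div_decay r0 r1 (_ : 0 < b * c * L)%N d0) => [n|].
    by rewrite !divnMA.
  by rewrite !muln_gt0 b0 c0.
move=> gT cT eT gc n s hs f x d dD; apply: le_trans (H _ cT eT gc _ _ f x d dD) _.
by apply: ler_wiXn2l => //; [apply: ltW | apply: leq_div2r].
Qed.

Variable C : finZmodType.
Hypothesis C_exp : forall x : C, x *+ N = 0.

(** The factor 2 leaves [t] occurrences of each generating value when [t] coordinates are discarded,
    as in [prg_low_weight]. *)
Definition code (t n : nat) (f : 'I_n -> C) : bool :=
  span f \subset <<popular f (2 * t)>>%g.

Lemma card_unpopular n s (f : 'I_n -> C) :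
  (#|[set i | f i \notin <<popular f s>>%g]| <= s * #|C|)%N.
Proof.
rewrite -sum1_card (partition_big f predT) //=.
rewrite mulnC -sum_nat_const; apply: leq_sum => y _.
case: (boolP (y \in popular f s)) => yp.
  rewrite big1 // => i; rewrite inE => /andP[fi /eqP fy].
  by case/negP: fi; rewrite fy mem_gen.
rewrite sum1_card; move: yp; rewrite inE -ltnNge => /ltnW; apply: leq_trans.
by apply: subset_leq_card; apply/subsetP => i; rewrite inE unfold_in => /andP[_].
Qed.

Lemma popular_span n s (f : 'I_n -> C) : (0 < s)%N ->
  <<popular f s>>%g \subset span f.
Proof.
move=> s0; rewrite gen_subG; apply/subsetP => y; rewrite inE => sy.
have /card_gt0P[i] : (0 < #|[set i | f i == y]|)%N by apply: leq_trans sy.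
by rewrite inE => /eqP <-; apply: mem_gen; apply: imset_f.
Qed.

(** Group the tuples by the subgroup [D] generated by their popular values: at most [2 * t * #|C|]
    positions have a value outside [D], so [card_few_outside] bounds the size of each group. *)
Lemma sum_popular (n t : nat) (x : R) (F : {set C} -> R) (P : pred {ffun 'I_n -> C}) :
  0 < x -> x <= 1 -> (forall D, 0 <= F D) ->
  \sum_(f : {ffun 'I_n -> C} | P f) F <<popular f (2 * t)>>%g <=
  \sum_(D : {set C} | [exists f : {ffun 'I_n -> C}, P f && (<<popular f (2 * t)>>%g == D)])
    (x^-1 ^+ (2 * t * #|C|) * (#|D|%:R + x * #|C|%:R) ^+ n) * F D.
Proof.
move=> x0 x1 F0.
rewrite (partition_big (fun f : {ffun 'I_n -> C} => <<popular f (2 * t)>>%g)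
   (fun D => [exists f : {ffun 'I_n -> C}, P f && (<<popular f (2 * t)>>%g == D)])) /=; last first.
  by move=> f Pf; apply/existsP; exists f; rewrite Pf eqxx.
apply: ler_sum => D _.
rewrite (eq_bigr (fun=> F D)) => [|f /andP[_ /eqP ->]] //.
rewrite sumr_const -[leLHS]mulr_natl ler_wpM2r //.
apply: le_trans (card_few_outside D n (2 * t * #|C|) x0 x1).
rewrite ler_nat; apply: subset_leq_card; apply/subsetP => f.
rewrite unfold_in inE => /andP[_ /eqP <-]; exact: card_unpopular.
Qed.

Section Rates.
Variable kappa : nat.
Hypothesis kappaC : (#|C| <= kappa)%N.
(** The weight of an exceptional letter in [card_few_outside]. As [x * kappa%:R] is [alpha / 4], the
    factor [1 + x * m] with [m <= kappa] cannot push a base [1 - alpha + d] above [beta] when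
    [d <= alpha / 4]. *)
Let x : R := alpha / (4 * kappa%:R).
Let beta : R := 1 - alpha / 4.

Lemma cardC_gt0 : (0 < #|C|)%N.
Proof. by apply/card_gt0P; exists 0. Qed.

Lemma kappa_gt0 : (0 : R) < kappa%:R.
Proof. by rewrite ltr0n (leq_trans cardC_gt0). Qed.

Lemma rate_gt0 : 0 < x.
Proof. by rewrite divr_gt0 // mulr_gt0 ?kappa_gt0. Qed.

Lemma rate_lin_ge0 (y : R) (m : nat) : 0 <= y -> 0 <= y + x * m%:R.
Proof. by move=> y0; exact: addr_ge0 y0 (mulr_ge0 (ltW rate_gt0) (ler0n _ _)). Qed.

Lemma rate_kappa : x * kappa%:R = alpha / 4.
Proof. by rewrite /x; field; rewrite gt_eqF ?kappa_gt0. Qed.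

Lemma rate_mul m : (m <= kappa)%N -> x * m%:R <= alpha / 4.
Proof.
by move=> mk; rewrite -rate_kappa ler_wpM2l ?ler_nat // ltW // rate_gt0.
Qed.

Lemma rate_le1 : x <= 1.
Proof.
have := alpha_le1 N_gt1 q_ge0 q_bal; have := rate_kappa.
have : 1 <= kappa%:R :> R by rewrite ler1n (leq_trans cardC_gt0).
have := rate_gt0 => *; nra.
Qed.

Lemma rate_beta (m : nat) (d : R) : (m <= kappa)%N -> 0 <= d -> d <= alpha / 4 ->
  (1 + x * m%:R) * (1 - alpha + d) <= beta.
Proof.
move=> mk d0 d1; have := rate_mul mk; have := alpha_le1 N_gt1 q_ge0 q_bal.
have : 0 <= x * m%:R by rewrite mulr_ge0 // ltW // rate_gt0.
rewrite /beta; set z := x * _ => *; nra.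
Qed.

(** For each popular subgroup [D] the number of tuples grows with base [#|D| + x * #|C|] and each
    has weight with base [(1 - alpha) / #|D| + e]. The order of [D] cancels, and the product of the
    bases is at most [beta]. *)
Lemma sum_noncode (n t : nat) (e : R) : (0 < t)%N -> 0 <= e -> #|C|%:R * e <= alpha / 4 ->
  \sum_(f : {ffun 'I_n -> C} | ~~ code t f)
    ((1 - alpha) / #|<<popular f (2 * t)>>%g|%:R + e) ^+ n
  <= #|{set C}|%:R * (x^-1 ^+ (2 * t * #|C|) * beta ^+ n).
Proof.
move=> t0 e0 eC.
have a1 : 0 <= 1 - alpha by rewrite subr_ge0 (alpha_le1 N_gt1 q_ge0 q_bal).
have bse (D : {set C}) : 0 <= (1 - alpha) / #|D|%:R + e.
  by rewrite addr_ge0 // mulr_ge0 // invr_ge0.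
apply: le_trans (@sum_popular n t x (fun D => ((1 - alpha) / #|D|%:R + e) ^+ n) _
  rate_gt0 rate_le1 _) _; first by move=> D; rewrite exprn_ge0.
apply: (@le_trans _ _ (\sum_(D : {set C}) (x^-1 ^+ (2 * t * #|C|) * beta ^+ n))); last first.
  by rewrite sumr_const mulr_natl.
have b0 : 0 <= beta by rewrite /beta; have := alpha_le1 N_gt1 q_ge0 q_bal; lra.
have xi0 : 0 <= x^-1 by rewrite invr_ge0 ltW // rate_gt0.
rewrite big_mkcond; apply: ler_sum => D _; case: ifP => [/existsP[f /andP[_ /eqP E]]|_]; last first.
  by rewrite mulr_ge0 // exprn_ge0.
rewrite -mulrA ler_wpM2l ?exprn_ge0 // -exprMn.
have D0 : (1 : R) <= #|D|%:R by rewrite -E ler1n cardG_gt0.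
have DC : #|D|%:R <= #|C|%:R :> R by rewrite ler_nat max_card.
apply: lerXn2r; rewrite ?nnegrE ?mulr_ge0 //.
  exact: rate_lin_ge0.
apply: le_trans (rate_beta kappaC (_ : 0 <= #|C|%:R * e) eC); last by rewrite mulr_ge0.
have Dn0 : #|D|%:R != 0 :> R by rewrite gt_eqF // (lt_le_trans _ D0).
have -> : (#|D|%:R + x * #|C|%:R) * ((1 - alpha) / #|D|%:R + e)
  = (1 + x * #|C|%:R / #|D|%:R) * (1 - alpha + #|D|%:R * e) by field.
apply: ler_pM.
- by rewrite addr_ge0 // mulr_ge0 ?invr_ge0 // mulr_ge0 // ltW // rate_gt0.
- by rewrite addr_ge0 // mulr_ge0.
- rewrite lerD2l ler_pdivrMr ?(lt_le_trans _ D0) // ler_peMr // mulr_ge0 //.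
  by rewrite ltW // rate_gt0.
by rewrite lerD2l ler_wpM2r.
Qed.

(** The popular subgroup of such a tuple is proper in [A], so it has index at least two, at the cost
    of an exponential factor. *)
Lemma card_noncode (n t : nat) (A : {group C}) : (0 < t)%N ->
  #|[set f : {ffun 'I_n -> C} |
      [forall i, f i \in A] && ~~ (code t f && (span f :==: A))]|%:R
  <= #|{set C}|%:R * (x^-1 ^+ (2 * t * #|C|) * beta ^+ n) * #|A|%:R ^+ n.
Proof.
move=> t0.
have b0 : 0 <= beta by rewrite /beta; have := alpha_le1 N_gt1 q_ge0 q_bal; lra.
have xi0 : 0 <= x^-1 by rewrite invr_ge0 ltW // rate_gt0.
rewrite -sum1_card natr_sum.
under eq_bigl do rewrite inE.
apply: le_trans (@sum_popular n t x (fun=> 1) _ rate_gt0 rate_le1 (fun=> ler01)) _.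
apply: (@le_trans _ _ (\sum_(D : {set C})
    (x^-1 ^+ (2 * t * #|C|) * beta ^+ n * #|A|%:R ^+ n))); last first.
  by rewrite sumr_const -[leLHS]mulr_natl -!mulrA.
rewrite big_mkcond; apply: ler_sum => D _.
rewrite mulr1; case: ifP => [/existsP[f /andP[/andP[/forallP fA fN] /eqP E]]|_]; last first.
  by rewrite mulr_ge0 ?mulr_ge0 ?exprn_ge0.
rewrite -mulrA ler_wpM2l ?exprn_ge0 // -exprMn.
have A0 : (1 : R) <= #|A|%:R by rewrite ler1n cardG_gt0.
have sA : span f \subset A.
  by rewrite gen_subG; apply/subsetP => _ /imsetP[i _ ->].
have pA : <<popular f (2 * t)>>%g \proper A.
  rewrite properE; apply/andP; split.
    by apply: subset_trans sA; apply: popular_span; rewrite muln_gt0.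
  apply: contra fN => Ap; rewrite /code (subset_trans sA Ap) /=.
  rewrite eqEsubset sA /= (subset_trans Ap) // popular_span // muln_gt0 //.
have DA : (2 * #|D| <= #|A|)%N.
  rewrite -E mulnC -(Lagrange (proper_sub pA)) leq_mul2l indexg_gt1 proper_subn ?orbT //.
apply: lerXn2r; rewrite ?nnegrE ?mulr_ge0 //.
  exact: rate_lin_ge0.
have := rate_mul kappaC; have := alpha_le1 N_gt1 q_ge0 q_bal.
have : 2 * #|D|%:R <= #|A|%:R :> R by rewrite -natrM ler_nat.
have aA a : a <= 1 -> a * #|A|%:R <= #|A|%:R :> R by move=> a1; rewrite ler_piMl.
by move=> DA' a1 xC; have := aA _ a1; rewrite /beta; lra.
Qed.

(* [t = n %/ b] for a large [b] beats all the counting factors. *)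
Lemma exists_scale : exists2 b0 : nat, (0 < b0)%N & forall b, (b0 <= b)%N ->
  forall d, 0 < d ->
  eventually (fun n => x^-1 ^+ (2 * (n %/ b) * #|C|) * beta ^+ n <= d).
Proof.
have b0 : 0 <= beta by rewrite /beta; have := alpha_le1 N_gt1 q_ge0 q_bal; lra.
have b1 : beta < 1 by rewrite /beta ltrBlDr ltrDl divr_gt0.
have xi1 : 1 <= x^-1 by rewrite invf_ge1 ?rate_gt0 ?rate_le1.
have [B B0 H] := balanced_decay b0 b1 (exprn_ege1 (2 * #|C|) xi1).
exists B => // b Bb d d0; apply: eventually_impl (H b Bb d d0) => n.
by rewrite -exprM mulnAC.
Qed.

Lemma sum_low_weight (n t p : nat) : prime p -> (p <= kappa)%N ->
  #|[set w : {ffun 'I_n -> 'F_p} | (#|[set i | w i != 0%R]| <= t)%N]|%:R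
  <= x^-1 ^+ t * (1 + x * p%:R) ^+ n.
Proof.
move=> pp pk.
have := @card_few_outside R 'F_p [set 0] n t x rate_gt0 rate_le1.
rewrite cards1 card_Fp //; apply: le_trans; rewrite ler_nat.
apply: subset_leq_card; apply/subsetP => w; rewrite !inE.
by apply: leq_trans; apply: subset_leq_card; apply/subsetP => i; rewrite !inE.
Qed.

End Rates.
End Codes.

(** * Subgroups of columns over Z/N and reduction modulo primes *)

Lemma Fp_row_functional p r (L : {group 'rV['F_p]_r}) : L :!=: [set: 'rV['F_p]_r] ->
  exists2 y : 'cV['F_p]_r, y != 0 & forall v, v \in L -> v *m y = 0.
Proof.
move=> LT.
have : ~~ row_full (rowg_mx L).
  apply: contra LT => full; rewrite eqEsubset subsetT /=.
  rewrite -(rowg_mxK L); apply/subsetP => v _; rewrite inE.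
  exact: submx_full.
rewrite -cokermx_eq0 => /matrix0Pn[i [j ij]].
exists (col j (cokermx (rowg_mx L))).
  by apply: contra ij => /eqP/colP/(_ i); rewrite [LHS]mxE [RHS]mxE => ->.
move=> v /(subsetP (sub_rowg_mx L)); rewrite inE submxE => /eqP vL.
by rewrite colE mulmxA vL mul0mx.
Qed.

Section Lattice.
Variables (N : nat).
Hypothesis N_gt1 : (1 < N)%N.
Variable n : nat.
Local Notation V := 'cV['Z_N]_n.

Lemma cV_mulrn_exp (v : V) : v *+ N = 0.
Proof. exact: cV_exp. Qed.

Lemma group_add (K : {group V}) u v : u \in K -> v \in K -> u + v \in K.
Proof. exact: groupM. Qed.

Lemma group_opp (K : {group V}) u : (- u \in K) = (u \in K).
Proof. exact: groupV. Qed.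

Lemma group_sub (K : {group V}) u v : u \in K -> v \in K -> u - v \in K.
Proof. by move=> uK vK; rewrite group_add // group_opp. Qed.

Lemma group_zero (K : {group V}) : 0 \in K.
Proof. exact: group1. Qed.

Lemma group_mulrn (K : {group V}) u k : u \in K -> u *+ k \in K.
Proof. exact: groupX. Qed.

Lemma group_sum (K : {group V}) (I : Type) (r : seq I) (P : pred I) (F : I -> V) :
  (forall i, P i -> F i \in K) -> \sum_(i <- r | P i) F i \in K.
Proof.
move=> H; apply: (big_ind (fun x => x \in K)) => //; first exact: group_zero.
exact: group_add.
Qed.

(* Nakayama: [L = W + p L] for all primes [p | N] forces [L = W], by
   multiplying these equations along the prime factorisation of [N]. *)
Lemma nakayama (W L : {group V}) : W \subset L ->
  (forall p, prime p -> (p %| N)%N -> forall v, v \in L ->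
     exists2 w, w \in W & exists2 u, u \in L & v = w + u *+ p) ->
  L \subset W.
Proof.
move=> WL H.
have main m : (0 < m)%N -> (forall p, prime p -> (p %| m)%N -> (p %| N)%N) ->
    forall v, v \in L -> exists2 w, w \in W & exists2 u, u \in L & v = w + u *+ m.
  elim/ltn_ind: m => m IH m0 mN v vL.
  case: (ltngtP m 1%N) => [|m1|->]; first by rewrite ltnNge m0.
    have pp := pdiv_prime m1; have pm := pdiv_dvd m.
    set p := pdiv m in pp pm.
    have [w wW [u uL E]] := H p pp (mN _ pp pm) v vL.
    have m'm : (m %/ p < m)%N by rewrite ltn_Pdiv // prime_gt1.
    have m'0 : (0 < m %/ p)%N by rewrite divn_gt0 ?prime_gt0 // dvdn_leq.
    have [|w' w'W [u' u'L E']] := IH _ m'm m'0 _ u uL.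
      move=> p' pp' p'm; apply: mN => //; apply: dvdn_trans p'm _.
      by rewrite -{2}(divnK pm) dvdn_mulr.
    exists (w + w' *+ p); first by rewrite group_add // group_mulrn.
    exists u' => //; rewrite E E' mulrnDl -mulrnA divnK // addrA //.
  by exists 0; [exact: group_zero | exists v => //; rewrite add0r mulr1n].
apply/subsetP => v vL.
have [|p|w wW [u _ ->]] := main N _ _ v vL; rewrite ?(ltnW N_gt1) //.
by rewrite cV_mulrn_exp addr0.
Qed.

Lemma Fp_modN p k : prime p -> (p %| N)%N -> ((k %% N)%N%:R : 'F_p) = k%:R.
Proof.
by move=> pp pN; rewrite -(Fp_nat_mod pp (k %% N)) modn_dvdm // Fp_nat_mod.
Qed.

Definition redp (p : nat) (v : V) : 'cV['F_p]_n := \col_i (v i ord0 : nat)%:R.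

Lemma redpD p u v : prime p -> (p %| N)%N -> redp p (u + v) = redp p u + redp p v.
Proof.
move=> pp pN; apply/colP => i; rewrite !mxE val_Zp_add //.
by rewrite Fp_modN // natrD.
Qed.

Lemma redp_eq0 p v : prime p -> (p %| N)%N -> redp p v = 0 -> exists u, v = u *+ p.
Proof.
move=> pp pN E; exists (\col_i ((v i ord0 : nat) %/ p)%:R).
apply/colP => i; rewrite mulmxnE !mxE -mulrnA divnK ?Zp_natK //.
by move/colP/(_ i): E; rewrite !mxE => /eqP; rewrite -(dvdn_pcharf (pchar_Fp pp)).
Qed.

Lemma act_redp p (w : 'I_n -> 'F_p) v : act w v = \sum_i w i * redp p v i ord0.
Proof. by apply: eq_bigr => i _; rewrite mxE mulr_natr. Qed.

Lemma Fp_exp p (z : 'F_p) : prime p -> (p %| N)%N -> z *+ N = 0.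
Proof.
move=> pp pN; rewrite -mulr_natr.
by move: pN; rewrite (dvdn_pcharf (pchar_Fp pp)) => /eqP ->; rewrite mulr0.
Qed.

Lemma redp_morphM p (pp : prime p) (pN : (p %| N)%N) :
  {in [set: V] &, {morph (fun v => (redp p v)^T) : x y / (x * y)%g}}.
Proof. by move=> u v _ _; rewrite -[RHS]/(_ + _) -linearD -redpD. Qed.

Lemma separating_functional (D : {group V}) : D :!=: [set: V] ->
  exists p, [/\ prime p, (p %| N)%N & exists w : {ffun 'I_n -> 'F_p},
    (exists i, w i != 0) /\ forall v, v \in D -> act w v = 0].
Proof.
move=> DT.
have /forall_inPn [p /andP[pp pN] pD] : ~~ [forall p : 'I_N.+1,
    (prime p && (p %| N)%N) ==> [forall v : V, [exists w in D, [exists u : V, v == w + u *+ p]]]].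
  apply: contra DT => /forall_inP H; rewrite eqEsubset subsetT /=.
  apply: nakayama => [|p pp pN v _]; first exact: subsetT.
  have pN' : (p < N.+1)%N by rewrite ltnS dvdn_leq // ltnW.
  have := H (Ordinal pN'); rewrite /= pp pN => /(_ isT) /forallP /(_ v).
  move=> /exists_inP[w wD /existsP[u /eqP E]].
  by exists w => //; exists u; rewrite ?inE.
exists p; split=> //.
pose redm := Morphism (redp_morphM pp pN).
pose L := (redm @* D)%G.
have LT : L :!=: [set: 'rV['F_p]_n].
  apply: contra pD => /eqP LT; apply/forallP => v.
  have : (redp p v)^T \in L by rewrite LT inE.
  case/morphimP => w _ wD E; apply/exists_inP; exists w => //; apply/existsP.
  have [u Hu] : exists u, v - w = u *+ p.
    apply: redp_eq0 => //; apply: (addIr (redp p w)).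
    by rewrite -redpD // subrK add0r; apply: trmx_inj.
  by exists u; rewrite -Hu addrC subrK.
have [y yn0 yL] := Fp_row_functional LT.
exists [ffun i => y i ord0]; split.
  have /matrix0Pn[i [j ij]] := yn0; exists i; rewrite ffunE.
  by rewrite (ord1 j) in ij.
move=> v vD; rewrite act_redp.
have /yL /rowP /(_ ord0) : (redp p v)^T \in L by apply: (mem_morphim redm); rewrite ?inE.
rewrite !mxE => E; rewrite -[RHS]E; apply: eq_bigr => k _.
by rewrite ffunE mulrC !mxE.
Qed.

Section ModP.
Variable p : nat.
Hypotheses (pp : prime p) (pN : (p %| N)%N).

Lemma card_torsion : #|[set v : V | v *+ p == 0]| = (p ^ n)%N.
Proof.
have p0 := prime_gt0 pp.
have m0 : (0 < N %/ p)%N by rewrite divn_gt0 // dvdn_leq // ltnW.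
pose th (w : 'cV['F_p]_n) : V := \col_i (N %/ p * w i ord0)%:R.
have wp (w : 'cV['F_p]_n) i : (w i ord0 < p)%N.
  by apply: leq_trans (ltn_ord _) _; rewrite Fp_cast.
have lt (w : 'cV['F_p]_n) i : (N %/ p * w i ord0 < N)%N.
  by rewrite -[X in (_ < X)%N](divnK pN) ltn_pmul2l // wp.
have th_inj : injective th.
  move=> w1 w2 /colP E; apply/colP => i; have := E i; rewrite !mxE => /(congr1 (@nat_of_ord _)).
  rewrite !Zp_natr // !modn_small ?lt // => /eqP; rewrite eqn_pmul2l // => /eqP Ei.
  exact: val_inj.
have -> : [set v : V | v *+ p == 0] = [set th w | w in [set: 'cV['F_p]_n]].
  apply/setP => v; rewrite inE; apply/eqP/imsetP => [vp|[w _ ->]].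
    have dv i : (N %/ p %| v i ord0)%N.
      have : ((v *+ p) i ord0 : nat) = 0%N by rewrite vp mxE.
      rewrite mulmxnE -{1}[v i ord0]Zp_natK -mulrnA (Zp_natr N_gt1).
      by move=> /eqP H; rewrite -(dvdn_pmul2r p0) (divnK pN).
    exists (\col_i ((v i ord0 : nat) %/ (N %/ p))%:R); rewrite ?inE //.
    apply/colP => i; rewrite !mxE val_Fp_nat // modn_small.
      by rewrite mulnC (divnK (dv i)) Zp_natK.
    rewrite ltn_divLR //; apply: leq_trans (ltn_ord (v i ord0)) _.
    by rewrite [leqRHS]mulnC (divnK pN) Zp_cast.
  apply/colP => i; rewrite mulmxnE !mxE -mulrnA mulnAC (divnK pN).
  by rewrite mulrnA Zp_natN // mul0rn.
by rewrite card_imset // cardsT card_mx muln1 card_Fp.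
Qed.

Variable L : {group V}.
Hypothesis Lp : forall v : V, v *+ p = 0 -> v \in L.

Lemma mod_p_coordinates : exists tau : V -> 'cV['F_p]_n,
  [/\ {in L &, {morph tau : u v / u + v}},
      forall y, exists2 v, v \in L & tau v = y &
      forall v, v \in L -> tau v = 0 -> exists2 u, u \in L & v = u *+ p].
Proof.
have mM : {in L &, {morph (fun v : V => v *+ p) : x y / (x * y)%g}}.
  by move=> u v _ _; apply: mulrnDl.
pose mulp := Morphism mM.
pose pL := (mulp @* L)%G.
have abL (A : {set V}) : abelian A by exact: FinRing.zmod_abelian.
have pLL : pL \subset L.
  by apply/subsetP => _ /morphimP[u uL _ ->]; apply: group_mulrn.
have nL : (pL <| L)%g by rewrite -(sub_abelian_normal _ (abL L)).
have kerE : ('ker mulp)%g = [set v : V | v *+ p == 0].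
  apply/setP => v; rewrite [RHS]inE; apply/idP/eqP => [/mker //|vp].
  by apply/kerP; [apply: Lp | ].
have cardE : #|(L / pL)%g| = (p ^ n)%N.
  rewrite card_quotient ?normal_norm // -card_torsion -kerE.
  have := card_morphim mulp L; rewrite setIid => E.
  have kL : ('ker mulp)%g \subset L by apply: subset_trans (subsetIl _ _) _.
  have := Lagrange kL; rewrite -E -(Lagrange pLL) mulnC => /eqP.
  by rewrite eqn_pmul2l ?cardG_gt0 // => /eqP.
have abelE : (p.-abelem (L / pL))%g.
  rewrite abelemE // quotient_abelian //=; apply/exponentP => y.
  case/morphimP => v _ vL ->; rewrite -morphX ?(subsetP (normal_norm nL)) //.
  by apply: coset_id; apply/morphimP; exists v.
have : ((L / pL) \isog [set: 'cV['F_p]_n])%g.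
  by rewrite (isog_abelem_card _ abelE) cardsT card_mx muln1 card_Fp // cardE eqxx
       mx_Fp_abelem.
case/isogP => h injh hT.
exists (fun v => h (coset pL v)); split.
- move=> u v uL vL; rewrite -[RHS]/(_ * _)%g -morphM ?mem_quotient //.
  by rewrite -morphM ?(subsetP (normal_norm nL)).
- move=> y; have : y \in (h @* (L / pL))%g by rewrite hT inE.
  case/morphimP => _ _ /morphimP[v _ vL ->] ->; by exists v.
move=> v vL hv.
have : coset pL v \in ('ker h)%g by apply/kerP; rewrite ?mem_quotient.
move: injh => /trivgP -> /set1P /coset_idr.
move=> /(_ (subsetP (normal_norm nL) _ vL)) /morphimP[u _ uL ->].
by exists u.
Qed.

End ModP.

End Lattice.

(** * Kernels of linear forms and the rank criterion *)

Section Kernel.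
Variables (N : nat).
Hypothesis N_gt1 : (1 < N)%N.
Variable C : finZmodType.
Hypothesis C_ann : forall p, prime p -> (p %| N)%N -> forall x : C, x *+ (N %/ p) = 0.

Lemma C_exponent (x : C) : x *+ N = 0.
Proof.
have pN := pdiv_dvd N.
by rewrite -(divnK pN) mulrnA C_ann ?mul0rn // pdiv_prime.
Qed.
Let C_exp := C_exponent.

Variable n : nat.
Local Notation V := 'cV['Z_N]_n.
Variable f : 'I_n -> C.

Lemma preact_group_set (A : {group C}) : group_set [set v : V | act f v \in A].
Proof.
apply/group_setP; split; first by rewrite inE act0 group1.
by move=> u v; rewrite !inE actD // => uA vA; apply: groupM.
Qed.

Definition preact (A : {group C}) : {group V} := Group (preact_group_set A).

Lemma preactE A v : (v \in preact A) = (act f v \in A).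
Proof. by rewrite inE. Qed.

Definition kact : {group V} := preact 1%G.

Lemma kactE v : (v \in kact) = (act f v == 0).
Proof. by rewrite preactE inE. Qed.

Lemma kact_preact (A : {group C}) : kact \subset preact A.
Proof. by apply/subsetP => v; rewrite kactE preactE => /eqP ->; apply: group1. Qed.

Lemma actMn (v : V) k : act f (v *+ k) = act f v *+ k.
Proof.
elim: k => [|k IH]; first by rewrite !mulr0n act0.
by rewrite !mulrS actD // IH.
Qed.

(** The [p]-torsion consists of multiples of [N %/ p], which kills [C]. This is what the spare
    factor [p] in [N] is for: preimages satisfy the hypothesis of [mod_p_coordinates]. *)
Lemma torsion_in_preact (A : {group C}) p (v : V) : prime p -> (p %| N)%N -> v *+ p = 0 ->
  v \in preact A.
Proof.
move=> pp pN vp; have p0 := prime_gt0 pp.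
have dv i : (N %/ p %| v i ord0)%N.
  have : ((v *+ p) i ord0 : nat) = 0%N by rewrite vp mxE.
  rewrite mulmxnE -{1}[v i ord0]Zp_natK -mulrnA (Zp_natr N_gt1).
  by move=> /eqP H; rewrite -(dvdn_pmul2r p0) (divnK pN).
have -> : v = (\col_i ((v i ord0 : nat) %/ (N %/ p))%:R) *+ (N %/ p).
  by apply/colP => i; rewrite mulmxnE !mxE -mulrnA (divnK (dv i)) Zp_natK.
by rewrite preactE actMn C_ann // group1.
Qed.

Lemma card_kact : #|[set: V] : kact|%g = #|span f|.
Proof.
have fM : {in [set: V] &, {morph (fun v : V => act f v) : x y / (x * y)%g}}.
  by move=> u v _ _; apply: actD.
pose fm := Morphism fM.
have := card_morphim fm [set: V]; rewrite setIid.
have -> : ('ker fm)%g = kact.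
  apply/setP => v; rewrite kactE; apply/idP/eqP => [/mker //|E].
  by apply/kerP; rewrite ?inE.
move=> <-; apply: eq_card => x; apply/morphimP/idP => [[v _ _ ->]|].
  exact: act_span.
by move=> /(span_act N_gt1 C_exp) [v <-]; exists v; rewrite ?inE.
Qed.

Definition colspan (I : finType) (g : I -> V) : {group V} := <<[set g j | j : I]>>%G.

Lemma mem_colspan (I : finType) (g : I -> V) j : g j \in colspan g.
Proof. by apply: mem_gen; apply: imset_f. Qed.

Lemma colspan_sub (I : finType) (g : I -> V) (K : {group V}) :
  (forall j, g j \in K) -> colspan g \subset K.
Proof. by move=> H; rewrite gen_subG; apply/subsetP => _ /imsetP[j _ ->]. Qed.

Definition hits (I : finType) (f' : I -> C) (g : I -> V) : bool :=
  [forall j, act f (g j) == f' j].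

Lemma hitsP (I : finType) (f' : I -> C) (g : I -> V) :
  reflect (forall j, act f (g j) = f' j) (hits f' g).
Proof. exact: 'forall_eqP. Qed.

(* The columns [g] generate [ker f] together with their images. *)
Lemma hits_lift m (f' : 'I_m -> C) (g : 'I_m -> V) v : hits f' g ->
  v \in preact (span f') -> exists2 w, w \in colspan g & v - w \in kact.
Proof.
move=> /hitsP hg; rewrite preactE => /gen_prodgP[k [c Hc E]].
have [w wg Ew] : exists2 w, w \in colspan g & act f w = act f v.
  rewrite E; elim: k c Hc {E} => [|k IH] c Hc.
    by exists (0 : V); [exact: group1 | rewrite act0 big_ord0].
  have [w wg Ew] := IH (fun i => c (lift ord0 i)) (fun i => Hc _).
  have /imsetP[j _ cj] := Hc ord0.
  exists (g j + w); first by rewrite group_add ?mem_colspan.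
  by rewrite actD // hg Ew -cj big_ord_recl.
by exists w => //; rewrite kactE actB // Ew subrr.
Qed.

Lemma hits_colspan (I : finType) (f' : I -> C) (g : I -> V) (A : {group C}) : hits f' g ->
  (forall j, f' j \in A) -> colspan g \subset preact A.
Proof. by move=> /hitsP hg fA; apply: colspan_sub => j; rewrite preactE hg. Qed.

End Kernel.

Section ModPrimes.
Variables (N : nat).
Hypothesis N_gt1 : (1 < N)%N.
Variable C : finZmodType.
Hypothesis C_ann : forall p, prime p -> (p %| N)%N -> forall x : C, x *+ (N %/ p) = 0.
Let C_exp := C_exponent N_gt1 C_ann.
Variable n : nat.
Local Notation V := 'cV['Z_N]_n.
Variable f : 'I_n -> C.
Variable A' : {group C}.
Local Notation Lam := (preact N_gt1 C_ann f A').
Local Notation Gam := (kact N_gt1 C_ann f).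

Variable tau : forall p : 'I_N.+1, V -> 'cV['F_p]_n.
Definition prN (p : 'I_N.+1) : bool := prime p && (p %| N)%N.
Hypothesis tauD : forall p, prN p -> {in Lam &, {morph @tau p : u v / u + v}}.
Hypothesis tau_surj : forall p, prN p -> forall y, exists2 v, v \in Lam & tau p v = y.
Hypothesis tau_ker : forall p, prN p -> forall v, v \in Lam -> tau p v = 0 ->
  exists2 u, u \in Lam & v = u *+ p.

Lemma Gam_Lam v : v \in Gam -> v \in Lam.
Proof. exact: (subsetP (kact_preact N_gt1 C_ann f A')). Qed.

Lemma tau0 p : prN p -> tau p 0 = 0.
Proof.
move=> pP; have := tauD pP (group_zero Lam) (group_zero Lam).
by rewrite addr0 => /eqP; rewrite -subr_eq0 opprD addrA subrr sub0r oppr_eq0 => /eqP.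
Qed.

Lemma tauN p v : prN p -> v \in Lam -> tau p (- v) = - tau p v.
Proof.
move=> pP vL; apply/eqP; rewrite -addr_eq0 -tauD ?group_opp // addNr tau0 //.
Qed.

Lemma tauB p u v : prN p -> u \in Lam -> v \in Lam -> tau p (u - v) = tau p u - tau p v.
Proof. by move=> pP uL vL; rewrite tauD ?group_opp // tauN. Qed.

Lemma tauMn p (v : V) k : prN p -> v \in Lam -> tau p (v *+ k) = tau p v *+ k.
Proof.
move=> pP vL; elim: k => [|k IH]; first by rewrite !mulr0n tau0.
by rewrite !mulrS tauD ?group_mulrn // IH.
Qed.

Definition coords m (p : 'I_N.+1) (g : 'I_m -> V) : 'M['F_p]_(n, m) :=
  \matrix_(i, j) tau p (g j) i ord0.

Lemma mul_coords m (p : 'I_N.+1) (g : 'I_m -> V) k (B : 'M['F_p]_(k, n)) :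
  B *m coords p g = \matrix_(i, j) (B *m tau p (g j)) i ord0.
Proof. by apply/matrixP => i j; rewrite !mxE; apply: eq_bigr => l _; rewrite !mxE. Qed.

Lemma mul_coords0 m (p : 'I_N.+1) (g : 'I_m -> V) k (B : 'M['F_p]_(k, n)) :
  B *m coords p g = 0 <-> forall j, B *m tau p (g j) = 0.
Proof.
rewrite mul_coords; split=> [/matrixP E j|E].
  by apply/colP => i; have := E i j; rewrite !mxE.
by apply/matrixP => i j; rewrite mxE E !mxE.
Qed.

(* A subset of [Lam] killed by a functional. *)
Lemma kill_group_set (p : 'I_N.+1) k (B : 'M['F_p]_(k, n)) (K : {group V}) : prN p -> K \subset Lam ->
  group_set [set v in K | B *m tau p v == 0].
Proof.
move=> pP KL; apply/group_setP; split.
  by rewrite inE group1 /= (tau0 pP) mulmx0.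
move=> u v; rewrite !inE => /andP[uK /eqP uB] /andP[vK /eqP vB].
by rewrite groupM // -[(u * v)%g]/(u + v) tauD ?(subsetP KL) // mulmxDr uB vB addr0 eqxx.
Qed.

(** The columns and [Gam] together generate [Lam], on which [tau p] is onto. *)
Lemma functional_eq0 (p : 'I_N.+1) m (f1 : 'I_m -> C) (g : 'I_m -> V) (psi : 'rV['F_p]_n) : prN p ->
  span f1 = A' -> hits f f1 g -> psi *m coords p g = 0 ->
  (forall v, v \in Gam -> psi *m tau p v = 0) -> psi = 0.
Proof.
move=> pP fA hg /mul_coords0 pg pG.
suff H v : v \in Lam -> psi *m tau p v = 0.
  apply/rowP => i; rewrite mxE.
  have [v vL Ev] := tau_surj pP (delta_mx i ord0); have := H v vL.
  rewrite Ev => /matrixP /(_ ord0 ord0); rewrite !mxE (bigD1 i) //= mxE !eqxx mulr1.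
  by rewrite big1 ?addr0 // => j ji; rewrite mxE (negPf ji) mulr0.
move=> vL.
have [w wg vw] : exists2 w, w \in colspan g & v - w \in Gam.
  by apply: hits_lift hg _; rewrite fA.
have KG := kill_group_set psi pP (subxx Lam).
have wL : w \in Group KG.
  apply: (subsetP (colspan_sub _)) wg => j; rewrite inE pg eqxx andbT preactE.
  by move/hitsP: hg => ->; rewrite -fA; apply: mem_gen; apply: imset_f.
move: wL; rewrite inE => /andP[wL /eqP wp].
by rewrite -[v](subrK w) (tauD pP (Gam_Lam vw) wL) mulmxDr pG // wp addr0.
Qed.

(** The columns already map onto [A'], so containing [Gam] amounts to spanning all of [Lam]. By
    [nakayama] this can be tested modulo each prime, where it is a rank condition. *)
Lemma colspan_full m (f1 : 'I_m -> C) (g : 'I_m -> V) : span f1 = A' -> hits f f1 g ->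
  (Gam \subset colspan g) = [forall p : 'I_N.+1, prN p ==> (\rank (coords p g) == n)].
Proof.
move=> fA hg.
have gL : colspan g \subset Lam.
  by apply: hits_colspan hg _ => j; rewrite -fA; apply: mem_gen; apply: imset_f.
have gj j : g j \in Lam by apply: (subsetP gL); apply: mem_colspan.
apply/idP/forall_inP => [Gg p pP|H].
  rewrite eqn_leq rank_leq_row /= -[X in (X <= _)%N](addn0 n) leqNgt; apply/negP => rk.
  have : kermx (coords p g) != 0.
    by rewrite -mxrank_eq0 mxrank_ker subn_eq0 -ltnNge -[X in (_ < X)%N]addn0.
  move=> /rowV0Pn[psi /sub_kermxP pg pn0].
  case/eqP: pn0; apply: (functional_eq0 pP fA hg pg) => v vG.
  have KG := kill_group_set psi pP (subxx Lam).
  have : v \in Group KG.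
    apply: (subsetP (colspan_sub _)) (subsetP Gg _ vG) => j.
    by rewrite inE gj /=; move/mul_coords0: pg => ->.
  by rewrite inE => /andP[_ /eqP].
apply: subset_trans (kact_preact N_gt1 C_ann f A') _.
apply: nakayama => // p pp pN v vL.
have pN' : (p < N.+1)%N by rewrite ltnS dvdn_leq // ltnW.
pose p' := Ordinal pN'.
have pP : prN p' by rewrite /prN pp.
have /eqP rk := H p' pP.
have full : row_full (coords p' g)^T by rewrite /row_full mxrank_tr rk.
have /submxP[c Ec] := submx_full (tau p' v)^T full.
pose w := \sum_j g j *+ (c ord0 j : nat).
have wL : w \in colspan g.
  by apply: group_sum => j _; apply: group_mulrn; apply: mem_colspan.
have wE : tau p' w = tau p' v.
  apply: trmx_inj; rewrite Ec; apply/rowP => i; rewrite !mxE.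
  have -> : tau p' w = \sum_j tau p' (g j) *+ (c ord0 j : nat).
    rewrite /w; have : true by [].
    elim: (index_enum _) => [|j s IH] _; first by rewrite !big_nil tau0.
    rewrite !big_cons tauD ?tauMn ?IH ?group_mulrn //.
    by apply: group_sum => k _; apply: group_mulrn.
  rewrite summxE; apply: eq_bigr => j _; rewrite mulmxnE !mxE.
  by rewrite -mulr_natl natr_Zp.
have vwL : v - w \in Lam by rewrite group_sub ?(subsetP gL w).
have [u uL E] : exists2 u, u \in Lam & v - w = u *+ p.
  by apply: (tau_ker pP vwL); rewrite tauB ?(subsetP gL w) // wE subrr.
by exists w => //; exists u => //; rewrite -E addrC subrK.
Qed.

End ModPrimes.

(** * The first columns: sparse relations and rank *)

Section Indicators.
Variable R : archiRealFieldType.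

Lemma exists_le_sum (T : finType) (P : pred T) :
  ([exists x, P x]%:R : R) <= \sum_x (P x)%:R.
Proof.
case: existsP => [[x Px]|_]; last by apply: sumr_ge0.
by rewrite (bigD1 x) //= Px lerDl sumr_ge0.
Qed.

Lemma natr_forall (I : finType) (P : pred I) :
  ([forall j, P j]%:R : R) = \prod_j (P j)%:R.
Proof.
case: forallP => [H|/forallP]; first by rewrite big1 // => j _; rewrite H.
by rewrite negb_forall => /existsP[j /negPf Pj]; rewrite (bigD1 j) //= Pj mul0r.
Qed.

Lemma expect_forall (I T : finType) (w : T -> R) (E : I -> pred T) :
  expect w (fun g : {ffun I -> T} => [forall j, E j (g j)]%:R)
  = \prod_j \sum_(t | E j t) w t.
Proof.
under eq_expect do rewrite natr_forall.
rewrite (expect_prod w (fun j t => (E j t)%:R)); apply: eq_bigr => j _.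
by rewrite [RHS]big_mkcond; apply: eq_bigr => t _; case: (E j t); rewrite ?mulr1 ?mulr0.
Qed.

Lemma prodr_le_expr (m : nat) (F : 'I_m -> R) (b : R) :
  (forall j, 0 <= F j <= b) -> \prod_j F j <= b ^+ m.
Proof.
move=> H; apply: le_trans (_ : \prod_(j < m) b <= _).
  exact: ler_prod.
by rewrite prodr_const card_ord.
Qed.

End Indicators.

Lemma index_le_card (gT : finGroupType) (Y : finType) (K G : {group gT}) (h : gT -> Y) :
  (forall u v, u \in G -> v \in G -> h u = h v -> (u * v^-1)%g \in K) ->
  (#|G : K|%g <= #|Y|)%N.
Proof.
move=> H.
have rG c : c \in rcosets K G -> exists2 x, x \in G & c = (K :* x)%g.
  by case/rcosetsP => x xG ->; exists x.
pose h' (c : {set gT}) := h (if [pick x in G | c == (K :* x)%g] is Some x then x else 1%g).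
rewrite /indexg -(card_in_imset (f := h')); first exact: max_card.
move=> c d /rG[x xG cx] /rG[y yG dy]; rewrite /h'.
case: pickP => [x' /andP[x'G /eqP cx']|/(_ x)]; last by rewrite xG cx eqxx.
case: pickP => [y' /andP[y'G /eqP dy']|/(_ y)]; last by rewrite yG dy eqxx.
move=> /(H _ _ x'G y'G) xyK; rewrite cx' dy'.
by apply/rcoset_eqP; rewrite mem_rcoset.
Qed.

Section FirstColumns.
Variables (R : archiRealFieldType) (N : nat).
Hypothesis N_gt1 : (1 < N)%N.
Variable q : 'Z_N -> R.
Hypothesis q_ge0 : forall r, 0 <= q r.
Hypothesis q_sum1 : \sum_r q r = 1.
Variable alpha : R.
Hypothesis alpha_gt0 : 0 < alpha.
Hypothesis alpha_half : alpha <= 1 / 2.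
Hypothesis q_bal : forall p, prime p -> (p %| N)%N -> forall r : nat,
  \sum_(x : 'Z_N | (x %% p)%N == r) q x <= 1 - alpha.
Variable C : finZmodType.
Hypothesis C_ann : forall p, prime p -> (p %| N)%N -> forall x : C, x *+ (N %/ p) = 0.
Let C_exp := C_exponent N_gt1 C_ann.
Variable n : nat.
Local Notation V := 'cV['Z_N]_n.
Variable f : 'I_n -> C.
Variable t : nat.
Hypothesis f_code : code t f.
Local Notation a := (#|span f|).

(* Some functional of weight at most [t] takes values on the columns [g] that
   depend only on the values [f1]. *)
Definition sparse_relation m (f1 : 'I_m -> C) (g : 'I_m -> V) : bool :=
  [exists p : 'I_N.+1, prN p && [exists w : {ffun 'I_n -> 'F_p},
    [&& [exists i, w i != 0], (#|[set i | w i != 0%R]| <= t)%N &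
        [exists chi : {ffun C -> 'F_p}, [forall j, act w (g j) == chi (f1 j)]]]]].

(** A functional killing [D] vanishes on the basis vectors in [D]. If fewer than [t] basis vectors
    were outside, it would be sparse, and being equal on columns with equal [f1] it would be a
    sparse relation. *)
Lemma dense_of_no_relation m (f1 : 'I_m -> C) (g : 'I_m -> V) (K D : {group V}) :
  ~~ sparse_relation f1 g -> (forall i j, f1 i = f1 j -> g i - g j \in K) ->
  K \subset D -> D :!=: [set: V] ->
  (t <= #|[set i | delta_mx i ord0 \notin D]|)%N.
Proof.
move=> hN hK KD DT; rewrite leqNgt; apply: contra hN => Dt.
have [p [pp pN [w [wn0 wD]]]] := separating_functional N_gt1 DT.
have pN' : (p < N.+1)%N by rewrite ltnS dvdn_leq // ltnW.
apply/existsP; exists (Ordinal pN'); rewrite /prN /= pp pN /=.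
apply/existsP; exists w; apply/and3P; split; first exact/existsP.
  apply: leq_trans (ltnW Dt); apply: subset_leq_card; apply/subsetP => i.
  rewrite !inE; apply: contra => iD; have := wD _ iD.
  by rewrite act_delta => // ->.
apply/existsP.
(* Any column with the given value of [f1] will do, since they all agree modulo [K]; 0 is a default
   for values that are not attained. *)
exists [ffun c => if [pick j | f1 j == c] is Some j then act w (g j) else 0].
apply/forallP => j; rewrite ffunE; case: pickP => [i /eqP ij|/(_ j)]; last by rewrite eqxx.
have := wD _ (subsetP KD _ (hK _ _ ij)).
have w_exp (z : 'F_p) : z *+ N = 0 by apply: Fp_exp.
by rewrite (actB N_gt1 w_exp) => /eqP; rewrite subr_eq0 eq_sym.
Qed.

Section SparseBound.
Variable kappa : nat.
Hypothesis kappaC : (#|C| <= kappa)%N.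
Hypothesis kappaN : (N <= kappa)%N.
Let x : R := alpha / (4 * kappa%:R).
Let beta : R := 1 - alpha / 4.
Variable e : R.
Hypothesis e_ge0 : 0 <= e.
Hypothesis e_small : #|C|%:R * e <= alpha / 4.
Hypothesis mix : forall p, prime p -> (p %| N)%N -> mixing q (C * 'F_p)%type n t e.

(** Union bound over the prime, the sparse functional [w] and the prescribed values [chi]. Each
    column has probability at most [(1 - alpha) / a + e] by [prg_low_weight], and the gain
    [1 - alpha] per column outweighs the number of sparse functionals. *)
Lemma prob_sparse m (f1 : 'I_m -> C) : (m <= n)%N ->
  expect (@wcol R N q n) (fun g : {ffun 'I_m -> V} => (hits f f1 g && sparse_relation f1 g)%:R)
  <= N.+1%:R * kappa%:R ^+ #|C| * 2 ^+ (n - m)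
     * (x^-1 ^+ t * beta ^+ n) * a%:R ^- m.
Proof.
move=> mn.
have wge := @wcol_ge0 R N q q_ge0 n.
have a0 : (0 : R) < a%:R by rewrite ltr0n cardG_gt0.
have ale1 := alpha_le1 N_gt1 q_ge0 q_bal.
set T := expect _ _; pose bnd (p : nat) : R :=
  #|[set w : {ffun 'I_n -> 'F_p} | (#|[set i | w i != 0%R]| <= t)%N]|%:R
  * (p%:R ^+ #|C| * ((1 - alpha) / a%:R + e) ^+ m).
have H1 : T <= \sum_(p : 'I_N.+1 | prN p) bnd p.
  apply: (@le_trans _ _ (\sum_(p : 'I_N.+1 | prN p)
     \sum_(w : {ffun 'I_n -> 'F_p} | [exists i, w i != 0] && (#|[set i | w i != 0%R]| <= t)%N)
     \sum_(chi : {ffun C -> 'F_p})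
       expect (@wcol R N q n) (fun g : {ffun 'I_m -> V} =>
         [forall j, (act f (g j) == f1 j) && (act w (g j) == chi (f1 j))]%:R))).
    under eq_bigr => p _ do under eq_bigr => w _ do rewrite -expect_sum.
    under eq_bigr => p _ do rewrite -expect_sum.
    rewrite -expect_sum; apply: le_expect => // g.
    case: (boolP (hits f f1 g)) => [/hitsP hg|_] /=; last first.
      by apply: sumr_ge0 => p _; apply: sumr_ge0 => w _; apply: sumr_ge0.
    apply: le_trans (exists_le_sum _ _) _.
    rewrite [leRHS]big_mkcond; apply: ler_sum => p _.
    case: (prN p) => //=.
    apply: le_trans (exists_le_sum _ _) _.
    rewrite [leRHS]big_mkcond; apply: ler_sum => w _.
    case: [exists i, w i != 0] => //=; case: (_ <= t)%N => //=.
    apply: le_trans (exists_le_sum _ _) _.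
    apply: ler_sum => chi _.
    by rewrite ler_nat; case: forallP => // H; rewrite lt0b; apply/forallP => j; rewrite hg eqxx H.
  apply: ler_sum => p /andP[pp pN].
  rewrite /bnd mulr_natl -sumr_const.
  rewrite [leLHS]big_mkcond [leRHS]big_mkcond; apply: ler_sum => w _; rewrite !inE.
  case: (_ <= t)%N / idP => [wt|_]; last first.
    by rewrite andbF.
  have bb : 0 <= (1 - alpha) / a%:R + e.
    by rewrite addr_ge0 // mulr_ge0 ?subr_ge0 // invr_ge0 ltW.
  case: existsP => [wi|_] /=; last by rewrite mulr_ge0 // exprn_ge0.
  have -> : (p%:R : R) ^+ #|C| = #|{: {ffun C -> 'F_p}}|%:R.
    by rewrite card_ffun card_Fp // natrX.
  rewrite mulr_natl -sumr_const; apply: ler_sum => chi _.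
  rewrite (expect_forall _ (fun j v => (act f v == f1 j) && (act w v == chi (f1 j)))).
  apply: prodr_le_expr => j; apply/andP; split; first by apply: sumr_ge0.
  exact: (prg_low_weight N_gt1 q_ge0 q_sum1 q_bal _ _ pp pN (mix pp pN) f_code wt wi).
apply: le_trans H1 _.
have key (p : 'I_N.+1) : prN p -> bnd p <= kappa%:R ^+ #|C| * 2 ^+ (n - m)
     * (x^-1 ^+ t * beta ^+ n) * a%:R ^- m.
  move=> /andP[pp pN].
  have pk : (p <= kappa)%N by apply: leq_trans kappaN; apply: dvdn_leq pN; exact: ltnW.
  have aC : a%:R <= #|C|%:R :> R by rewrite ler_nat max_card.
  have b2 : ((1 - alpha) / a%:R + e) ^+ m <= (1 - alpha + #|C|%:R * e) ^+ m * a%:R ^- m.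
    rewrite -exprVn -exprMn; apply: lerXn2r; rewrite ?nnegrE.
    - by rewrite addr_ge0 // mulr_ge0 ?subr_ge0 // invr_ge0 ltW.
    - by rewrite mulr_ge0 ?invr_ge0 ?(ltW a0) // addr_ge0 ?subr_ge0 // mulr_ge0.
    rewrite ler_pdivlMr // mulrDl mulfVK ?gt_eqF // lerD2l mulrC ler_wpM2r //.
  have x0 := rate_gt0 alpha_gt0 kappaC : 0 < x.
  have hp := sum_low_weight N_gt1 q_ge0 alpha_gt0 q_bal kappaC n t pp pk.
  set z := 1 - alpha + #|C|%:R * e in b2.
  have z0 : 2^-1 <= z.
    by apply: (@le_trans _ _ (1 - alpha)); [have := alpha_half; lra | rewrite /z lerDl mulr_ge0].
  (* Only [m] columns gain a factor; as [alpha <= 1 / 2] gives [z >= 1 / 2], raising the exponent to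
     [n] costs a factor 2 for each missing column. *)
  have zm : z ^+ m <= z ^+ n * 2 ^+ (n - m).
    rewrite -[X in z ^+ X * _](subnKC mn) exprD -mulrA ler_peMr ?exprn_ge0 //.
      by apply: le_trans z0; rewrite invr_ge0.
    rewrite -exprMn exprn_ege1 //; move: z0; lra.
  have zb : (1 + x * p%:R) * z <= beta.
    apply: (rate_beta N_gt1 q_ge0 alpha_gt0 q_bal kappaC pk) e_small; exact: mulr_ge0.
  have kp : (p%:R : R) ^+ #|C| <= kappa%:R ^+ #|C|.
    by apply: lerXn2r; rewrite ?nnegrE // ler_nat.
  have z00 : 0 <= z by apply: le_trans z0; rewrite invr_ge0.
  have xp0 : 0 <= 1 + x * p%:R by rewrite addr_ge0 // mulr_ge0 // ltW.
  have xi0 : 0 <= x^-1 by rewrite invr_ge0 ltW.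
  have am0 : 0 <= a%:R ^- m :> R by rewrite invr_ge0 exprn_ge0.
  rewrite /bnd.
  apply: le_trans (ler_wpM2r _ hp) _.
    rewrite mulr_ge0 ?exprn_ge0 // addr_ge0 // mulr_ge0 ?subr_ge0 // invr_ge0 ltW //.
  apply: le_trans (ler_wpM2l _ (ler_pM _ _ kp b2)) _; rewrite ?mulr_ge0 ?exprn_ge0 //.
    by rewrite addr_ge0 // mulr_ge0 ?subr_ge0 // invr_ge0 ltW.
  apply: le_trans (_ : x^-1 ^+ t * (1 + x * p%:R) ^+ n
      * (kappa%:R ^+ #|C| * (z ^+ n * 2 ^+ (n - m) * a%:R ^- m)) <= _).
    rewrite ler_wpM2l ?mulr_ge0 ?exprn_ge0 // ler_wpM2l ?exprn_ge0 // ler_wpM2r //.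
  have -> : x^-1 ^+ t * (1 + x * p%:R) ^+ n * (kappa%:R ^+ #|C| * (z ^+ n * 2 ^+ (n - m) / a%:R ^+ m))
    = kappa%:R ^+ #|C| * 2 ^+ (n - m) * (x^-1 ^+ t * ((1 + x * p%:R) * z) ^+ n) / a%:R ^+ m.
    by rewrite exprMn; ring.
  rewrite ler_wpM2r // ler_wpM2l ?mulr_ge0 ?exprn_ge0 // ler_wpM2l ?exprn_ge0 //.
  by apply: lerXn2r; rewrite ?nnegrE ?mulr_ge0 //; apply: le_trans zb; rewrite mulr_ge0.
apply: le_trans (ler_sum _ key) _.
rewrite sumr_const -[leLHS]mulr_natl -!mulrA.
rewrite ler_wpM2r //; last by rewrite ler_nat (leq_trans (max_card _)) // card_ord.
have b0 : 0 <= beta by rewrite /beta; move: ale1; lra.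
have x0 := rate_gt0 alpha_gt0 kappaC : 0 < x.
by rewrite !mulr_ge0 ?exprn_ge0 ?invr_ge0 ?exprn_ge0 // ltW.
Qed.

End SparseBound.
End FirstColumns.

Section RankDeficiency.
Variables (R : archiRealFieldType) (N : nat).
Hypothesis N_gt1 : (1 < N)%N.
Variable q : 'Z_N -> R.
Hypothesis q_ge0 : forall r, 0 <= q r.
Hypothesis q_sum1 : \sum_r q r = 1.
Variable C : finZmodType.
Hypothesis C_ann : forall p, prime p -> (p %| N)%N -> forall x : C, x *+ (N %/ p) = 0.
Let C_exp := C_exponent N_gt1 C_ann.
Variable n : nat.
Local Notation V := 'cV['Z_N]_n.
Variable f : 'I_n -> C.
Variable t : nat.
Local Notation a := (#|span f|).

Variable A' : {group C}.
Hypothesis A'f : A' \subset span f.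
Local Notation Lam := (preact N_gt1 C_ann f A').
Local Notation Gam := (kact N_gt1 C_ann f).
Variable tau : forall p : 'I_N.+1, V -> 'cV['F_p]_n.
Hypothesis tauD : forall p, prN p -> {in Lam &, {morph @tau p : u v / u + v}}.
Hypothesis tau_surj : forall p, prN p -> forall y, exists2 v, v \in Lam & tau p v = y.
Hypothesis tau_ker : forall p, prN p -> forall v, v \in Lam -> tau p v = 0 ->
  exists2 u, u \in Lam & v = u *+ p.

Variables (c s : nat) (e : R).
Hypothesis e_ge0 : 0 <= e.
Hypothesis s_gt0 : (0 < s)%N.
Hypothesis sct : (s * c <= t)%N.
Hypothesis mixK : forall K : {group V}, (#|[set: V] : K|%g <= c)%N ->
  mixing q (coset_of K) n s e.

Lemma prob_coset m (f1 : 'I_m -> C) (g : 'I_m -> V) (K : {group V}) x :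
  ~~ sparse_relation t f1 g -> (forall i j, f1 i = f1 j -> g i - g j \in K) ->
  (#|[set: V] : K|%g <= c)%N ->
  `|\sum_(v | v - x \in K) wcol q v - #|[set: V] : K|%g%:R^-1| <= e.
Proof.
move=> hN hK Kc; apply: (prg_subgroup q_sum1 x (mixK Kc) s_gt0) => D KD DT.
apply: leq_trans (dense_of_no_relation N_gt1 hN hK KD DT).
by apply: leq_trans sct; rewrite leq_mul2l Kc orbT.
Qed.

Variables (m : nat) (f1 : 'I_m -> C).
Hypothesis f1A : span f1 = A'.

Lemma f1_in j : f1 j \in A'.
Proof. by rewrite -f1A; apply: mem_gen; apply: imset_f. Qed.

Lemma hits_Lam (g : 'I_m -> V) j : hits f f1 g -> g j \in Lam.
Proof. by move=> /hitsP hg; rewrite preactE hg f1_in. Qed.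

Lemma hits_Gam (g : 'I_m -> V) i j : hits f f1 g -> f1 i = f1 j -> g i - g j \in Gam.
Proof. by move=> /hitsP hg ij; rewrite kactE actB // !hg ij subrr. Qed.

Definition kill (p : 'I_N.+1) k (B : 'M['F_p]_(k, n)) : {set V} :=
  [set v in Gam | B *m tau p v == 0].

Lemma kill_group (p : 'I_N.+1) k (B : 'M['F_p]_(k, n)) : prN p -> group_set (kill B).
Proof.
move=> pP; apply: (kill_group_set tauD B pP).
exact: kact_preact.
Qed.

Hypothesis c_ge : (#|C| * N <= c)%N.

(** A nonzero functional maps [Gam] onto ['F_p], a group of prime order, and [Gam] itself has index
    [a]. *)
Lemma index_kill (p : 'I_N.+1) (psi : 'rV['F_p]_n) (pP : prN p) :
  (exists2 v, v \in Gam & psi *m tau p v != 0) ->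
  #|[set: V] : Group (kill_group psi pP)|%g = (p * a)%N.
Proof.
move=> [v vG vn0]; have [pp pN] := andP pP.
set K := Group _.
have KG : K \subset Gam by apply/subsetP => u; rewrite inE => /andP[].
rewrite -(Lagrange_index (subsetT Gam) KG) card_kact mulnC; congr (_ * _)%N.
have hM : {in Gam &, {morph (fun v : V => psi *m tau p v) : x y / (x * y)%g}}.
  move=> x y xG yG; rewrite -[(x * y)%g]/(x + y) (tauD pP) ?mulmxDr //;
  exact: (subsetP (kact_preact N_gt1 C_ann f A')).
pose hm := Morphism hM.
have := card_morphim hm Gam; rewrite setIid.
have -> : ('ker hm)%g = K.
  apply/setP => u; rewrite [RHS]inE; apply/idP/andP => [uk|[uG /eqP u0]].
    by split; [apply: dom_ker uk | apply/eqP; apply: mker uk].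
  exact/kerP.
move=> <-.
have cT : #|[set: 'M['F_p]_(1, 1)]| = p by rewrite cardsT card_mx card_Fp.
have := cardSg (subsetT (hm @* Gam)%G); rewrite cT => dv.
have : (#|(hm @* Gam)%g| == 1%N) || (#|(hm @* Gam)%g| == p) by move: pp => /primeP[_ /(_ _ dv)].
case/orP => /eqP // E1; case/eqP: vn0.
have : hm v \in (hm @* Gam)%g by apply: mem_morphim.
by rewrite (card1_trivg E1) => /set1P.
Qed.

(** If the event is possible, fix one [g0] in it. Since [g0] has no sparse relation, a random column
    is nearly uniform modulo [K]; and every other [g] in the event has its columns in the same
    cosets of [K] as those of [g0]. *)
Lemma prob_kernel (p : 'I_N.+1) (psi : 'rV['F_p]_n) : prN p -> psi != 0 ->
  expect (@wcol R N q n) (fun g : {ffun 'I_m -> V} =>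
    [&& hits f f1 g, ~~ sparse_relation t f1 g & psi *m coords tau p g == 0]%:R)
  <= ((p * a)%:R^-1 + e) ^+ m.
Proof.
move=> pP pn0; have wge := @wcol_ge0 R N q q_ge0 n.
have [pp pN] := andP pP.
have b0 : 0 <= ((p * a)%:R^-1 + e) ^+ m by rewrite exprn_ge0 // addr_ge0 // invr_ge0.
case: (pickP (fun g : {ffun 'I_m -> V} =>
    [&& hits f f1 g, ~~ sparse_relation t f1 g & psi *m coords tau p g == 0])) => [g0|none]; last first.
  under eq_expect do rewrite none.
  by rewrite /expect big1 // => g _; rewrite mulr0.
move=> /and3P[hg0 ng0 /eqP pg0].
have exG : exists2 v, v \in Gam & psi *m tau p v != 0.
  apply/exists_inP; apply: contraT; rewrite negb_exists_in => /forall_inP H.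
  case/eqP: pn0; apply: (functional_eq0 tauD tau_surj pP f1A hg0 pg0) => v vG.
  by apply/eqP; rewrite -[_ == 0]negbK H.
set K := Group (kill_group psi pP).
have idxK := index_kill pP exG.
have Kc : (#|[set: V] : K|%g <= c)%N.
  rewrite idxK; apply: leq_trans c_ge; rewrite mulnC leq_mul ?max_card //.
  by apply: dvdn_leq pN; exact: ltnW.
have hK i j : f1 i = f1 j -> g0 i - g0 j \in K.
  move=> ij; rewrite inE (hits_Gam hg0 ij) /=.
  rewrite (tauB tauD) ?(hits_Lam _ hg0) //.
  by move/mul_coords0: pg0 => pg0; rewrite mulmxBr !pg0 subrr.
have P1 y := prob_coset y ng0 hK Kc.
apply: (@le_trans _ _ (expect (@wcol R N q n) (fun g : {ffun 'I_m -> V} =>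
    [forall j, (act f (g j) == f1 j) && (psi *m tau p (g j) == 0)]%:R))).
  apply: le_expect => // g; rewrite ler_nat.
  case: and3P => // -[/hitsP hg _ /eqP/mul_coords0 pg]; rewrite lt0b.
  by apply/forallP => j; rewrite hg pg !eqxx.
rewrite (expect_forall _ (fun j v => (act f v == f1 j) && (psi *m tau p v == 0))).
apply: prodr_le_expr => j; apply/andP; split; first exact: sumr_ge0.
apply: (@le_trans _ _ (\sum_(v | v - g0 j \in K) wcol q v)).
  rewrite big_mkcond [leRHS]big_mkcond; apply: ler_sum => v _.
  case: ifP => [/andP[/eqP fv /eqP pv]|_]; last by case: ifP.
  have -> : v - g0 j \in K; last by [].
  have vL : v \in Lam by rewrite preactE fv f1_in.
  rewrite inE kactE actB // fv; move/hitsP: (hg0) => ->; rewrite subrr eqxx /=.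
  rewrite (tauB tauD) ?(hits_Lam _ hg0) // mulmxBr pv.
  by move/mul_coords0: pg0 => ->; rewrite subrr.
have := P1 (g0 j); rewrite ler_norml => /andP[_]; rewrite lerBlDl idxK; exact.
Qed.

Lemma card_left_kernel (p : 'I_N.+1) (X : 'M['F_p]_(n, m)) : prime p ->
  #|[set psi : 'rV['F_p]_n | psi *m X == 0]| = (p ^ (n - \rank X))%N.
Proof.
move=> pp; rewrite -mxrank_ker -[X in (X ^ _)%N](card_Fp pp) -card_rowg.
by apply: eq_card => psi; rewrite !inE sub_kermx.
Qed.

Definition admissible (g : 'I_m -> V) : bool := hits f f1 g && ~~ sparse_relation t f1 g.

(** First moment of the number of nonzero row vectors killing the columns. As [n = m + r], each
    admissible [g] contributes at least [p ^ r - 1] of them, and a rank-deficient one at least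
    [p ^ r.+1 - 1]; the excess singles out the deficient ones. *)
Lemma prob_rank_deficient (p : 'I_N.+1) r : n = (m + r)%N -> prN p ->
  expect (@wcol R N q n) (fun g : {ffun 'I_m -> V} =>
    (admissible g && (\rank (coords tau p g) < m)%N)%:R) * (p%:R ^+ r.+1 - p%:R ^+ r)
  + (p%:R ^+ r - 1) * expect (@wcol R N q n) (fun g : {ffun 'I_m -> V} => (admissible g)%:R)
  <= p%:R ^+ n * ((p * a)%:R^-1 + e) ^+ m.
Proof.
move=> nE pP; have [pp pN] := andP pP; have wge := @wcol_ge0 R N q q_ge0 n.
rewrite mulrC -!expectZ -expectD.
apply: (@le_trans _ _ (expect (@wcol R N q n) (fun g : {ffun 'I_m -> V} =>
   \sum_(psi : 'rV['F_p]_n | psi != 0)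
     [&& hits f f1 g, ~~ sparse_relation t f1 g & psi *m coords tau p g == 0]%:R))).
  apply: le_expect => // g; rewrite /admissible.
  case: (boolP (hits f f1 g)) => hg /=; last by rewrite !mulr0 addr0 sumr_ge0.
  case: (boolP (sparse_relation t f1 g)) => ng /=; first by rewrite !mulr0 addr0 sumr_ge0.
  rewrite mulr1.
  have -> : \sum_(psi : 'rV['F_p]_n | psi != 0) (psi *m coords tau p g == 0)%:R
    = (p ^ (n - \rank (coords tau p g)))%:R - 1 :> R.
    rewrite -card_left_kernel // -sum1_card natr_sum [X in _ = X - 1](bigD1 (0 : 'rV['F_p]_n)) /=.
      rewrite addrAC subrr add0r big_mkcond [RHS]big_mkcond; apply: eq_bigr => psi _.
      by rewrite inE; case: (psi == 0); case: (_ == 0).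
    by rewrite inE mul0mx.
  have rk : (\rank (coords tau p g) <= m)%N by apply: rank_leq_col.
  have p1 : 1 <= (p%:R : R) by rewrite ler1n prime_gt0.
  case: (ltnP (\rank (coords tau p g)) m) => rm; rewrite natrX.
    rewrite mulr1 addrA subrK lerD2r.
    by apply: ler_weXn2l => //; move: nE rm rk; lia.
  rewrite mulr0 add0r lerD2r.
  by apply: ler_weXn2l => //; move: nE rm rk; lia.
rewrite expect_sum.
apply: (@le_trans _ _ (\sum_(psi : 'rV['F_p]_n) ((p * a)%:R^-1 + e) ^+ m)).
  rewrite big_mkcond; apply: ler_sum => psi _.
  case: ifP => [pn0|_]; first exact: prob_kernel.
  by rewrite exprn_ge0 // addr_ge0 // invr_ge0.
by rewrite sumr_const card_mx mul1n card_Fp // -[leLHS]mulr_natl natrX.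
Qed.

End RankDeficiency.

(** * The last columns: completing the matrix *)

Lemma left_kernel_basis (F : fieldType) n m r (X : 'M[F]_(n, m)) :
  (n - \rank X)%N = r -> exists B : 'M[F]_(r, n),
  [/\ row_free B, B *m X = 0 & forall psi : 'rV_n, psi *m X = 0 -> exists y, psi = y *m B].
Proof.
rewrite -mxrank_ker => <-; exists (row_base (kermx X)); split.
- exact: row_base_free.
- by apply/sub_kermxP; rewrite eq_row_base.
move=> psi /sub_kermxP pX.
have /submxP[y ->] : (psi <= row_base (kermx X))%MS by rewrite eq_row_base.
by exists y.
Qed.

Lemma row_free_inj (F : fieldType) m n (A : 'M[F]_(m, n)) :
  reflect (forall v : 'rV_m, v *m A = 0 -> v = 0) (row_free A).
Proof.
rewrite -kermx_eq0; apply: (iffP idP) => [/eqP k0 v /sub_kermxP|H].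
  by rewrite k0 submx0 => /eqP.
apply: contraT => /rowV0Pn[v /sub_kermxP /H ->]; by rewrite eqxx.
Qed.

(** A row killing [row_mx X Y] kills [X], so it is [y *m B], and then [y] kills [B *m Y]. *)
Lemma rank_row_mx_unit (F : fieldType) n m r (X : 'M[F]_(n, m)) (Y : 'M[F]_(n, r))
    (B : 'M[F]_(r, n)) : row_free B -> B *m X = 0 ->
  (forall psi : 'rV_n, psi *m X = 0 -> exists y, psi = y *m B) ->
  (\rank (row_mx X Y) == n) = (B *m Y \in unitmx).
Proof.
move=> /row_free_inj fB BX HB; rewrite -row_free_unit -/(row_free _).
apply/row_free_inj/row_free_inj => H v.
  rewrite mulmxA => vBY; apply: fB; apply: H.
  by rewrite mul_mx_row vBY -mulmxA BX mulmx0 row_mx0.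
rewrite mul_mx_row => /eqP; rewrite row_mx_eq0 => /andP[/eqP vX /eqP vY].
have [y Ey] := HB v vX; rewrite Ey in vY *.
by rewrite (H y) ?mul0mx // mulmxA.
Qed.

Section Smoothing.
Variable R : archiRealFieldType.
Variables (V : finZmodType) (I : finType) (w : V -> R) (K : {group V}).

(** A function invariant under [K] in each coordinate sees only the masses of cosets: average the
    expectation over all translations by [K]. *)
Lemma smoothing (F : {ffun I -> V} -> R) :
  (forall g k : {ffun I -> V}, (forall j, k j \in K) -> F [ffun j => g j + k j] = F g) ->
  #|K|%:R ^+ #|I| * expect w F
  = \sum_g F g * \prod_j \sum_(v | v - g j \in K) w v.
Proof.
move=> Fper.
have -> : (#|K|%:R : R) ^+ #|I| * expect w F
    = \sum_(k : {ffun I -> V} | k \in ffun_on K) \sum_(g : {ffun I -> V})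
        (\prod_j w (g j + k j)) * F g.
  rewrite (eq_bigr (fun=> expect w F)) => [|k /ffun_onP kK].
    rewrite sumr_const card_ffun_on -[RHS]mulr_natl natrX //.
  rewrite /expect [RHS](reindex (fun g : {ffun I -> V} => [ffun j => g j + k j])) /=.
    by apply: eq_bigr => g _; rewrite Fper //; congr (_ * _); apply: eq_bigr => j _; rewrite ffunE.
  by exists (fun g : {ffun I -> V} => [ffun j => g j - k j]) => g _;
    apply/ffunP => j; rewrite !ffunE ?addrK ?subrK.
rewrite exchange_big; apply: eq_bigr => g _ /=.
rewrite -mulr_suml mulrC; congr (_ * _).
rewrite -(bigA_distr_big (mem K) (fun j x => w (g j + x))) /=; apply: eq_bigr => j _.
rewrite [RHS](reindex (fun x => g j + x)) /=.
  by apply: eq_bigl => x; rewrite addrC addKr.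
by exists (fun x => x - g j) => x _; rewrite ?subrKC // addrC ?addKr ?subrK.
Qed.

End Smoothing.

Section UnitCount.
Variables (p r : nat).
Hypothesis pp : prime p.

Definition card_unitmx : nat := #|[set X : 'M['F_p]_r | X \in unitmx]|.

(* A surjection from a group onto the columns has equal fibres. *)
Lemma card_unit_shift (V : finZmodType) (G : {group V}) (h : V -> 'cV['F_p]_r)
    (X0 : 'M['F_p]_r) :
  {in G &, {morph h : x y / x + y}} -> (forall y, exists2 x, x \in G & h x = y) ->
  (#|[set u : {ffun 'I_r -> V} | (u \in ffun_on G) &&
      ((X0 + \matrix_(i, j) h (u j) i ord0)%R \in unitmx)]| * p ^ (r * r)
   = card_unitmx * #|G| ^ r)%N.
Proof.
move=> hD hS.
have h0 : h 0 = 0.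
  have := hD _ _ (group1 G) (group1 G); rewrite -[X in h (X + _)]/(0) -[X in h (_ + X)]/(0).
  by rewrite addr0 => /eqP; rewrite -subr_eq0 opprD addrA subrr sub0r oppr_eq0 => /eqP.
have fib (y : 'cV['F_p]_r) : (#|[set x in G | h x == y]| * p ^ r = #|G|)%N.
  have all y' : #|[set x in G | h x == y']| = #|[set x in G | h x == 0]|.
    have [x0 x0G hx0] := hS y'.
    rewrite -[RHS](card_imset _ (addrI x0)); apply: eq_card => x; rewrite inE.
    apply/andP/imsetP => [[xG /eqP hx]|[z zH ->]].
      exists (- x0 + x); last by rewrite addrA subrr add0r.
      have zG : - x0 + x \in G by apply: groupM => //; rewrite groupV.
      rewrite inE zG /=; apply/eqP/(addrI (h x0)).
      by rewrite -hD // addrA subrr add0r addr0 hx hx0.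
    move: zH; rewrite inE => /andP[zG /eqP hz]; split; first exact: groupM.
    by rewrite hD // hz addr0 hx0.
  rewrite -[in RHS]sum1_card (partition_big h predT) //=.
  rewrite (eq_bigr (fun=> #|[set x in G | h x == y]|)) => [|y' _].
    by rewrite sum_nat_const card_mx muln1 card_Fp // mulnC.
  by rewrite all -(all y') sum1_card; apply: eq_card => x; rewrite !inE.
have -> : #|[set u : {ffun 'I_r -> V} | (u \in ffun_on G) &&
      ((X0 + \matrix_(i, j) h (u j) i ord0)%R \in unitmx)]|
  = (\sum_(X : 'M['F_p]_r | (X0 + X)%R \in unitmx) \prod_j #|[set x in G | h x == col j X]|)%N.
  rewrite -sum1_card (partition_big (fun u : {ffun 'I_r -> V} => \matrix_(i, j) h (u j) i ord0)
     (fun X => X0 + X \in unitmx)) => [|u]; last by rewrite inE => /andP[].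
  apply: eq_bigr => X XU.
  under [RHS]eq_bigr do rewrite -sum1_card.
  rewrite (bigA_distr_big_dep (fun j x => x \in [set x in G | h x == col j X]) (fun _ _ => 1%N)) /=.
  rewrite [RHS](eq_bigr (fun=> 1%N)) => [|u _]; last by rewrite big1.
  apply: eq_bigl => u; rewrite inE; apply/andP/familyP => [[/andP[/ffun_onP uG _] /eqP uX] j|H].
    rewrite !inE uG /=; apply/eqP/colP => i; by rewrite -uX !mxE.
  have uX : \matrix_(i, j) h (u j) i ord0 = X.
    apply/matrixP => i j; have := H j; rewrite inE => /andP[_ /eqP/colP/(_ i)].
    by rewrite !mxE.
  rewrite uX XU eqxx andbT; split=> //; apply/ffun_onP => j.
  by have := H j; rewrite inE => /andP[].
rewrite big_distrl /=.
rewrite (eq_bigr (fun=> #|G| ^ r)%N) => [|X _]; last first.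
  have -> : (p ^ (r * r) = \prod_(j < r) p ^ r)%N by rewrite prod_nat_const card_ord expnM.
  rewrite -big_split /= (eq_bigr (fun=> #|G|)) => [|j _]; last exact: fib.
  by rewrite prod_nat_const card_ord.
rewrite sum_nat_const; congr (_ * _)%N.
rewrite /card_unitmx -[LHS](card_imset _ (addrI X0)); apply: eq_card => X.
rewrite [RHS]inE; apply/imsetP/idP => [[Y YU ->]|XU]; first exact: YU.
exists (- X0 + X); last by rewrite addrA subrr add0r.
by rewrite unfold_in /= addrA subrr add0r.
Qed.

End UnitCount.

Section LastColumns.
Variables (R : archiRealFieldType) (N : nat).
Hypothesis N_gt1 : (1 < N)%N.
Variable q : 'Z_N -> R.
Hypothesis q_ge0 : forall r, 0 <= q r.
Hypothesis q_sum1 : \sum_r q r = 1.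
Variable C : finZmodType.
Hypothesis C_ann : forall p, prime p -> (p %| N)%N -> forall x : C, x *+ (N %/ p) = 0.
Let C_exp := C_exponent N_gt1 C_ann.
Variable n : nat.
Local Notation V := 'cV['Z_N]_n.
Variable f : 'I_n -> C.
Variable t : nat.
Local Notation a := (#|span f|).

Variable A' : {group C}.
Hypothesis A'f : A' \subset span f.
Local Notation Lam := (preact N_gt1 C_ann f A').
Local Notation Gam := (kact N_gt1 C_ann f).
Variable tau : forall p : 'I_N.+1, V -> 'cV['F_p]_n.
Hypothesis tauD : forall p, prN p -> {in Lam &, {morph @tau p : u v / u + v}}.
Hypothesis tau_surj : forall p, prN p -> forall y, exists2 v, v \in Lam & tau p v = y.

Variables (m r : nat) (f1 : 'I_m -> C) (g1 : 'I_m -> V).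
Hypothesis nE : n = (m + r)%N.
Hypothesis f1A : span f1 = A'.
Hypothesis hg1 : hits f f1 g1.
Hypothesis rk1 : forall p, prN p -> \rank (coords tau p g1) = m.

Variable B : forall p : 'I_N.+1, 'M['F_p]_(r, n).
Hypothesis B_basis : forall p, prN p -> [/\ row_free (B p), B p *m coords tau p g1 = 0 &
  forall psi : 'rV_n, psi *m coords tau p g1 = 0 -> exists y, psi = y *m B p].

Let GL v : v \in Gam -> v \in Lam.
Proof. exact: (subsetP (kact_preact N_gt1 C_ann f A') v). Qed.

Lemma dvd_natr_Fp (p : 'I_N.+1) z : prime p -> (p %| z)%N -> (z%:R : 'F_p) = 0.
Proof. by move=> pp; rewrite (dvdn_pcharf (pchar_Fp pp)) => /eqP. Qed.

(** A functional vanishing on the image of [Gam] pulls back through [B p] to one that kills both the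
    first columns and [Gam], hence is zero by [functional_eq0]. *)
Lemma Bkill_onto p : prN p -> forall y : 'cV['F_p]_r, exists2 v, v \in Gam & B p *m tau p v = y.
Proof.
move=> pP y; have [fB BX _] := B_basis pP.
have hM : {in Gam &, {morph (fun v : V => (B p *m tau p v)^T) : x y / (x * y)%g}}.
  move=> u v uG vG; rewrite -[(u * v)%g]/(u + v) -[RHS]/(_ + _).
  by rewrite (tauD pP) ?GL // mulmxDr linearD.
pose hm := Morphism hM.
have LT : (hm @* Gam)%G :==: [set: 'rV['F_p]_r].
  apply: contraT => /Fp_row_functional [z zn0 zL].
  have z0 : (z^T *m B p) = 0.
    apply: (functional_eq0 tauD tau_surj pP f1A hg1); first by rewrite -mulmxA BX mulmx0.
    move=> v vG; have := zL (hm v) (mem_morphim hm vG vG).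
    move=> /(congr1 trmx); rewrite trmx_mul trmxK trmx0 mulmxA //.
  case/eqP: zn0; apply: trmx_inj; rewrite trmx0.
  by move/row_free_inj: fB; apply.
have : y^T \in (hm @* Gam)%G by rewrite (eqP LT) inE.
by case/morphimP => v _ vG /trmx_inj ->; exists v.
Qed.

Variable f2 : 'I_r -> C.
Hypothesis f2A : forall j, f2 j \in A'.

Definition unit_at (l : seq 'I_N.+1) : {set {ffun 'I_r -> V}} :=
  [set g : {ffun 'I_r -> V} | hits f f2 g && all (fun p : 'I_N.+1 => (B p *m coords tau p g) \in unitmx) l].

Lemma hits2_Lam (g : 'I_r -> V) j : hits f f2 g -> g j \in Lam.
Proof. by move=> /hitsP hg; rewrite preactE hg f2A. Qed.

Definition ffun_add (g k : {ffun 'I_r -> V}) : {ffun 'I_r -> V} := [ffun j => g j + k j].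
Definition ffun_scale (k : {ffun 'I_r -> V}) z : {ffun 'I_r -> V} := [ffun j => k j *+ z].

Lemma hits_shift (g k : {ffun 'I_r -> V}) : (forall j, k j \in Gam) ->
  hits f f2 (ffun_add g k) = hits f f2 g.
Proof.
move=> kG; apply: eq_forallb => j; rewrite ffunE actD //.
by have := kG j; rewrite kactE => /eqP ->; rewrite addr0.
Qed.

Lemma coords_shift p (g k : {ffun 'I_r -> V}) : prN p -> hits f f2 g ->
  (forall j, k j \in Gam) ->
  coords tau p (ffun_add g k) = coords tau p g + coords tau p k.
Proof.
move=> pP hg kG; apply/matrixP => i j; rewrite !mxE ffunE (tauD pP) ?mxE //.
  exact: hits2_Lam.
exact: (subsetP (kact_preact N_gt1 C_ann f A')).
Qed.

Lemma card_hits : #|[set g : {ffun 'I_r -> V} | hits f f2 g]| = (#|Gam| ^ r)%N.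
Proof.
have ex j : exists v : V, act f v == f2 j.
  by have [v <-] := span_act N_gt1 C_exp (subsetP A'f _ (f2A j)); exists v.
pose g0 : {ffun 'I_r -> V} := [ffun j => xchoose (ex j)].
have hg0 : hits f f2 g0 by apply/forallP => j; rewrite ffunE (eqP (xchooseP (ex j))).
rewrite -[in RHS](card_ord r) -card_ffun_on.
have inj : injective (ffun_add g0).
  by move=> k k' /ffunP E; apply/ffunP => j; have := E j; rewrite !ffunE => /addrI.
rewrite -[RHS](card_imset _ inj); apply: eq_card => g; rewrite inE.
apply/idP/imsetP => [hg|[k /ffun_onP kG ->]]; last by rewrite (hits_shift _ kG).
exists [ffun j => g j - g0 j].
  apply/ffun_onP => j; rewrite ffunE kactE actB //.
  by move/hitsP: hg => ->; move/hitsP: hg0 => ->; rewrite subrr.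
by apply/ffunP => j; rewrite !ffunE addrC subrK.
Qed.

(** Induction over the primes. Translate the columns by [z] times elements of [Gam], where [z] is 1
    modulo [p] and 0 modulo the other primes: the matrix at [p] becomes uniform by
    [card_unit_shift], and the conditions at the other primes do not change. *)
Lemma card_unit_at (l : seq 'I_N.+1) : uniq l -> all (fun p => prN p) l ->
  (#|unit_at l| * \prod_(p <- l) (p ^ (r * r)) = #|Gam| ^ r * \prod_(p <- l) card_unitmx p r)%N.
Proof.
elim: l => [|p l IH] /=.
  by rewrite !big_nil !muln1 -card_hits => _ _; apply: eq_card => g; rewrite !inE andbT.
move=> /andP[pl ul] /andP[pP lP]; have {IH} := IH ul lP.
rewrite !big_cons.
set S := unit_at l; set S' := unit_at (p :: l) => IH.
have [pp pN] := andP pP.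
have cop : coprime p (\prod_(p' <- l) (p' : nat)).
  rewrite coprime_sym big_seq_cond; apply: (big_rec (fun x => coprime x p)); first exact: coprime1n.
  move=> p' k /andP[p'l _] ck; rewrite coprimeMl ck andbT.
  rewrite prime_coprime; last by have /andP[] := allP lP _ p'l.
  rewrite dvdn_prime2 //; last by have /andP[] := allP lP _ p'l.
  by apply: contraNneq pl => pE; rewrite -(val_inj pE).
set Q := (\prod_(p' <- l) (p' : nat))%N in cop.
pose z := chinese p Q 1 0.
have zp : (z = 1 %[mod p])%N by apply: chinese_modl.
have zl p' : p' \in l -> (p' %| z)%N.
  move=> p'l; have zQ : (z = 0 %[mod Q])%N by apply: chinese_modr.
  have : (Q %| z)%N by rewrite /dvdn zQ mod0n.
  by apply: dvdn_trans; rewrite /Q (big_rem _ p'l) dvdn_mulr.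
have key : (#|Gam| ^ r * #|S'| * p ^ (r * r) = #|S| * (card_unitmx p r * #|Gam| ^ r))%N.
  pose sh (g u : {ffun 'I_r -> V}) := ffun_add g (ffun_scale u z).
  (* Double count of the pairs of [g] in [S] and a translation [u] whose shifted matrix is
     invertible at [p]: fixing [g] gives [T1], fixing [u] gives [T2]. *)
  pose T := (\sum_(g in S) \sum_(u : {ffun 'I_r -> V} | u \in ffun_on Gam)
     ((B p *m coords tau p (sh g u)) \in unitmx))%N.
  have zG (u : {ffun 'I_r -> V}) : u \in ffun_on Gam -> forall j, ffun_scale u z j \in Gam.
    by move=> /ffun_onP uG j; rewrite ffunE group_mulrn.
  have hS g : g \in S -> hits f f2 g by rewrite inE => /andP[].
  have shS g u : u \in ffun_on Gam -> (sh g u \in S) = (g \in S).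
    move=> uG; rewrite !inE /sh (hits_shift _ (zG _ uG)).
    apply: andb_id2l => hg.
    apply: eq_in_all => p' p'l.
    have p'P := allP lP _ p'l.
    rewrite (coords_shift p'P hg (zG _ uG)) mulmxDr.
    suff -> : B p' *m coords tau p' (ffun_scale u z) = 0 by rewrite addr0.
    apply/mul_coords0 => j; rewrite ffunE (tauMn tauD) //; last first.
      by apply: GL; move/ffun_onP: uG.
    by rewrite -scaler_nat dvd_natr_Fp ?zl ?scale0r ?mulmx0 //; have /andP[] := p'P.
  have T1 : (T * p ^ (r * r) = #|S| * (card_unitmx p r * #|Gam| ^ r))%N.
    rewrite /T big_distrl /= -sum_nat_const; apply: eq_bigr => g gS.
    have hD : {in Gam &, {morph (fun u : V => B p *m tau p u) : x y / x + y}}.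
      move=> u v uG vG; rewrite (tauD pP) ?mulmxDr //; exact: GL.
    rewrite -(card_unit_shift pp (B p *m coords tau p g) hD (Bkill_onto pP)).
    congr (_ * _)%N; rewrite -sum1_card [RHS]big_mkcond /= [LHS]big_mkcond /=.
    apply: eq_bigr => u _; rewrite in_set; case: ifP => uG; rewrite ?uG; last by [].
    rewrite andTb.
    rewrite /sh (coords_shift pP (hS _ gS) (zG _ uG)) mulmxDr.
    suff -> : B p *m coords tau p (ffun_scale u z)
      = \matrix_(i, j) (B p *m tau p (u j)) i ord0 by case: (_ \in _).
    rewrite mul_coords; apply/matrixP => i j; rewrite !mxE ffunE (tauMn tauD) //.
      suff -> : tau p (u j) *+ z = tau p (u j) by [].
      by rewrite -scaler_nat -(Fp_nat_mod pp) zp Fp_nat_mod // scale1r.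
    by apply: GL; move/ffun_onP: uG.
  have T2 : T = (#|Gam| ^ r * #|S'|)%N.
    rewrite /T exchange_big /= -[X in (_ ^ X)%N](card_ord r) -card_ffun_on -sum_nat_const.
    apply: eq_bigr => u uG.
    have -> : #|S'| = (\sum_(g in S) ((B p *m coords tau p g) \in unitmx))%N.
      rewrite -sum1_card [LHS]big_mkcond [RHS]big_mkcond; apply: eq_bigr => g _.
      have bl (b1 b2 b3 : bool) :
          (if b1 && (b2 && b3) then 1 else 0)%N = (if b1 && b3 then b2 : nat else 0)%N.
        by case: b1 b2 b3 => [] [] [].
      by rewrite !in_set; apply: bl.
    rewrite [RHS](reindex (fun g => sh g u)) /=.
      by apply: eq_bigl => g; rewrite shS.
    exists (fun g : {ffun 'I_r -> V} => [ffun j => g j - u j *+ z]) => g _;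
      apply/ffunP => j; rewrite /sh !ffunE ?addrK ?subrK //.
  by rewrite -T2.
have G0 : (0 < #|Gam| ^ r)%N by rewrite expn_gt0 cardG_gt0.
apply/eqP; rewrite -(eqn_pmul2l G0) !mulnA key [(#|S| * _ * _)%N]mulnAC IH; apply/eqP.
move: (#|Gam| ^ r)%N (card_unitmx p r) (\prod_(p <- l) card_unitmx p r)%N => x y z'.
by clear - x y z'; lia.
Qed.

End LastColumns.

(** The probability that a uniform [r] by [r] matrix is invertible modulo every prime divisor of
    [N]. *)
Definition unit_density (R : archiRealFieldType) (N r : nat) : R :=
  \prod_(p : 'I_N.+1 | prN p) ((card_unitmx p r)%:R / (p ^ (r * r))%:R).

Section LastColumnsProb.
Variables (R : archiRealFieldType) (N : nat).
Hypothesis N_gt1 : (1 < N)%N.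
Variable q : 'Z_N -> R.
Hypothesis q_ge0 : forall r, 0 <= q r.
Hypothesis q_sum1 : \sum_r q r = 1.
Variable C : finZmodType.
Hypothesis C_ann : forall p, prime p -> (p %| N)%N -> forall x : C, x *+ (N %/ p) = 0.
Let C_exp := C_exponent N_gt1 C_ann.
Variable n : nat.
Local Notation V := 'cV['Z_N]_n.
Variable f : 'I_n -> C.
Variable t : nat.
Local Notation a := (#|span f|).

Variable A' : {group C}.
Hypothesis A'f : A' \subset span f.
Local Notation Lam := (preact N_gt1 C_ann f A').
Local Notation Gam := (kact N_gt1 C_ann f).
Variable tau : forall p : 'I_N.+1, V -> 'cV['F_p]_n.
Hypothesis tauD : forall p, prN p -> {in Lam &, {morph @tau p : u v / u + v}}.
Hypothesis tau_surj : forall p, prN p -> forall y, exists2 v, v \in Lam & tau p v = y.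

Variables (c s : nat) (e : R).
Hypothesis e_ge0 : 0 <= e.
Hypothesis s_gt0 : (0 < s)%N.
Hypothesis sct : (s * c <= t)%N.
Hypothesis mixK : forall K : {group V}, (#|[set: V] : K|%g <= c)%N ->
  mixing q (coset_of K) n s e.
Hypothesis ce1 : c%:R * e <= 1.

Variables (m r : nat) (f1 : 'I_m -> C) (g1 : 'I_m -> V).
Hypothesis nE : n = (m + r)%N.
Hypothesis f1A : span f1 = A'.
Hypothesis hg1 : hits f f1 g1.
Hypothesis ng1 : ~~ sparse_relation t f1 g1.
Hypothesis rk1 : forall p, prN p -> \rank (coords tau p g1) = m.
Hypothesis c_ge : (#|C| * (N.+1 ^ r) ^ N.+1 <= c)%N.

Variable f2 : 'I_r -> C.
Hypothesis f2A : forall j, f2 j \in A'.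

Let GL v : v \in Gam -> v \in Lam.
Proof. exact: (subsetP (kact_preact N_gt1 C_ann f A') v). Qed.

Section WithBasis.
Variable B : forall p : 'I_N.+1, 'M['F_p]_(r, n).
Hypothesis B_basis : forall p, prN p -> [/\ row_free (B p), B p *m coords tau p g1 = 0 &
  forall psi : 'rV_n, psi *m coords tau p g1 = 0 -> exists y, psi = y *m B p].

(** The last columns matter only modulo this subgroup: translation by it changes neither their
    values under [f] nor the matrices [B p *m coords tau p g]. *)
Definition common_kill : {set V} :=
  [set v in Gam | [forall p, prN p ==> (B p *m tau p v == 0)]].

Lemma common_killP v : reflect (v \in Gam /\ forall p, prN p -> B p *m tau p v = 0)
  (v \in common_kill).
Proof.
rewrite [v \in common_kill]in_set; apply: (iffP andP) => -[vG H]; split=> //.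
  by move=> p pP; move/forall_inP: H => H; apply/eqP; apply: H.
by apply/forall_inP => p pP; apply/eqP; apply: H.
Qed.

Lemma common_kill_group : group_set common_kill.
Proof.
apply/group_setP; split.
  apply/common_killP; split=> [|p pP]; first exact: group1.
  by rewrite (tau0 tauD pP) mulmx0.
move=> u v /common_killP[uG uB] /common_killP[vG vB]; apply/common_killP; split.
  exact: groupM.
by move=> p pP; rewrite -[(u * v)%g]/(u + v) (tauD pP) ?GL // mulmxDr uB // vB // addr0.
Qed.

Let K : {group V} := Group common_kill_group.

Lemma common_kill_sub : K \subset Gam.
Proof. by apply/subsetP => v /common_killP[]. Qed.

Lemma common_kill_index : #|[set: V] : K|%g = (a * #|Gam : K|%g)%N.
Proof. by rewrite -(Lagrange_index (subsetT Gam) common_kill_sub) card_kact mulnC. Qed.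

Lemma common_kill_bound : (#|[set: V] : K|%g <= c)%N.
Proof.
rewrite common_kill_index; apply: leq_trans c_ge; apply: leq_mul; first exact: max_card.
(* An element of [Gam] is recorded by its [r] coordinates at each prime. The primes have different
   residue fields, so the residues are stored in the common type ['I_N.+1]; this bounds the index
   independently of [n]. *)
have -> : ((N.+1 ^ r) ^ N.+1 = #|{: {ffun 'I_N.+1 -> {ffun 'I_r -> 'I_N.+1}}}|)%N.
  by rewrite !card_ffun !card_ord.
pose h (v : V) : {ffun 'I_N.+1 -> {ffun 'I_r -> 'I_N.+1}} :=
  [ffun p : 'I_N.+1 => [ffun i => inord (nat_of_ord ((B p *m tau p v) i ord0))]].
apply: (index_le_card (h := h)) => u v uG vG huv.
apply/common_killP; split; first by rewrite groupM // groupV.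
move=> p pP; have [pp pN] := andP pP.
rewrite -[(u * v^-1)%g]/(u - v) (tauB tauD) ?GL // mulmxBr.
apply/eqP; rewrite subr_eq0; apply/eqP/colP => i.
have := congr1 (fun k : {ffun 'I_N.+1 -> {ffun 'I_r -> 'I_N.+1}} => nat_of_ord (k p i)) huv.
rewrite /h !ffunE => E.
have lt (x : 'F_p) : (x < N.+1)%N.
  apply: leq_trans (ltn_ord x) _; rewrite (Fp_cast pp).
  exact: ltnW (ltn_ord p).
by move: E; rewrite !inordK // => /val_inj.
Qed.

Lemma unit_atE (g : {ffun 'I_r -> V}) :
  (hits f f2 g && [forall p, prN p ==>
     (\rank (row_mx (coords tau p g1) (coords tau p g)) == n)])
  = (g \in unit_at f tau B f2 (enum [pred p : 'I_N.+1 | prN p])).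
Proof.
rewrite in_set; congr (_ && _); apply/forall_inP/allP => H p.
  rewrite mem_enum => pP; have [fB BX HB] := B_basis pP.
  by rewrite -(rank_row_mx_unit (coords tau p g) fB BX HB); apply: H.
move=> pP; have [fB BX HB] := B_basis pP.
by rewrite (rank_row_mx_unit (coords tau p g) fB BX HB); apply: H; rewrite mem_enum.
Qed.

Let S := unit_at f tau B f2 (enum [pred p : 'I_N.+1 | prN p]).

Lemma card_S : #|S|%:R = #|Gam|%:R ^+ r * unit_density R N r :> R.
Proof.
have uP : uniq (enum [pred p : 'I_N.+1 | prN p]) by apply: enum_uniq.
have aP : all (fun p => prN p) (enum [pred p : 'I_N.+1 | prN p]).
  by apply/allP => p; rewrite mem_enum.
have := card_unit_at A'f tauD tau_surj f1A hg1 B_basis f2A uP aP.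
rewrite -/S => /(congr1 (fun k => k%:R : R)).
rewrite !natrM natrX => E.
have P0 : (\prod_(p <- enum [pred p : 'I_N.+1 | prN p]) (p ^ (r * r)))%N%:R != 0 :> R.
  rewrite pnatr_eq0 -lt0n big_seq prodn_cond_gt0 // => p pl.
  by rewrite expn_gt0 prime_gt0 //; have /andP[] := allP aP _ pl.
apply: (mulIf P0); rewrite E -mulrA; congr (_ * _).
rewrite /unit_density big_split /= prodfV !natr_prod !big_enum /=.
rewrite mulfVK //; move: P0; rewrite natr_prod big_enum //.
Qed.

(** The index of [K] is at most [c], so the absolute error [e] becomes the relative error
    [c%:R * e]. *)
Lemma unit_prob (x : V) :
  (1 - c%:R * e) * #|[set: V] : K|%g%:R^-1 <= \sum_(v | v - x \in K) wcol q v
  <= (1 + c%:R * e) * #|[set: V] : K|%g%:R^-1.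
Proof.
have hK i j : f1 i = f1 j -> g1 i - g1 j \in K.
  move=> ij; apply/common_killP; split.
    by move/hitsP: hg1 => H; rewrite kactE actB // !H ij subrr.
  move=> p pP; have [_ /mul_coords0 BX _] := B_basis pP.
  have gL k : g1 k \in Lam.
    move/hitsP: hg1 => H; rewrite preactE H -f1A.
    by apply: mem_gen; apply: imset_f.
  by rewrite (tauB tauD pP (gL i) (gL j)) mulmxBr !BX subrr.
have := prob_coset N_gt1 q_sum1 s_gt0 sct mixK x ng1 hK common_kill_bound.
set I := #|_ : _|%g; set P := \sum_(v | _) _.
have I0 : (0 : R) < I%:R by rewrite ltr0n indexg_gt0.
have Ic : I%:R <= c%:R :> R by rewrite ler_nat common_kill_bound.
have eI : e <= c%:R * e * I%:R^-1.
  by rewrite ler_pdivlMr // mulrC ler_wpM2r.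
rewrite ler_norml mulrBl mulrDl mul1r => /andP[H1 H2]; apply/andP; split.
  rewrite lerBrDr addrC in H1; apply: le_trans H1.
  by rewrite lerD2l lerN2.
by rewrite lerBlDl in H2; apply: le_trans H2 _; rewrite lerD2l.
Qed.

(** [smoothing] leaves only masses of cosets of [K], close to uniform by [unit_prob]; the exact
    count [card_S] then gives the main term. *)
Lemma expect_unit_at :
  a%:R ^- r * unit_density R N r * (1 - c%:R * e) ^+ r
  <= expect (@wcol R N q n) (fun g : {ffun 'I_r -> V} => (g \in S)%:R)
  <= a%:R ^- r * unit_density R N r * (1 + c%:R * e) ^+ r.
Proof.
have sm := @smoothing R _ ('I_r) (@wcol R N q n) K (fun g => (g \in S)%:R).
have per (g k : {ffun 'I_r -> V}) : (forall j, k j \in K) ->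
    (([ffun j => g j + k j] : {ffun 'I_r -> V}) \in S)%:R = (g \in S)%:R :> R.
  move=> kK; congr (nat_of_bool _)%:R.
  have kG j : k j \in Gam by apply: (subsetP common_kill_sub).
  rewrite -[[ffun j => _]]/(ffun_add g k) !in_set (hits_shift _ _ kG).
  apply: andb_id2l => hg; apply: eq_in_all => p; rewrite mem_enum => pP.
  rewrite (coords_shift tauD f2A pP hg kG) mulmxDr.
  suff -> : B p *m coords tau p k = 0 by rewrite addr0.
  by apply/mul_coords0 => j; have /common_killP[_ ->] := kK j.
have {}sm := sm per; rewrite card_ord in sm.
set ex := expect _ _ in sm *.
have K0 : (0 : R) < #|K|%:R by rewrite ltr0n cardG_gt0.
have KG : #|Gam|%:R = #|K|%:R * #|Gam : K|%g%:R :> R.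
  by rewrite -natrM Lagrange // common_kill_sub.
have idx : #|[set: V] : K|%g%:R = a%:R * #|Gam : K|%g%:R :> R.
  by rewrite common_kill_index natrM.
have a0 : (0 : R) < a%:R by rewrite ltr0n cardG_gt0.
have G0 : (0 : R) < #|Gam : K|%g%:R by rewrite ltr0n indexg_gt0.
have cst (b : R) : \sum_(g : {ffun 'I_r -> V}) (g \in S)%:R * \prod_(j < r) (b * #|[set: V] : K|%g%:R^-1)
   = #|K|%:R ^+ r * (a%:R ^- r * unit_density R N r * b ^+ r).
  rewrite -mulr_suml.
  have -> : \sum_(g : {ffun 'I_r -> V}) (g \in S)%:R = #|S|%:R :> R.
    by rewrite -sum1_card natr_sum [RHS]big_mkcond; apply: eq_bigr => g _; case: (g \in S).
  rewrite card_S KG prodr_const card_ord idx !exprMn !exprVn !exprMn.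
  set x1 := #|K|%:R ^+ r; set x2 := #|Gam : K|%g%:R ^+ r; set x3 := a%:R ^+ r.
  have x20 : x2 != 0 by rewrite expf_neq0 // gt_eqF.
  have x30 : x3 != 0 by rewrite expf_neq0 // gt_eqF.
  by move: (unit_density R N r) (b ^+ r) => y z; field; rewrite x20 x30.
have Kr : 0 < (#|K|%:R : R) ^+ r by rewrite exprn_gt0.
have lo : 0 <= (1 - c%:R * e) * #|[set: V] : K|%g%:R^-1.
  by rewrite mulr_ge0 ?invr_ge0 // subr_ge0.
apply/andP; split; rewrite -(ler_pM2l Kr) sm -cst; apply: ler_sum => g _;
  apply: ler_wpM2l => //; apply: ler_prod => j _; have /andP[H1 H2] := unit_prob (g j).
  by rewrite lo H1.
by rewrite H2 andbT; apply: sumr_ge0 => v _; apply: wcol_ge0.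
Qed.

End WithBasis.

Lemma last_columns :
  a%:R ^- r * unit_density R N r * (1 - c%:R * e) ^+ r
  <= expect (@wcol R N q n) (fun g : {ffun 'I_r -> V} =>
       (hits f f2 g && [forall p, prN p ==>
         (\rank (row_mx (coords tau p g1) (coords tau p g)) == n)])%:R)
  <= a%:R ^- r * unit_density R N r * (1 + c%:R * e) ^+ r.
Proof.
have ex (p : 'I_N.+1) : exists B : 'M['F_p]_(r, n), prN p ->
    [/\ row_free B, B *m coords tau p g1 = 0 &
    forall psi : 'rV_n, psi *m coords tau p g1 = 0 -> exists y, psi = y *m B].
  case: (boolP (prN p)) => [pP|_]; last by exists 0.
  have rkE : (n - \rank (coords tau p g1))%N = r by rewrite rk1 // nE addKn.
  by have [B HB] := left_kernel_basis rkE; exists B.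
have [B HB] := fin_all_exists ex.
under eq_expect do rewrite (unit_atE HB).
exact: expect_unit_at HB.
Qed.

End LastColumnsProb.

(** * The probability of one step of a chain *)

Section PairProbability.
Variables (R : archiRealFieldType) (N : nat).
Hypothesis N_gt1 : (1 < N)%N.
Variable q : 'Z_N -> R.
Hypothesis q_ge0 : forall r, 0 <= q r.
Hypothesis q_sum1 : \sum_r q r = 1.
Variable C : finZmodType.
Hypothesis C_ann : forall p, prime p -> (p %| N)%N -> forall x : C, x *+ (N %/ p) = 0.
Let C_exp := C_exponent N_gt1 C_ann.

(* Probability that a random matrix [M] satisfies [f M = f'] and that the
   kernel of [f] is contained in the image of [M]. *)
Definition pair_prob n (f f' : 'I_n -> C) : R :=
  expect (@wcol R N q n) (fun g : {ffun 'I_n -> 'cV['Z_N]_n} =>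
    (hits f f' g && (kact N_gt1 C_ann f \subset colspan g))%:R).

Section Fixed.
Variables (m r : nat).
Local Notation n := (m + r)%N.
Local Notation V := 'cV['Z_N]_n.
Variables (f f' : 'I_n -> C) (t c s : nat) (e : R).
Local Notation a := (#|span f|).
Hypothesis r_gt0 : (0 < r)%N.
Hypothesis t_r : (r < 2 * t)%N.
Hypothesis f_code : code t f.
Hypothesis f'_code : code t f'.
Hypothesis f'f : span f' \subset span f.
Hypothesis e_ge0 : 0 <= e.
Hypothesis s_gt0 : (0 < s)%N.
Hypothesis sct : (s * c <= t)%N.
Hypothesis c_ge : (#|C| * (N.+1 ^ r) ^ N.+1 <= c)%N.
Hypothesis ce_half : n%:R * (c%:R * e) <= 2^-1.
Hypothesis mixK : forall K : {group V}, (#|[set: V] : K|%g <= c)%N ->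
  mixing q (coset_of K) n s e.
Hypothesis mixC : mixing q C n (2 * t) e.
Variable sig : R.
Local Notation f1 := (fun j : 'I_m => f' (lshift r j)).
Local Notation f2 := (fun j : 'I_r => f' (rshift m j)).
Hypothesis prob_sig : expect (@wcol R N q n) (fun g : {ffun 'I_m -> V} =>
  (hits f f1 g && sparse_relation t f1 g)%:R) * a%:R ^+ m <= sig.

(** Only [r < 2 * t] positions are dropped, so no value taken [2 * t] times disappears. *)
Lemma span_first : span f1 = span f'.
Proof.
apply/eqP; rewrite -val_eqE /= eqEsubset; apply/andP; split.
  rewrite gen_subG; apply/subsetP => _ /imsetP[j _ ->].
  by apply: mem_gen; apply: imset_f.
apply: subset_trans f'_code _; rewrite gen_subG; apply/subsetP => y.
rewrite inE => ty; apply: mem_gen.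
apply: contraT => hN.
have hN' j : f' (lshift r j) != y.
  by apply: contra hN => /eqP <-; apply: (imset_f (fun j => f' (lshift r j))).
have : (#|[set i | f' i == y]| <= r)%N.
  have sub : [set i | f' i == y] \subset [set rshift m j | j : 'I_r].
    apply/subsetP => i; rewrite inE; case: (splitP i) => j Ej fy.
      have Ei : i = lshift r j by apply: val_inj.
      by rewrite Ei (negPf (hN' j)) in fy.
    by apply/imsetP; exists j => //; apply: val_inj.
  apply: leq_trans (subset_leq_card sub) _.
  by apply: leq_trans (leq_imset_card _ _) _; rewrite card_ord.
by move=> le; have := leq_trans ty le; rewrite leqNgt t_r.
Qed.

Definition glue (g1 : {ffun 'I_m -> V}) (g2 : {ffun 'I_r -> V}) : {ffun 'I_n -> V} :=
  [ffun i => match split i with inl j => g1 j | inr j => g2 j end].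

Lemma glue_l g1 g2 j : glue g1 g2 (lshift r j) = g1 j.
Proof.
rewrite ffunE; case: splitP => k Ek; first by congr (g1 _); apply: val_inj.
by have := ltn_ord j; move: Ek => /=; lia.
Qed.

Lemma glue_r g1 g2 j : glue g1 g2 (rshift m j) = g2 j.
Proof.
rewrite ffunE; case: splitP => k Ek; last first.
  by congr (g2 _); apply: val_inj; move: Ek => /=; lia.
by have := ltn_ord k; move: Ek => /=; lia.
Qed.

Lemma expect_glue (F : {ffun 'I_n -> V} -> R) :
  expect (@wcol R N q n) F = expect (@wcol R N q n) (fun g1 : {ffun 'I_m -> V} =>
    expect (@wcol R N q n) (fun g2 : {ffun 'I_r -> V} => F (glue g1 g2))).
Proof.
rewrite (expect_reindex _ _ (@unsplitK m r) (@splitK m r)).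
rewrite expect_sumtype; apply: eq_expect => g1; apply: eq_expect => g2.
congr F; apply/ffunP => i; rewrite !ffunE.
by case: (split i).
Qed.

Lemma hits_glue g1 g2 : hits f f' (glue g1 g2) = hits f f1 g1 && hits f f2 g2.
Proof.
apply/hitsP/andP => [H|[/hitsP H1 /hitsP H2] i].
  split; apply/hitsP => j; first by rewrite -H glue_l.
  by rewrite -H glue_r.
case: (splitP i) => j Ej.
  have -> : i = lshift r j by apply: val_inj.
  by rewrite glue_l.
have -> : i = rshift m j by apply: val_inj.
by rewrite glue_r.
Qed.

Local Notation Gam := (kact N_gt1 C_ann f).
Local Notation Lam := (preact N_gt1 C_ann f (span f')).

Lemma exists_tau : exists tau : forall p : 'I_N.+1, V -> 'cV['F_p]_n,
  [/\ forall p, prN p -> {in Lam &, {morph tau p : u v / u + v}},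
    forall p, prN p -> forall y, exists2 v, v \in Lam & tau p v = y &
    forall p, prN p -> forall v, v \in Lam -> tau p v = 0 ->
      exists2 u, u \in Lam & v = u *+ p].
Proof.
have ex (p : 'I_N.+1) : exists tau : V -> 'cV['F_p]_n, prN p ->
  [/\ {in Lam &, {morph tau : u v / u + v}},
      forall y, exists2 v, v \in Lam & tau v = y &
      forall v, v \in Lam -> tau v = 0 -> exists2 u, u \in Lam & v = u *+ p].
  case: (boolP (prN p)) => [/andP[pp pN]|_]; last by exists (fun=> 0).
  have [tau H] := mod_p_coordinates N_gt1 pp pN (L := Lam)
    (fun v => torsion_in_preact N_gt1 C_ann f (span f') pp pN); by exists tau.
have [tau H] := fin_all_exists ex.
by exists tau; split=> p pP; have [] := H p pP.
Qed.

Section WithTau.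
Variable tau : forall p : 'I_N.+1, V -> 'cV['F_p]_n.
Hypothesis tauD : forall p, prN p -> {in Lam &, {morph @tau p : u v / u + v}}.
Hypothesis tau_surj : forall p, prN p -> forall y, exists2 v, v \in Lam & tau p v = y.
Hypothesis tau_ker : forall p, prN p -> forall v, v \in Lam -> tau p v = 0 ->
  exists2 u, u \in Lam & v = u *+ p.

Definition full_pair (g1 : {ffun 'I_m -> V}) (g2 : {ffun 'I_r -> V}) : bool :=
  [forall p, prN p ==> (\rank (row_mx (coords tau p g1) (coords tau p g2)) == n)].

Lemma pair_event g1 g2 :
  (hits f f' (glue g1 g2) && (Gam \subset colspan (glue g1 g2)))
  = (hits f f1 g1 && (hits f f2 g2 && full_pair g1 g2)).
Proof.
rewrite andbA -hits_glue; apply: andb_id2l => hg.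
rewrite (colspan_full tauD tau_surj tau_ker (erefl _) hg).
apply: eq_forallb => p; congr (_ ==> (\rank _ == _)).
apply/matrixP => i j; rewrite mxE; case: (splitP j) => k Ek.
  have -> : j = lshift r k by apply: val_inj.
  by rewrite row_mxEl mxE glue_l.
have -> : j = rshift m k by apply: val_inj.
by rewrite row_mxEr mxE glue_r.
Qed.

Local Notation wV := (@wcol R N q n).
Local Notation adm := (fun g1 : {ffun 'I_m -> V} => admissible f t f1 g1).
Local Notation ce := (c%:R * e).

Lemma a_gt0 : (0 : R) < a%:R.
Proof. by rewrite ltr0n cardG_gt0. Qed.

Lemma ac : (a <= c)%N.
Proof.
apply: leq_trans c_ge; apply: leq_trans (max_card _) _.
by rewrite leq_pmulr // !expn_gt0.
Qed.

Lemma CNc : (#|C| * N <= c)%N.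
Proof.
apply: leq_trans c_ge; rewrite leq_mul2l; apply/orP; right.
apply: leq_trans (leqnSn N) _; rewrite -expnM -[leqLHS]expn1.
by rewrite leq_pexp2l // muln_gt0 r_gt0.
Qed.

Lemma ce_ge0 : 0 <= ce.
Proof. by rewrite mulr_ge0. Qed.

Lemma ce_le1 : ce <= 1.
Proof.
have n1 : (1 : R) <= n%:R by rewrite ler1n addn_gt0 r_gt0 orbT.
have := ce_half; have := ce_ge0; set z := c%:R * e => z0 h.
have : z <= n%:R * z by rewrite ler_peMl.
lra.
Qed.

Lemma prob_hits_le k (fk : 'I_k -> C) :
  expect wV (fun g : {ffun 'I_k -> V} => (hits f fk g)%:R) <= (a%:R^-1 + e) ^+ k.
Proof.
rewrite (expect_forall _ (fun j v => act f v == fk j)).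
apply: prodr_le_expr => j; apply/andP; split; first by apply: sumr_ge0 => v _; apply: wcol_ge0.
rewrite -[leLHS]/(prg q f (fk j)).
case: (boolP (fk j \in span f)) => [fS|fN].
  have := prg_code q_sum1 mixC f_code fS.
  by rewrite ler_norml => /andP[_]; rewrite lerBlDl.
by rewrite prg_out_span // addr_ge0 // invr_ge0.
Qed.

Lemma prob_hits_ge k (fk : 'I_k -> C) : (forall j, fk j \in span f) ->
  (a%:R^-1 - e) ^+ k <= expect wV (fun g : {ffun 'I_k -> V} => (hits f fk g)%:R).
Proof.
move=> fS; rewrite (expect_forall _ (fun j v => act f v == fk j)).
have ae : 0 <= a%:R^-1 - e.
  rewrite subr_ge0 -[leRHS]mul1r ler_pdivlMr ?a_gt0 //.
  apply: le_trans ce_le1; rewrite mulrC ler_wpM2r // ler_nat; exact: ac.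
rewrite -[X in _ ^+ X](card_ord k) -prodr_const; apply: ler_prod => j _.
rewrite ae -[leRHS]/(prg q f (fk j)) /=.
have := prg_code q_sum1 mixC f_code (fS j).
by rewrite ler_norml => /andP[+ _]; rewrite lerBrDr addrC.
Qed.

Local Notation z := (n%:R * ce).

Lemma z_ge0 : 0 <= z.
Proof. by rewrite mulr_ge0 // ce_ge0. Qed.

Lemma pow_up k (d : R) : (k <= n)%N -> 0 <= d <= ce -> (1 + d) ^+ k <= 1 + 2 * z.
Proof.
move=> kn /andP[d0 dc].
apply: (@le_trans _ _ ((1 + ce) ^+ n)); last exact: expr1p_le ce_ge0 ce_half.
have c1 : 1 <= 1 + ce by rewrite lerDl ce_ge0.
apply: le_trans (ler_weXn2l c1 kn); apply: lerXn2r; rewrite ?nnegrE ?addr_ge0 ?ce_ge0 //.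
by rewrite lerD2l.
Qed.

Lemma pow_lo k (d : R) : (k <= n)%N -> 0 <= d <= ce -> 1 - z <= (1 - d) ^+ k.
Proof.
move=> kn /andP[d0 dc]; apply: le_trans (expr1m_ge _ (le_trans dc ce_le1)).
rewrite lerD2l lerN2; apply: ler_pM => //.
by rewrite ler_nat.
Qed.

Lemma ae_ce : 0 <= a%:R * e <= ce.
Proof. by rewrite mulr_ge0 //= ler_wpM2r // ler_nat ac. Qed.

Lemma scaled_up k : (k <= n)%N -> (a%:R^-1 + e) ^+ k * a%:R ^+ k <= 1 + 2 * z.
Proof.
move=> kn; rewrite -exprMn mulrDl mulVf ?gt_eqF ?a_gt0 // mulrC.
exact: pow_up kn ae_ce.
Qed.

Lemma scaled_lo k : (k <= n)%N -> 1 - z <= (a%:R^-1 - e) ^+ k * a%:R ^+ k.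
Proof.
move=> kn; rewrite -exprMn mulrBl mulVf ?gt_eqF ?a_gt0 // [e * _]mulrC.
exact: pow_lo kn ae_ce.
Qed.

Local Notation gam := (unit_density R N r).

Lemma gam_ge0 : 0 <= gam.
Proof. by apply: prodr_ge0 => p _; rewrite mulr_ge0 // invr_ge0. Qed.

(** The conditional probability, given the first columns, that the last ones complete the event. *)
Definition inner (g1 : {ffun 'I_m -> V}) : R :=
  expect wV (fun g2 : {ffun 'I_r -> V} => (hits f f2 g2 && full_pair g1 g2)%:R).

Lemma inner_ge0 g1 : 0 <= inner g1.
Proof. by apply: expect_ge0 => // v; apply: wcol_ge0. Qed.

Lemma pair_prob_inner :
  pair_prob f f' = expect wV (fun g1 : {ffun 'I_m -> V} => (hits f f1 g1)%:R * inner g1).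
Proof.
rewrite /pair_prob expect_glue; apply: eq_expect => g1.
rewrite /inner -expectZ; apply: eq_expect => g2.
by rewrite pair_event; case: (hits f f1 g1); rewrite ?mul1r ?mul0r.
Qed.

Definition all_full (g1 : {ffun 'I_m -> V}) : bool :=
  [forall p, prN p ==> (\rank (coords tau p g1) == m)].

(** The last [r] columns raise the rank by at most [r], so a first block of rank below [m] is never
    completed. *)
Lemma inner_deficient (g1 : {ffun 'I_m -> V}) : ~~ all_full g1 -> inner g1 = 0.
Proof.
rewrite negb_forall => /existsP[p]; rewrite negb_imply => /andP[pP rk].
rewrite /inner -[RHS](mul0r (expect wV (fun _ : {ffun 'I_r -> V} => 1))) -expectZ.
apply: eq_expect => g2; rewrite mul0r.
suff -> : full_pair g1 g2 = false by rewrite andbF.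
apply: contraNF rk => /forall_inP /(_ p pP) /eqP rn.
rewrite eqn_leq rank_leq_col /=.
have : (\rank (row_mx (coords tau p g1) (coords tau p g2))
    <= \rank (coords tau p g1) + \rank (coords tau p g2))%N.
  rewrite -mxrank_tr tr_row_mx -addsmxE -[X in (_ <= X + _)%N]mxrank_tr
    -[X in (_ <= _ + X)%N]mxrank_tr.
  exact: mxrank_adds_leqif.
rewrite rn => le; rewrite -(leq_add2r r); apply: leq_trans le _.
by rewrite leq_add2l rank_leq_col.
Qed.

Lemma inner_full (g1 : {ffun 'I_m -> V}) : admissible f t f1 g1 -> all_full g1 ->
  a%:R ^- r * gam * (1 - ce) ^+ r <= inner g1 <= a%:R ^- r * gam * (1 + ce) ^+ r.
Proof.
move=> /andP[hg ng] /forall_inP rk.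
have f2A j : f2 j \in span f' by apply: mem_gen; apply: imset_f.
have rk' p : prN p -> \rank (coords tau p g1) = m by move=> pP; apply/eqP; apply: rk.
apply: (last_columns q_ge0 q_sum1 f'f tauD tau_surj e_ge0 s_gt0 sct mixK ce_le1
  (erefl _) span_first hg ng rk' c_ge f2A).
Qed.

Lemma inner_le g1 : inner g1 <= (a%:R^-1 + e) ^+ r.
Proof.
apply: le_trans (prob_hits_le _); apply: le_expect => [v|g2]; first exact: wcol_ge0.
by rewrite ler_nat; case: (full_pair _ _); rewrite ?andbT ?andbF.
Qed.

Local Notation Padm := (expect wV (fun g1 : {ffun 'I_m -> V} => (admissible f t f1 g1)%:R)).

Lemma Padm_le : Padm * a%:R ^+ m <= 1 + 2 * z.
Proof.
apply: le_trans (scaled_up (leq_addr r m)).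
rewrite ler_wpM2r ?exprn_ge0 //; apply: le_trans (prob_hits_le f1).
apply: le_expect => [v|g1]; first exact: wcol_ge0.
by rewrite ler_nat /admissible; case: (hits _ _ _); rewrite ?leq_b1.
Qed.

Lemma Padm_ge : 1 - z - sig <= Padm * a%:R ^+ m.
Proof.
have f1S j : f1 j \in span f.
  by apply: (subsetP f'f); apply: mem_gen; apply: imset_f.
have H := prob_hits_ge f1S.
have split_hits : expect wV (fun g : {ffun 'I_m -> V} => (hits f f1 g)%:R)
  = Padm + expect wV (fun g : {ffun 'I_m -> V} => (hits f f1 g && sparse_relation t f1 g)%:R).
  rewrite -expectD; apply: eq_expect => g; rewrite /admissible.
  by case: (hits _ _ _); case: (sparse_relation _ _ _) => /=; rewrite ?addr0 ?add0r.
have am : 0 <= a%:R ^+ m :> R by rewrite exprn_ge0.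
have := ler_wpM2r am H; rewrite split_hits mulrDl => H'.
have := le_trans (scaled_lo (leq_addr r m)) H' => H''.
by rewrite lerBlDr; apply: le_trans H'' _; rewrite lerD2l.
Qed.

(** Admissible first columns are completed with probability at most about [gam] times [a ^- r];
    those with a sparse relation contribute at most [sig] up to the same relative error. *)
Lemma pair_prob_upper : pair_prob f f' * a%:R ^+ n <= (gam + sig) * (1 + 2 * z).
Proof.
have wge := @wcol_ge0 R N q q_ge0 n.
have ar0 : 0 <= a%:R ^- r * gam * (1 + ce) ^+ r.
  by rewrite mulr_ge0 ?mulr_ge0 ?gam_ge0 ?invr_ge0 ?exprn_ge0 // addr_ge0 // ce_ge0.
have br0 : 0 <= (a%:R^-1 + e) ^+ r by rewrite exprn_ge0 // addr_ge0 // invr_ge0.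
have step1 : pair_prob f f' <= a%:R ^- r * gam * (1 + ce) ^+ r * Padm
  + (a%:R^-1 + e) ^+ r * expect wV (fun g : {ffun 'I_m -> V} =>
      (hits f f1 g && sparse_relation t f1 g)%:R).
  rewrite pair_prob_inner -!expectZ -expectD; apply: le_expect => // g1.
  case hg : (hits f f1 g1); last by rewrite mul0r addr_ge0 // mulr_ge0.
  case sg : (sparse_relation t f1 g1); rewrite /admissible hg sg /= mul1r ?mulr0 ?mulr1.
    by rewrite add0r inner_le.
  rewrite addr0; case: (boolP (all_full g1)) => fg; last by rewrite inner_deficient.
  have ag : admissible f t f1 g1 by rewrite /admissible hg sg.
  by have /andP[] := inner_full ag fg.
have an0 : 0 <= a%:R ^+ n :> R by rewrite exprn_ge0.
apply: le_trans (ler_wpM2r an0 step1) _; rewrite mulrDl [leRHS]mulrDl.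
have ane : (a%:R : R) ^+ r != 0 by rewrite expf_neq0 // gt_eqF // a_gt0.
have z0 := z_ge0.
have U0 : 0 <= 1 + 2 * z by rewrite addr_ge0 // mulr_ge0.
apply: lerD.
  have -> : a%:R ^- r * gam * (1 + ce) ^+ r * Padm * a%:R ^+ n
    = gam * ((1 + ce) ^+ r * (Padm * a%:R ^+ m)).
    rewrite exprD; set P := Padm; set x1 := a%:R ^+ m; set x2 := a%:R ^+ r in ane *.
    by field.
  rewrite ler_wpM2l ?gam_ge0 //.
  have h1 : (1 + ce) ^+ n <= 1 + 2 * z by apply: expr1p_le ce_ge0 ce_half.
  apply: le_trans h1; have -> : (1 + ce) ^+ n = (1 + ce) ^+ r * (1 + ce) ^+ m.
    by rewrite exprD mulrC.
  rewrite ler_wpM2l //.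
    by rewrite exprn_ge0 // addr_ge0 // ce_ge0.
  have a0 := a_gt0.
  have -> : (1 + ce) ^+ m = ((1 + ce) * a%:R^-1) ^+ m * a%:R ^+ m.
    by rewrite -exprMn mulfVK // gt_eqF.
  rewrite ler_wpM2r ?exprn_ge0 //; apply: le_trans (_ : (a%:R^-1 + e) ^+ m <= _).
    apply: le_trans (prob_hits_le f1); apply: le_expect => // g1.
    by rewrite ler_nat /admissible; case: (hits _ _ _); rewrite ?leq_b1.
  apply: lerXn2r; rewrite ?nnegrE ?addr_ge0 ?invr_ge0 ?mulr_ge0 ?addr_ge0 ?ce_ge0 ?invr_ge0 //.
  rewrite mulrDl mul1r lerD2l ler_pdivlMr // mulrC.
  by have /andP[] := ae_ce.
set P := expect _ _.
have -> : (a%:R^-1 + e) ^+ r * P * a%:R ^+ n = (P * a%:R ^+ m) * ((a%:R^-1 + e) ^+ r * a%:R ^+ r).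
  by rewrite exprD; ring.
apply: ler_pM => //.
- by apply: mulr_ge0; [apply: expect_ge0 | rewrite exprn_ge0].
- by apply: mulr_ge0; [exact: br0 | rewrite exprn_ge0].
exact: scaled_up (leq_addl m r).
Qed.

(** The probability [Padm] of admissible first columns is [a ^- m] up to a small relative error, so
    the main terms of [prob_rank_deficient] cancel and leave the small errors and
    [2 * 2^-1 ^+ r]. *)
Lemma deficient_le (p : 'I_N.+1) : prN p ->
  expect wV (fun g : {ffun 'I_m -> V} =>
    (admissible f t f1 g && (\rank (coords tau p g) < m)%N)%:R) * a%:R ^+ m
  <= 3 * z + sig + 2 * 2^-1 ^+ r.
Proof.
move=> pP; have [pp pN] := andP pP.
have H := prob_rank_deficient q_ge0 q_sum1 f'f tauD tau_surj e_ge0 s_gt0 sct mixK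
  span_first CNc (erefl n) pP.
set D := expect _ _ in H *; have am : 0 <= a%:R ^+ m :> R by rewrite exprn_ge0.
have D0 : 0 <= D by apply: expect_ge0 => // v; apply: wcol_ge0.
have {}H := ler_wpM2r am H; set P := p%:R in H.
have p2 : 2 <= P :> R by rewrite /P ler_nat prime_gt1.
have p0 : 0 < P by apply: lt_le_trans p2.
have a0 := a_gt0.
have rhs : P ^+ n * ((p * a)%:R^-1 + e) ^+ m * a%:R ^+ m <= P ^+ r * (1 + 2 * z).
  have -> : P ^+ n * ((p * a)%:R^-1 + e) ^+ m * a%:R ^+ m
      = P ^+ r * (1 + P * a%:R * e) ^+ m.
    have -> : P ^+ n = P ^+ r * P ^+ m by rewrite exprD mulrC.
    have Pa : P * a%:R != 0 by rewrite gt_eqF // mulr_gt0.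
    have -> : 1 + P * a%:R * e = P * (a%:R * ((p * a)%:R^-1 + e)).
      by rewrite mulrA natrM -/P mulrDr mulfV.
    by rewrite !exprMn -!mulrA [(_ + _) ^+ m * _]mulrC.
  rewrite ler_wpM2l ?exprn_ge0 ?(ltW p0) //; apply: pow_up; first exact: leq_addr.
  rewrite !mulr_ge0 ?(ltW p0) //= ler_wpM2r // /P -natrM ler_nat.
  apply: leq_trans CNc; rewrite mulnC leq_mul ?max_card //.
  by apply: dvdn_leq pN; exact: ltnW.
have {}H := le_trans H rhs.
set A := Padm in H; set D' := D * a%:R ^+ m.
have A1 := Padm_ge; have A2 := Padm_le; rewrite -/A in A1 A2.
set A' := A * a%:R ^+ m in A1 A2.
have H2 : D' * (P ^+ r * (P - 1)) + (P ^+ r - 1) * A' <= P ^+ r * (1 + 2 * z).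
  move: H; rewrite mulrDl exprS.
  by have -> : D * (P * P ^+ r - P ^+ r) * a%:R ^+ m + (P ^+ r - 1) * A * a%:R ^+ m
    = D' * (P ^+ r * (P - 1)) + (P ^+ r - 1) * A' by rewrite /D' /A'; ring.
have D'0 : 0 <= D' by rewrite mulr_ge0.
have Pr0 : 0 < P ^+ r by rewrite exprn_gt0.
have Dle : D' <= D' * (P - 1) by rewrite ler_peMr //; move: p2; lra.
have iP : (P ^+ r)^-1 <= 2^-1 ^+ r.
  rewrite exprVn lef_pV2 ?posrE ?exprn_gt0 //.
  by apply: lerXn2r; rewrite ?nnegrE // ltW.
have A'0 : 0 <= A'.
  by apply: mulr_ge0 => //; apply: expect_ge0 => // v; apply: wcol_ge0.
have H3 : D' * (P - 1) <= 1 + 2 * z - A' + A' * (P ^+ r)^-1.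
  rewrite -(ler_pM2l Pr0).
  have -> : P ^+ r * (1 + 2 * z - A' + A' * (P ^+ r)^-1) = P ^+ r * (1 + 2 * z) - (P ^+ r - 1) * A'.
    by field; rewrite gt_eqF.
  by rewrite lerBrDr mulrCA.
have zh := ce_half.
have H4 : A' * (P ^+ r)^-1 <= 2 * 2^-1 ^+ r.
  apply: ler_pM; rewrite ?invr_ge0 ?(ltW Pr0) //.
  by apply: le_trans A2 _; move: zh; set zz := z; lra.
apply: le_trans Dle _; apply: le_trans H3 _.
move: A1 H4; set zz := z; set x := A' / _; set y := 2^-1 ^+ r; lra.
Qed.

(** Discard the admissible first columns that lose rank at some prime; [inner_full] applies to all
    the others. *)
Lemma pair_prob_lower :
  gam * (1 - z) * (1 - z - sig - N.+1%:R * (3 * z + sig + 2 * 2^-1 ^+ r))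
  <= pair_prob f f' * a%:R ^+ n.
Proof.
have wge := @wcol_ge0 R N q q_ge0 n.
have ppge : 0 <= pair_prob f f' * a%:R ^+ n.
  by apply: mulr_ge0; [apply: expect_ge0 | rewrite exprn_ge0].
set Y := (X in gam * (1 - z) * X).
have z1 : 0 <= 1 - z by rewrite subr_ge0; apply: le_trans ce_half _; rewrite invf_le1 // ler1n.
(* A negative last factor makes the bound trivial; otherwise the factors can be compared one by
   one. *)
case: (ltP Y 0) => [Y0|Y0].
  apply: le_trans ppge; rewrite -oppr_ge0 -mulrN mulr_ge0 ?mulr_ge0 ?gam_ge0 //.
  by rewrite oppr_ge0 ltW.
pose D (p : 'I_N.+1) := expect wV (fun g : {ffun 'I_m -> V} =>
    (admissible f t f1 g && (\rank (coords tau p g) < m)%N)%:R).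
have ar0 : 0 <= a%:R ^- r * gam * (1 - ce) ^+ r.
  by rewrite mulr_ge0 ?mulr_ge0 ?gam_ge0 ?invr_ge0 ?exprn_ge0 // subr_ge0 ce_le1.
have step1 : a%:R ^- r * gam * (1 - ce) ^+ r * (Padm - \sum_(p | prN p) D p) <= pair_prob f f'.
  have -> : a%:R ^- r * gam * (1 - ce) ^+ r * (Padm - \sum_(p | prN p) D p)
    = expect wV (fun g1 : {ffun 'I_m -> V} => a%:R ^- r * gam * (1 - ce) ^+ r *
        ((admissible f t f1 g1)%:R + -1 * \sum_(p : 'I_N.+1 | prN p)
          (admissible f t f1 g1 && (\rank (coords tau p g1) < m)%N)%:R)).
    by rewrite expectZ expectD expectZ expect_sum mulN1r.
  rewrite pair_prob_inner; apply: le_expect => // g1.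
  have sum0 : 0 <= \sum_(p : 'I_N.+1 | prN p)
      (admissible f t f1 g1 && (\rank (coords tau p g1) < m)%N)%:R :> R.
    by apply: sumr_ge0 => p _.
  case ag : (admissible f t f1 g1); last first.
    rewrite big1 // mulr0 addr0 mulr0 mulr_ge0 // inner_ge0.
    by [].
  have [hg ng] := andP ag; rewrite hg mul1r.
  case: (boolP (all_full g1)) => fg.
    have /andP[lo _] := inner_full ag fg; apply: le_trans lo.
    rewrite -[leRHS]mulr1 ler_wpM2l //= mulN1r gerDl oppr_le0.
    by apply: sumr_ge0.
  apply: le_trans (inner_ge0 g1).
  rewrite -oppr_ge0 -mulrN mulr_ge0 // mulN1r opprB subr_ge0.
  move: fg; rewrite negb_forall => /existsP[p]; rewrite negb_imply => /andP[pP rk].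
  rewrite (bigD1 p) //= ltn_neqAle rk rank_leq_col lerDl.
  by apply: sumr_ge0.
have an0 : 0 <= a%:R ^+ n :> R by rewrite exprn_ge0.
apply: le_trans (ler_wpM2r an0 step1).
have ane : (a%:R : R) ^+ r != 0 by rewrite expf_neq0 // gt_eqF // a_gt0.
set X := Padm - _.
have -> : a%:R ^- r * gam * (1 - ce) ^+ r * X * a%:R ^+ n
  = gam * ((1 - ce) ^+ r * (X * a%:R ^+ m)).
  rewrite exprD; set x1 := a%:R ^+ m; set x2 := a%:R ^+ r in ane *.
  by field.
rewrite -mulrA ler_wpM2l ?gam_ge0 //; apply: ler_pM => //.
  by apply: pow_lo (leq_addl m r) _; rewrite ce_ge0 lexx.
rewrite mulrBl /Y; apply: lerB; first exact: Padm_ge.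
rewrite mulr_suml.
have b0 : 0 <= 3 * z + sig + 2 * 2^-1 ^+ r.
  have s0 : 0 <= sig.
    by apply: le_trans prob_sig; apply: mulr_ge0; [apply: expect_ge0 | rewrite exprn_ge0].
  by rewrite !addr_ge0 ?mulr_ge0 ?z_ge0 ?exprn_ge0 ?invr_ge0.
apply: (@le_trans _ _ (\sum_(p : 'I_N.+1) (3 * z + sig + 2 * 2^-1 ^+ r))).
  rewrite big_mkcond; apply: ler_sum => p _; case: ifP => // pP.
  exact: deficient_le.
by rewrite sumr_const card_ord -[leLHS]mulr_natl.
Qed.

End WithTau.
End Fixed.
End PairProbability.

Lemma unit_density_le1 (R : archiRealFieldType) N r : unit_density R N r <= 1.
Proof.
apply: prodr_ile1 => p /andP[pp _]; rewrite mulr_ge0 ?invr_ge0 //=.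
rewrite ler_pdivrMr ?ltr0n ?expn_gt0 ?prime_gt0 // mul1r ler_nat /card_unitmx.
by apply: leq_trans (max_card _) _; rewrite card_mx card_Fp.
Qed.

(** * Uniform asymptotics over pairs of codes *)

Section Asymptotics.
Variables (R : archiRealFieldType) (N : nat).
Hypothesis N_gt1 : (1 < N)%N.
Variable q : 'Z_N -> R.
Hypothesis q_ge0 : forall r, 0 <= q r.
Hypothesis q_sum1 : \sum_r q r = 1.
Variable alpha : R.
Hypothesis alpha_gt0 : 0 < alpha.
Hypothesis alpha_half : alpha <= 1 / 2.
Hypothesis q_bal : forall p, prime p -> (p %| N)%N -> forall r : nat,
  \sum_(x : 'Z_N | (x %% p)%N == r) q x <= 1 - alpha.
Variable C : finZmodType.
Hypothesis C_ann : forall p, prime p -> (p %| N)%N -> forall x : C, x *+ (N %/ p) = 0.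
Let C_exp := C_exponent N_gt1 C_ann.

(** The relaxation of [pair_prob] without the kernel condition; it factors over the columns. *)
Definition hit_prob n (I : finType) (f : 'I_n -> C) (f' : I -> C) : R :=
  expect (@wcol R N q n) (fun g : {ffun I -> 'cV['Z_N]_n} => (hits f f' g)%:R).

Lemma hit_probE n (I : finType) (f : 'I_n -> C) (f' : I -> C) :
  hit_prob f f' = \prod_j prg q f (f' j).
Proof. exact: (expect_forall _ (fun j v => act f v == f' j)). Qed.

Lemma pair_le_hit n (f f' : 'I_n -> C) : pair_prob N_gt1 q C_ann f f' <= hit_prob f f'.
Proof.
apply: le_expect => [v|g]; first exact: wcol_ge0.
by rewrite ler_nat; case: (_ \subset _); rewrite ?andbT ?andbF.
Qed.

Lemma pair_prob_ge0 n (f f' : 'I_n -> C) : 0 <= pair_prob N_gt1 q C_ann f f'.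
Proof. by apply: expect_ge0 => // v; apply: wcol_ge0. Qed.

Variable gam : R.
Hypothesis gamE : forall d, 0 < d -> eventually (fun r => `|unit_density R N r - gam| <= d).

Let kappa := maxn #|C| N.
Let x : R := alpha / (4 * kappa%:R).
Let beta : R := 1 - alpha / 4.

Lemma kC : (#|C| <= kappa)%N. Proof. exact: leq_maxl. Qed.
Lemma kN : (N <= kappa)%N. Proof. exact: leq_maxr. Qed.

Variable b : nat.
Hypothesis b_gt0 : (0 < b)%N.
Hypothesis b_scale : forall d, 0 < d ->
  eventually (fun n => x^-1 ^+ (2 * (n %/ b) * #|C|) * beta ^+ n <= d).

Lemma eventually_div m : eventually (fun n => (m <= n %/ b)%N).
Proof. by exists (m * b)%N => n; rewrite leq_divRL. Qed.

Lemma xinv_ge1 : 1 <= x^-1.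
Proof.
have x0 := rate_gt0 alpha_gt0 kC : 0 < x.
by rewrite invf_ge1 // (rate_le1 N_gt1 q_ge0 alpha_gt0 q_bal kC).
Qed.

Lemma low_weight_decay (K d : R) : 0 <= K -> 0 < d ->
  eventually (fun n => K * (x^-1 ^+ (n %/ b) * beta ^+ n) <= d).
Proof.
move=> K0 d0; have K1 : 0 < K + 1 by rewrite ltr_wpDl.
apply: eventually_impl (b_scale (divr_gt0 d0 K1)) => n.
rewrite ler_pdivlMr // => H.
have b0 : 0 <= beta ^+ n.
  by rewrite exprn_ge0 // /beta; have := alpha_half; lra.
have xi := xinv_ge1.
have le : x^-1 ^+ (n %/ b) * beta ^+ n <= x^-1 ^+ (2 * (n %/ b) * #|C|) * beta ^+ n.
  rewrite ler_wpM2r //; apply: ler_weXn2l => //.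
  by rewrite mulnAC leq_pmull // muln_gt0; apply/card_gt0P; exists 0.
have u0 : 0 <= x^-1 ^+ (n %/ b) * beta ^+ n.
  by rewrite mulr_ge0 // exprn_ge0 // (le_trans ler01).
set u := x^-1 ^+ (n %/ b) * _ in le u0 *; set w := x^-1 ^+ _ * _ in le H.
apply: le_trans H; rewrite mulrC; apply: ler_pM => //.
by rewrite lerDl.
Qed.

Lemma C_abelian (u v : C) : commute u v. Proof. exact: addrC. Qed.

Lemma CF_exp p (u : C * 'F_p) : prime p -> (p %| N)%N -> (u ^+ N = 1)%g.
Proof.
move=> pp pN; case: u => u v.
have E k : (((u, v) : C * 'F_p) ^+ k)%g = (u *+ k, v *+ k).
  by elim: k => [|k IH] //; rewrite expgS IH !mulrS.
by rewrite E C_exp (Fp_exp v pp pN).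
Qed.

(** The order of the choices matters. First [r], so that [unit_density] is close to [gam] and
    [2^-1 ^+ r] is small; it determines the index bound [c], which determines the error [e]; only
    then does [n] grow. *)
Lemma pair_limit d : 0 < d -> eventually (fun n => forall f f' : 'I_n -> C,
  code (n %/ b) f -> code (n %/ b) f' -> span f' \subset span f ->
  `|pair_prob N_gt1 q C_ann f f' * #|span f|%:R ^+ n - gam| <= d).
Proof.
move=> d0.
have N2 : (0 : R) < N.+2%:R by [].
have half0 : 0 <= 2^-1 :> R by rewrite invr_ge0.
have half1 : 2^-1 < 1 :> R by rewrite invf_lt1 // ltr1n.
have d1 : 0 < d / (16 * N.+2%:R) by rewrite divr_gt0 // mulr_gt0.
have d4 : 0 < d / 4 by rewrite divr_gt0.
have [r0 Hr0] := eventuallyI (eventuallyI (expr_decay half0 half1 d1) (gamE d4)) (eventually_ge 1).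
have [[r2 rg] r_gt0] := Hr0 r0 (leqnn _).
set r := r0 in r2 rg r_gt0.
pose c := (#|C| * (N.+1 ^ r) ^ N.+1)%N.
have C0 : (0 < #|C|)%N by apply/card_gt0P; exists 0.
have c0 : (0 < c)%N by rewrite muln_gt0 C0 !expn_gt0.
have cr0 : (0 : R) < c%:R by rewrite ltr0n.
have [e [e0 eD emix]] := mixing_error N_gt1 q_ge0 q_sum1 alpha_gt0 q_bal b_gt0 c0.
(* One threshold for three needs: 1/2 for [expr1p_le], [alpha / 4] for the rate bounds, and the last
   term to keep the total error below [d] although the deficiency bound is summed over up to [N.+1]
   indices. *)
pose eta := Num.min (2^-1) (Num.min (alpha / 4) (d / (40 * N.+2%:R))).
have eta0 : 0 < eta.
  by rewrite !lt_min invr_gt0 ltr0n /= !divr_gt0 // mulr_gt0.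
have eta_h : eta <= 2^-1 by rewrite ge_min lexx.
have eta_a : eta <= alpha / 4 by rewrite !ge_min lexx orbT.
have eta_d : N.+2%:R * eta <= d / 40.
  have : eta <= d / (40 * N.+2%:R) by rewrite !ge_min lexx !orbT.
  by rewrite invfM mulrA ler_pdivlMr // mulrC.
pose KK : R := N.+1%:R * kappa%:R ^+ #|C| * 2 ^+ r.
have KK0 : 0 <= KK by rewrite !mulr_ge0 // exprn_ge0.
have E1 := eD _ (divr_gt0 eta0 cr0).
have E2 := low_weight_decay KK0 eta0.
have E3 := eventually_div (maxn c r.+1).
apply: eventually_impl (eventuallyI (eventuallyI E1 E2) (eventuallyI E3 (eventually_ge r.+1))).
move=> n [[En Es] [Et rn]] f f'.
have [m nE] : exists m, n = (m + r)%N by exists (n - r)%N; rewrite subnK // ltnW.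
move: {nE rn}(erefl n) (nE : n = (m + r)%N) => _ nE.
subst n; set t := ((m + r) %/ b)%N in Es Et *.
move=> fc fc' ff.
move: Et; rewrite geq_max => /andP[ct rt].
have n1 : (1 : R) <= (m + r)%:R by rewrite ler1n addn_gt0 r_gt0 orbT.
set z : R := (m + r)%:R * (c%:R * e (m + r)%N).
have z_eta : z <= eta.
  by rewrite /z mulrCA mulrC -ler_pdivlMr.
have z0 : 0 <= z by rewrite /z !mulr_ge0.
have ce_eta : c%:R * e (m + r)%N <= eta.
  by apply: le_trans z_eta; rewrite /z ler_peMl // mulr_ge0.
have Cle : (#|C| <= c)%N by rewrite leq_pmulr // !expn_gt0.
have CN : (#|C| * N <= c)%N.
  rewrite leq_mul2l; apply/orP; right; apply: leq_trans (leqnSn N) _.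
  by rewrite -expnM -[leqLHS]expn1 leq_pexp2l // muln_gt0 r_gt0.
have Ce : #|C|%:R * e (m + r)%N <= alpha / 4.
  by apply: le_trans eta_a; apply: le_trans ce_eta; rewrite ler_wpM2r // ler_nat.
have s0 : (0 < t %/ c)%N by rewrite divn_gt0.
have sct : (t %/ c * c <= t)%N by rewrite leq_trunc_div.
have mixK (K : {group 'cV['Z_N]_(m + r)}) : (#|[set: 'cV['Z_N]_(m + r)] : K|%g <= c)%N ->
    mixing q (coset_of K) (m + r) (t %/ c) (e (m + r)%N).
  move=> Kc; apply: emix => //.
  - move=> u v; have [u' ->] := coset_surj u; have [v' ->] := coset_surj v.
    rewrite /commute -!(morphM (coset_morphism K)) ?norm_cV //.
    by congr (coset K _); apply: addrC.
  - move=> u; have [u' ->] := coset_surj u.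
    by rewrite -(morphX (coset_morphism K)) ?norm_cV // cV_exp // morph1.
  - by rewrite card_coset_of_cV.
have mixC : mixing q C (m + r) (2 * t) (e (m + r)%N).
  apply: emix; [exact: C_abelian | by move=> u; rewrite FinRing.zmodXgE C_exp | exact: Cle |].
  by apply: leq_trans (leq_div _ _) _; apply: leq_pmull.
have mixF p : prime p -> (p %| N)%N ->
    mixing q (C * 'F_p)%type (m + r) t (e (m + r)%N).
  move=> pp pN; apply: emix.
  - by move=> [u1 u2] [v1 v2]; congr pair; apply: addrC.
  - by move=> u; apply: CF_exp.
  - rewrite card_prod card_Fp //; apply: leq_trans CN; rewrite leq_mul2l.
    by rewrite (dvdn_leq _ pN) ?orbT // ltnW.
  - exact: leq_div.
pose sig : R := KK * (x^-1 ^+ t * beta ^+ (m + r)).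
have sig0 : 0 <= sig.
  have bge0 : 0 <= beta by rewrite /beta; have := alpha_half; have := alpha_gt0; lra.
  have xge0 : 0 <= x^-1 := le_trans ler01 xinv_ge1.
  exact: mulr_ge0 KK0 (mulr_ge0 (exprn_ge0 _ xge0) (exprn_ge0 _ bge0)).
have prob_sig : expect (@wcol R N q (m + r)) (fun g : {ffun 'I_m -> 'cV['Z_N]_(m + r)} =>
   (hits f (fun j => f' (lshift r j)) g && sparse_relation t (fun j => f' (lshift r j)) g)%:R)
   * #|span f|%:R ^+ m <= sig.
  rewrite -ler_pdivlMr ?exprn_gt0 ?ltr0n ?cardG_gt0 //.
  have := prob_sparse N_gt1 q_ge0 q_sum1 alpha_gt0 alpha_half q_bal fc kC kN (e0 _) Ce mixF
    (fun j => f' (lshift r j)) (leq_addr r m).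
  by rewrite addKn.
have zh : z <= 2^-1 by apply: le_trans eta_h.
have [tau [tauD tauS tauK]] := exists_tau N_gt1 C_ann f f'.
have rt' : (r < 2 * t)%N by apply: leq_trans rt _; rewrite leq_pmull.
have up := pair_prob_upper q_ge0 q_sum1 r_gt0 rt' fc fc' ff (e0 _) s0 sct (leqnn c) zh mixK
  mixC prob_sig tauD tauS tauK.
have lo := pair_prob_lower q_ge0 q_sum1 r_gt0 rt' fc fc' ff (e0 _) s0 sct (leqnn c) zh mixK
  mixC prob_sig tauD tauS tauK.
move: up lo; rewrite -/z; set pr := pair_prob _ _ _ _ _ * _; set g := unit_density R N r.
move=> up lo.
have g0 : 0 <= g by apply: prodr_ge0 => p _; rewrite mulr_ge0 // invr_ge0.
have g1 : g <= 1 by apply: unit_density_le1.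
have sig_eta : sig <= eta by [].
have rho : N.+1%:R * (2 * 2^-1 ^+ r) <= d / 8.
  move: r2; rewrite ler_pdivlMr ?mulr_gt0 // => r2.
  have : N.+1%:R * 2^-1 ^+ r <= N.+2%:R * 2^-1 ^+ r :> R.
    by rewrite ler_wpM2r ?exprn_ge0 // ler_nat.
  by move: r2; set y := 2^-1 ^+ r => r2 h; lra.
move: rg; rewrite -/g ler_norml => /andP[rg1 rg2].
have eta1 : eta <= d / 40.
  apply: le_trans eta_d; rewrite ler_peMl ?(ltW eta0) // ler1n //.
rewrite ler_norml; apply/andP; split; last first.
  have : (g + sig) * (1 + 2 * z) <= (g + eta) * (1 + 2 * eta).
    have h1 : g + sig <= g + eta by rewrite lerD2l.
    have h2 : 1 + 2 * z <= 1 + 2 * eta by rewrite lerD2l ler_wpM2l.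
    by apply: ler_pM h1 h2; rewrite addr_ge0 // mulr_ge0.
  have : (g + eta) * (1 + 2 * eta) <= g + 4 * eta.
    have : 0 <= (1 - g) * eta by rewrite mulr_ge0 ?subr_ge0 // ltW.
    have : 0 <= (2^-1 - eta) * eta by rewrite mulr_ge0 ?subr_ge0 // ltW.
    by move=> h1 h2; lra.
  by move=> h1 h2; lra.
set w := z + sig + N.+1%:R * (3 * z + sig + 2 * 2^-1 ^+ r).
have w0 : 0 <= w.
  apply: addr_ge0; first exact: addr_ge0.
  apply: mulr_ge0 => //; apply: addr_ge0; last by apply: mulr_ge0; rewrite ?exprn_ge0.
  by apply: addr_ge0 => //; apply: mulr_ge0.
have lo' : g * (1 - z) * (1 - w) <= pr.
  apply: le_trans lo; rewrite le_eqVlt; apply/orP; left; apply/eqP.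
  by rewrite /w; ring.
have w_le : w <= 2 * eta + 4 * (N.+1%:R * eta) + d / 8.
  have h1 : N.+1%:R * z <= N.+1%:R * eta by rewrite ler_wpM2l.
  have h2 : N.+1%:R * sig <= N.+1%:R * eta by rewrite ler_wpM2l.
  rewrite /w; move: h1 h2 rho z_eta sig_eta; rewrite !mulrDr.
  set y := N.+1%:R * (2 * _); rewrite [N.+1%:R * (3 * z)]mulrCA.
  by move=> h1 h2 h3 h4 h5; lra.
have Neta : N.+1%:R * eta <= d / 40.
  by apply: le_trans eta_d; rewrite ler_wpM2r ?(ltW eta0) // ler_nat.
have key : g - (z + w) <= g * (1 - z) * (1 - w).
  have h1 : 0 <= z * w by rewrite mulr_ge0.
  have h2 : 0 <= g * (z * w) by rewrite mulr_ge0.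
  have h3 : 0 <= (1 - g) * (z + w) by rewrite mulr_ge0 ?subr_ge0 // addr_ge0.
  by clearbody z w; move: h2 h3; lra.
by lra.
Qed.

End Asymptotics.

(** * Limits of sequences *)

Section Tends.
Variable R : archiRealFieldType.

(** Convergence stated without topology, so that it makes sense over any archimedean real field;
    [tendsP] identifies it with the usual notion over the reals. *)
Definition tends (u : nat -> R) (l : R) : Prop :=
  forall d : R, 0 < d -> eventually (fun n => `|u n - l| <= d).

Lemma tends_cst l : tends (fun=> l) l.
Proof. by move=> d d0; exists 0%N => n _; rewrite subrr normr0 ltW. Qed.

Lemma tends_eq (u v : nat -> R) l : eventually (fun n => u n = v n) -> tends u l -> tends v l.
Proof.
move=> uv ul d d0.
by apply: eventually_impl (eventuallyI uv (ul d d0)) => n [<-].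
Qed.

Lemma tends_bounded (u : nat -> R) l : tends u l -> eventually (fun n => `|u n| <= `|l| + 1).
Proof.
move=> ul; apply: eventually_impl (ul 1 ltr01) => n H.
rewrite -[u n](subrK l) addrC; apply: le_trans (ler_normD _ _) _.
by rewrite lerD2l.
Qed.

Lemma tends_add (u v : nat -> R) l m : tends u l -> tends v m ->
  tends (fun n => u n + v n) (l + m).
Proof.
move=> ul vm d d0; have d2 : 0 < d / 2 by rewrite divr_gt0.
apply: eventually_impl (eventuallyI (ul _ d2) (vm _ d2)) => n [H1 H2].
rewrite opprD addrACA; apply: le_trans (ler_normD _ _) _.
by rewrite [d](splitr d) lerD.
Qed.

Lemma tends_squeeze0 (u v : nat -> R) l : eventually (fun n => `|u n - l| <= v n) ->
  tends v 0 -> tends u l.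
Proof.
move=> uv v0 d d0; apply: eventually_impl (eventuallyI uv (v0 d d0)) => n [H1].
rewrite subr0 => H2; apply: le_trans H1 _; apply: le_trans H2; exact: ler_norm.
Qed.

Lemma tends0_mul (u v : nat -> R) K : eventually (fun n => `|u n| <= K) -> tends v 0 ->
  tends (fun n => u n * v n) 0.
Proof.
move=> uK v0 d d0.
have K1 : 0 < `|K| + 1 by rewrite ltr_wpDl.
apply: eventually_impl (eventuallyI uK (v0 _ (divr_gt0 d0 K1))) => n [H1].
rewrite !subr0 normrM ler_pdivlMr // => H2; apply: le_trans H2.
rewrite mulrC ler_wpM2l // (le_trans H1) // (le_trans (ler_norm K)) // lerDl //.
Qed.

Lemma tends_mul (u v : nat -> R) l m : tends u l -> tends v m ->
  tends (fun n => u n * v n) (l * m).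
Proof.
move=> ul vm.
have vm0 : tends (fun n => v n - m) 0.
  by move=> d d0; apply: eventually_impl (vm d d0) => n; rewrite subr0.
have ul0 : tends (fun n => u n - l) 0.
  by move=> d d0; apply: eventually_impl (ul d d0) => n; rewrite subr0.
have h1 := tends0_mul (tends_bounded ul) vm0.
have h2 := tends0_mul (tends_bounded (tends_cst m)) ul0.
have h3 := tends_add (tends_add h1 h2) (tends_cst (l * m)).
rewrite !add0r in h3; apply: tends_eq h3; exists 0%N => n _; ring.
Qed.

Lemma tends_sum (T : finType) (P : pred T) (u : T -> nat -> R) (l : T -> R) :
  (forall t, P t -> tends (u t) (l t)) ->
  tends (fun n => \sum_(t | P t) u t n) (\sum_(t | P t) l t).
Proof.
move=> H; rewrite -[\sum_(t | P t) l t]big_filter.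
apply: (@tends_eq (fun n => \sum_(t <- [seq t <- index_enum T | P t]) u t n)).
  by exists 0%N => n _; rewrite big_filter.
have : all P [seq t <- index_enum T | P t] by apply: filter_all.
elim: [seq t <- _ | _] => [|t s IH] /=.
  move=> _; rewrite big_nil; apply: (@tends_eq (fun=> 0)); last exact: tends_cst.
  by exists 0%N => n _; rewrite big_nil.
move=> /andP[Pt Ps]; rewrite big_cons.
apply: (@tends_eq (fun n => u t n + \sum_(t <- s) u t n)).
  by exists 0%N => n _; rewrite big_cons.
by apply: tends_add; [apply: H | apply: IH].
Qed.

End Tends.

(** * Sums over chains of linear forms *)

Section Chains.
Variables (R : archiRealFieldType) (N : nat).
Hypothesis N_gt1 : (1 < N)%N.
Variable q : 'Z_N -> R.
Hypothesis q_ge0 : forall r, 0 <= q r.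
Hypothesis q_sum1 : \sum_r q r = 1.
Variable alpha : R.
Hypothesis alpha_gt0 : 0 < alpha.
Hypothesis alpha_half : alpha <= 1 / 2.
Hypothesis q_bal : forall p, prime p -> (p %| N)%N -> forall r : nat,
  \sum_(x : 'Z_N | (x %% p)%N == r) q x <= 1 - alpha.
Variable C : finZmodType.
Hypothesis C_ann : forall p, prime p -> (p %| N)%N -> forall x : C, x *+ (N %/ p) = 0.
Let C_exp := C_exponent N_gt1 C_ann.
Variable gam : R.
Hypothesis gamE : forall d : R, 0 < d -> eventually (fun r => `|unit_density R N r - gam| <= d).

Local Notation pair f f' := (pair_prob N_gt1 q C_ann f f').

(** All that the chain argument needs, with [cd] and [B] left abstract: a bound [B] on hitting
    probabilities that is negligible in sum over non-codes and at most about [#|span f| ^- n] on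
    codes, the limit for pairs of codes, and the scarcity of non-codes. *)
Lemma code_asymptotics :
  exists (cd : forall n, pred {ffun 'I_n -> C}) (B : forall n, {ffun 'I_n -> C} -> R),
  [/\ forall n (f f' : {ffun 'I_n -> C}), hit_prob q f f' <= B n f,
      forall d : R, 0 < d -> eventually (fun n =>
        \sum_(f : {ffun 'I_n -> C} | ~~ cd n f) B n f <= d),
      forall d : R, 0 < d -> eventually (fun n => forall f : {ffun 'I_n -> C},
        cd n f -> B n f * #|span f|%:R ^+ n <= 1 + d),
      forall d : R, 0 < d -> eventually (fun n => forall f f' : {ffun 'I_n -> C},
        cd n f -> cd n f' -> span f' \subset span f ->
        `|pair f f' * #|span f|%:R ^+ n - gam| <= d) &
      forall d : R, 0 < d -> eventually (fun n => forall A : {group C},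
        #|[set f : {ffun 'I_n -> C} |
            [forall i, f i \in A] && ~~ (cd n f && (span f :==: A))]|%:R
        <= d * #|A|%:R ^+ n)].
Proof.
have kC' := kC N C.
have [b b0 Hb] := exists_scale N_gt1 q_ge0 alpha_gt0 q_bal kC'.
have {}Hb := Hb b (leqnn b).
have C0 : (0 < #|C|)%N by apply/card_gt0P; exists 0.
have [e [e0 eD emix]] := mixing_error N_gt1 q_ge0 q_sum1 alpha_gt0 q_bal b0 C0.
have mixC n : mixing q C n (2 * (n %/ b)) (e n).
  apply: emix; [exact: C_abelian | by move=> u; rewrite FinRing.zmodXgE C_exp | exact: leqnn |].
  by apply: leq_trans (leq_div _ _) _; apply: leq_pmull.
have a1 : 0 <= 1 - alpha by rewrite subr_ge0 (alpha_le1 N_gt1 q_ge0 q_bal).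
pose x : R := alpha / (4 * (maxn #|C| N)%:R).
pose beta : R := 1 - alpha / 4.
have setC0 : 0 < #|{set C}|%:R :> R by rewrite ltr0n; apply/card_gt0P; exists set0.
have tiny d : 0 < d -> eventually (fun n =>
    #|{set C}|%:R * (x^-1 ^+ (2 * (n %/ b) * #|C|) * beta ^+ n) <= d).
  move=> d0; apply: eventually_impl (Hb _ (divr_gt0 d0 setC0)) => n.
  by rewrite ler_pdivlMr // mulrC.
have Cr0 : (0 : R) < #|C|%:R by rewrite ltr0n.
have eC d : 0 < d -> eventually (fun n => n%:R * (#|C|%:R * e n) <= d).
  move=> d0; apply: eventually_impl (eD _ (divr_gt0 d0 Cr0)) => n.
  by rewrite ler_pdivlMr // mulrCA mulrC.
exists (fun n f => code (n %/ b) f).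
exists (fun n f => (if code (n %/ b) f then #|span f|%:R^-1 + e n
   else (1 - alpha) / #|<<popular f (2 * (n %/ b))>>%g|%:R + e n) ^+ n).
split.
- move=> n f f'; rewrite hit_probE; apply: prodr_le_expr => j.
  rewrite prg_ge0 //=; case: ifP => [fc|/negbT/subsetPn[y yS yP]].
    case: (boolP (f' j \in span f)) => [fS|fN].
      have := prg_code q_sum1 (mixC n) fc fS.
      by rewrite ler_norml => /andP[_]; rewrite lerBlDl.
    by rewrite prg_out_span // addr_ge0 // invr_ge0.
  have [i fi] : exists i, f i \notin <<popular f (2 * (n %/ b))>>%g.
    apply/existsP; apply: contraR yP; rewrite negb_exists => /forallP H.
    have : span f \subset <<popular f (2 * (n %/ b))>>%G.
      by rewrite gen_subG; apply/subsetP => _ /imsetP[i _ ->]; rewrite -[_ \in _]negbK H.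
    by move=> /subsetP /(_ y yS).
  exact: (prg_noncode N_gt1 q_ge0 q_sum1 q_bal C_exp _ (mixC n) fi).
- move=> d d0; have a4 : 0 < alpha / 4 by rewrite divr_gt0.
  have Ee := eventuallyI (eventuallyI (eC _ a4) (eventually_ge 1)) (tiny d d0).
  apply: eventually_impl (eventuallyI Ee (eventually_div b0 1)) => n [[[H1 n1] H2] H3].
  apply: le_trans H2.
  rewrite (eq_bigr (fun f : {ffun 'I_n -> C} =>
    ((1 - alpha) / #|<<popular f (2 * (n %/ b))>>%g|%:R + e n) ^+ n)) => [|f /negPf ->] //.
  apply: (sum_noncode N_gt1 q_ge0 alpha_gt0 q_bal kC' n H3 (e0 n)).
  by apply: le_trans H1; rewrite ler_peMl ?ler1n // mulr_ge0.
- move=> d d0.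
  have dd : 0 < Num.min (2^-1) (d / 2) by rewrite lt_min invr_gt0 ltr0n divr_gt0.
  apply: eventually_impl (eC _ dd) => n H f fc; rewrite fc.
  move: H; rewrite le_min => /andP[H1 H2].
  rewrite -exprMn mulrDl mulVf ?pnatr_eq0 -?lt0n ?cardG_gt0 // mulrC.
  have le1 : #|span f|%:R * e n <= #|C|%:R * e n by rewrite ler_wpM2r // ler_nat max_card.
  apply: le_trans (_ : (1 + #|C|%:R * e n) ^+ n <= _).
    apply: lerXn2r; rewrite ?nnegrE ?addr_ge0 ?mulr_ge0 //.
    by rewrite lerD2l.
  apply: le_trans (expr1p_le _ H1) _; first by rewrite mulr_ge0.
  by rewrite lerD2l mulrC -ler_pdivlMr.
- move=> d d0.
  apply: eventually_impl (pair_limit N_gt1 q_ge0 q_sum1 alpha_gt0 alpha_half q_bal C_ann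
    gamE b0 Hb d0) => n H f f' fc fc' ff.
  exact: H.
move=> d d0; apply: eventually_impl (eventuallyI (tiny d d0) (eventually_div b0 1)) => n [H1 H2] A.
apply: le_trans (card_noncode N_gt1 q_ge0 alpha_gt0 q_bal kC' n A H2) _.
by rewrite ler_wpM2r // exprn_ge0.
Qed.

(** The probability that independent random matrices push [f] successively to forms with images [l],
    each matrix satisfying the kernel condition; [chain_probE] makes this precise. *)
Fixpoint chain_prob n (f : {ffun 'I_n -> C}) (l : seq {group C}) : R :=
  if l is A :: l' then
    \sum_(f' : {ffun 'I_n -> C} | span f' :==: A) pair f f' * chain_prob f' l'
  else 1.

Definition chain_sum n (A : {group C}) (l : seq {group C}) : R :=
  \sum_(f : {ffun 'I_n -> C} | span f :==: A) chain_prob f l.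

Lemma chain_prob_ge0 n (f : {ffun 'I_n -> C}) l : 0 <= chain_prob f l.
Proof.
elim: l f => //= A l IH f; apply: sumr_ge0 => f' _.
by rewrite mulr_ge0 // pair_prob_ge0.
Qed.

Section Limits.
Variables (cd : forall {n}, pred {ffun 'I_n -> C}) (B : forall {n}, {ffun 'I_n -> C} -> R).
Hypothesis hitB : forall n (f f' : {ffun 'I_n -> C}), hit_prob q f f' <= B f.
Hypothesis B_noncode : forall d : R, 0 < d -> eventually (fun n =>
  \sum_(f : {ffun 'I_n -> C} | ~~ cd f) B f <= d).
Hypothesis B_code : forall d : R, 0 < d -> eventually (fun n => forall f : {ffun 'I_n -> C},
  cd f -> B f * #|span f|%:R ^+ n <= 1 + d).
Hypothesis pair_code : forall d : R, 0 < d -> eventually (fun n => forall f f' : {ffun 'I_n -> C},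
  cd f -> cd f' -> span f' \subset span f ->
  `|pair f f' * #|span f|%:R ^+ n - gam| <= d).
Hypothesis card_code : forall d : R, 0 < d -> eventually (fun n => forall A : {group C},
  #|[set f : {ffun 'I_n -> C} |
      [forall i, f i \in A] && ~~ (cd f && (span f :==: A))]|%:R
  <= d * #|A|%:R ^+ n).

Definition codes n (A : {group C}) : {set {ffun 'I_n -> C}} :=
  [set f | cd f && (span f :==: A)].

Definition sum_code n (A : {group C}) l : R := \sum_(f in codes n A) chain_prob f l.
Definition sum_rest n (A : {group C}) l : R :=
  \sum_(f : {ffun 'I_n -> C} | (span f :==: A) && ~~ cd f) chain_prob f l.

Lemma chain_sum_split n A l : chain_sum n A l = sum_code n A l + sum_rest n A l.
Proof.
rewrite /chain_sum (bigID (@cd n)) /=; congr (_ + _).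
by apply: eq_bigl => f; rewrite inE andbC.
Qed.

Lemma codes_ratio A : tends (fun n => #|codes n A|%:R * #|A|%:R ^- n : R) 1.
Proof.
move=> d d0; apply: eventually_impl (card_code d0) => n /(_ A).
set Z := [set f | _] => H.
have A0 : (0 : R) < #|A|%:R ^+ n by rewrite exprn_gt0 // ltr0n cardG_gt0.
have E : (#|codes n A| + #|Z| = #|A| ^ n)%N.
  rewrite -[X in (_ ^ X)%N](card_ord n) -card_ffun_on.
  rewrite -[RHS](cardID (mem (codes n A))); congr (_ + _)%N; apply: eq_card => f; rewrite !inE.
    case: (boolP (cd f && (span f :==: A))) => fc; rewrite ?andbF //= andbT; symmetry.
    apply/ffun_onP => i; have /andP[_ /eqP <-] := fc.
    by apply: mem_gen; apply: imset_f.
  by rewrite andbC; congr (_ && _); apply/forallP/ffun_onP.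
have -> : #|codes n A|%:R * #|A|%:R ^- n - 1 = - (#|Z|%:R / #|A|%:R ^+ n) :> R.
  have -> : #|codes n A|%:R = #|A|%:R ^+ n - #|Z|%:R :> R.
    by rewrite -natrX -E natrD addrK.
  by rewrite mulrBl mulfV ?gt_eqF // addrAC subrr add0r.
rewrite normrN ger0_norm; first by rewrite ler_pdivrMr.
by rewrite divr_ge0 // ltW.
Qed.

Lemma codes_le n A : #|codes n A|%:R <= #|A|%:R ^+ n :> R.
Proof.
rewrite -natrX ler_nat -[X in (_ ^ X)%N](card_ord n) -card_ffun_on.
apply: subset_leq_card; apply/subsetP => f; rewrite inE => /andP[_ /eqP fA].
by apply/ffun_onP => i; rewrite -fA; apply: mem_gen; apply: imset_f.
Qed.

(** A pair of codes contributes about [gam / #|A| ^ n] and about [#|A| ^ n] codes have image [A], so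
    each link multiplies the sum by [gam]. A non-code at the head is handled by the sum of [B], one
    at the second place by the induction hypothesis on [sum_rest]. *)
Lemma chain_limits (l : seq {group C}) (A : {group C}) :
  path (fun A B : {group C} => B \subset A) A l -> last A l :==: 1%g ->
  tends (fun n => sum_code n A l) (gam ^+ size l) /\ tends (fun n => sum_rest n A l) 0.
Proof.
elim: l A => [|A' l IH] A /=.
  move=> _ A1.
  have half : (0 : R) < 2^-1 by rewrite invr_gt0.
  (* For trivial [A] the number of non-codes is at most 1/2, hence zero; only the zero tuple is
     left. *)
  have ev : eventually (fun n => forall f : {ffun 'I_n -> C}, span f :==: A -> cd f).
    apply: eventually_impl (card_code half) => n /(_ A).
    have -> : #|A|%:R = 1 :> R by rewrite (eqP A1) cards1.
    rewrite expr1n mulr1 => H f fA; apply: contraT => fc.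
    suff : (1 : R) <= 2^-1 by rewrite leNgt invf_lt1 // ltr1n.
    apply: le_trans H; rewrite ler1n; apply/card_gt0P; exists f.
    rewrite inE (negPf fc) /= andbT; apply/forallP => i.
    by rewrite -(eqP fA); apply: mem_gen; apply: imset_f.
  split.
    apply: tends_eq (tends_cst 1); apply: eventually_impl ev => n H.
    rewrite /sum_code /= sumr_const.
    suff -> : codes n A = [set [ffun=> 0]] by rewrite cards1.
    apply/setP => f; rewrite !inE; apply/andP/eqP => [[_ fA]|->].
      apply/ffunP => i; rewrite ffunE.
      have : f i \in span f by apply: mem_gen; apply: imset_f.
      by rewrite (eqP fA) (eqP A1) => /set1P.
    suff fA : span (finfun (fun _ : 'I_n => (0 : C))) :==: A by split; [apply: H|].
    rewrite (eqP A1); apply/eqP/trivgP; rewrite gen_subG.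
    by apply/subsetP => _ /imsetP[i _ ->]; rewrite ffunE inE.
  apply: tends_eq (tends_cst 0); apply: eventually_impl ev => n H.
  by rewrite /sum_rest big1 // => f /andP[/H ->].
move=> /andP[A'A pl] lA; have [IHc IHr] := IH A' pl lA.
have wge n := @wcol_ge0 R N q q_ge0 n.
have IH_sum : tends (fun n => chain_sum n A' l) (gam ^+ size l).
  have := tends_add IHc IHr; rewrite addr0; apply: tends_eq.
  by exists 0%N => n _; rewrite chain_sum_split.
have sc0 n : 0 <= sum_code n A' l by apply: sumr_ge0 => f _; apply: chain_prob_ge0.
have sr0 n : 0 <= sum_rest n A' l by apply: sumr_ge0 => f _; apply: chain_prob_ge0.
have cs0 n : 0 <= chain_sum n A' l by apply: sumr_ge0 => f _; apply: chain_prob_ge0.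
have B0 n (f : {ffun 'I_n -> C}) : 0 <= B f.
  apply: le_trans (hitB f f); by apply: expect_ge0.
have Ble n (f f' : {ffun 'I_n -> C}) : pair f f' <= B f.
  exact: le_trans (pair_le_hit _ _ _ _ _) (hitB _ _).
have sumB0 : tends (fun n => \sum_(f : {ffun 'I_n -> C} | ~~ cd f) B f) 0.
  move=> d d0; apply: eventually_impl (B_noncode d0) => n H.
  by rewrite subr0 ger0_norm // sumr_ge0.
split; last first.
  apply: (@tends_squeeze0 _ _ (fun n => chain_sum n A' l *
     \sum_(f : {ffun 'I_n -> C} | ~~ cd f) B f)); last first.
    exact: tends0_mul (tends_bounded IH_sum) sumB0.
  exists 0%N => n _; rewrite subr0 ger0_norm; last first.
    by apply: sumr_ge0 => f _; apply: (@chain_prob_ge0 n f (A' :: l)).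
  rewrite mulr_sumr /sum_rest [leLHS]big_mkcond [leRHS]big_mkcond; apply: ler_sum => f _.
  case: (cd f); rewrite ?andbF //= andbT.
  have up : \sum_(f' : {ffun 'I_n -> C} | span f' :==: A') pair f f' * chain_prob f' l
      <= chain_sum n A' l * B f.
    rewrite mulrC /chain_sum mulr_sumr; apply: ler_sum => f' _.
    by rewrite ler_wpM2r // chain_prob_ge0.
  by case: ifP => // _; rewrite mulr_ge0.
have a0 n : (0 : R) < #|A|%:R ^+ n by rewrite exprn_gt0 // ltr0n cardG_gt0.
(* Replace the first pair probability by its limiting value. The error splits into pairs of codes,
   with precision [d1], and pairs whose second form is not a code, where [B f] is at most
   [2 / #|A| ^ n]. *)
have main : tends (fun n => sum_code n A (A' :: l) - gam * (#|codes n A|%:R * #|A|%:R ^- n) * sum_code n A' l) 0.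
  move=> d d0.
  pose K := `|gam ^+ size l| + 1.
  have K0 : 0 < K by rewrite ltr_wpDl.
  pose d1 := d / (2 * K).
  have d10 : 0 < d1 by rewrite divr_gt0 // mulr_gt0.
  have d4 : 0 < d / 4 by rewrite divr_gt0.
  have E1 := eventuallyI (pair_code d10) (B_code ltr01).
  have E2 := eventuallyI (tends_bounded IHc) (IHr _ d4).
  apply: eventually_impl (eventuallyI E1 E2) => n [[Hp HB] [Hc Hr]].
  rewrite subr0.
  have -> : sum_code n A (A' :: l) - gam * (#|codes n A|%:R * #|A|%:R ^- n) * sum_code n A' l
     = \sum_(f in codes n A) (\sum_(f' in codes n A')
           (pair f f' - gam * #|A|%:R ^- n) * chain_prob f' l
         + \sum_(f' : {ffun 'I_n -> C} | (span f' :==: A') && ~~ cd f') pair f f' * chain_prob f' l).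
    have -> : gam * (#|codes n A|%:R * #|A|%:R ^- n) * sum_code n A' l
       = \sum_(f in codes n A) gam * #|A|%:R ^- n * sum_code n A' l.
      by rewrite sumr_const -[RHS]mulr_natl; ring.
    rewrite /sum_code -sumrB; apply: eq_bigr => f fA /=.
    rewrite (bigID (@cd n)) /=.
    have -> : \sum_(i : {ffun 'I_n -> C} | (span i :==: A') && cd i) pair f i * chain_prob i l
        = \sum_(i in codes n A') pair f i * chain_prob i l.
      by apply: eq_bigl => i; rewrite inE andbC.
    rewrite addrAC; congr (_ + _); rewrite mulr_sumr -sumrB; apply: eq_bigr => f' _.
    by rewrite mulrBl.
  apply: le_trans (ler_norm_sum _ _ _) _.
  apply: le_trans (_ : \sum_(f in codes n A) (#|A|%:R ^- n * (d1 * sum_code n A' l + 2 * sum_rest n A' l)) <= _).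
    apply: ler_sum => f; rewrite inE => /andP[fc /eqP fA].
    apply: le_trans (ler_normD _ _) _; rewrite mulrDr; apply: lerD.
      apply: le_trans (ler_norm_sum _ _ _) _.
      rewrite /sum_code !mulr_sumr; apply: ler_sum => f'; rewrite inE => /andP[fc' /eqP fA'].
      rewrite normrM (ger0_norm (chain_prob_ge0 _ _)) mulrA ler_wpM2r ?chain_prob_ge0 //.
      have := Hp f f' fc fc'; rewrite fA fA' => /(_ A'A) H.
      have -> : pair f f' - gam * #|A|%:R ^- n = #|A|%:R ^- n * (pair f f' * #|A|%:R ^+ n - gam).
        by rewrite mulrBr mulrCA mulVf ?gt_eqF // mulr1 [gam * _]mulrC.
      have i0 : 0 <= #|A|%:R ^- n :> R by rewrite invr_ge0 ltW.
      by rewrite normrM (ger0_norm i0) ler_wpM2l.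
    rewrite ger0_norm; last first.
      by apply: sumr_ge0 => f' _; rewrite mulr_ge0 ?pair_prob_ge0 ?chain_prob_ge0.
    rewrite mulrA /sum_rest mulr_sumr; apply: ler_sum => f' _.
    rewrite ler_wpM2r ?chain_prob_ge0 //; apply: le_trans (Ble _ _ _) _.
    rewrite mulrC ler_pdivlMr //; have := HB f fc; rewrite fA => H.
    by apply: le_trans H _; rewrite -[1 + 1]/(2%:R).
  rewrite sumr_const -[leLHS]mulr_natl mulrA.
  have n1 : #|codes n A|%:R * #|A|%:R ^- n <= 1 :> R.
    by rewrite ler_pdivrMr // mul1r codes_le.
  have t1 : d1 * sum_code n A' l + 2 * sum_rest n A' l <= d.
    have h1 : d1 * sum_code n A' l <= d / 2.
      apply: le_trans (_ : d1 * K <= _).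
        by rewrite ler_wpM2l ?(ltW d10) // (le_trans (ler_norm _)).
      by rewrite /d1 invfM mulrA mulfVK // gt_eqF.
    have h2 : sum_rest n A' l <= d / 4 by apply: le_trans (ler_norm _) _; rewrite subr0 in Hr.
    by move: h1 h2; set u := d1 * _; set w := sum_rest _ _ _; lra.
  apply: le_trans (_ : 1 * d <= _); last by rewrite mul1r.
  apply: ler_pM => //.
    by rewrite mulr_ge0 // invr_ge0 ltW.
  by rewrite addr_ge0 // mulr_ge0 // ltW.
have := tends_add main (tends_mul (tends_mul (tends_cst gam) (codes_ratio A)) IHc).
rewrite add0r mulr1 -exprS; apply: tends_eq.
by exists 0%N => n _; rewrite subrK.
Qed.

Lemma chain_limit_aux (l : seq {group C}) (A : {group C}) :
  path (fun A B : {group C} => B \subset A) A l -> last A l :==: 1%g ->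
  tends (fun n => chain_sum n A l) (gam ^+ size l).
Proof.
move=> pl lA; have [c r] := chain_limits pl lA.
have := tends_add c r; rewrite addr0; apply: tends_eq.
by exists 0%N => n _; rewrite chain_sum_split.
Qed.

(** This is the expected number of surjections onto [C] killed by a random matrix: at most
    [#|C| ^ n] codes with probability at most [2 / #|C| ^ n] each, plus at most 1 from non-codes. *)
Lemma hit_sum_bound : eventually (fun n =>
  \sum_(f : {ffun 'I_n -> C} | span f :==: [set: C]) hit_prob q f (fun _ : 'I_n => 0) <= 3).
Proof.
apply: eventually_impl (eventuallyI (B_noncode ltr01) (B_code ltr01)) => n [H1 H2].
rewrite (bigID (@cd n)) /=.
have -> : (3 : R) = 2 + 1 by rewrite -natr1.
have B0 (f : {ffun 'I_n -> C}) : 0 <= B f.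
  by apply: le_trans (hitB f f); apply: expect_ge0 => // v; apply: wcol_ge0.
have z0 (f : {ffun 'I_n -> C}) : hit_prob q f (fun _ : 'I_n => 0) <= B f.
  have := hitB f [ffun=> 0]; rewrite !hit_probE.
  by under eq_bigr do rewrite ffunE.
apply: lerD.
  apply: le_trans (_ : \sum_(f in codes n [set: C]%G) 2 * #|C|%:R ^- n <= _).
    have -> : \sum_(f : {ffun 'I_n -> C} | (span f :==: [set: C]) && cd f) hit_prob q f (fun _ : 'I_n => 0)
      = \sum_(f in codes n [set: C]%G) hit_prob q f (fun _ : 'I_n => 0).
      by apply: eq_bigl => f; rewrite inE andbC.
    apply: ler_sum => f; rewrite inE => /andP[fc /eqP fA].
    apply: le_trans (z0 f) _; have := H2 f fc; rewrite fA cardsT => H.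
    have C0 : (0 : R) < #|C|%:R ^+ n by rewrite exprn_gt0 // ltr0n; apply/card_gt0P; exists 0.
    by rewrite ler_pdivlMr //; apply: le_trans H _; rewrite -[1 + 1]/(2%:R).
  rewrite sumr_const -[leLHS]mulr_natl mulrCA ler_piMr //.
  have C0 : (0 : R) < #|C|%:R ^+ n by rewrite exprn_gt0 // ltr0n; apply/card_gt0P; exists 0.
  rewrite ler_pdivrMr //; by rewrite mul1r; have := codes_le n [set: C]%G; rewrite cardsT.
apply: le_trans H1; rewrite [leLHS]big_mkcond [leRHS]big_mkcond; apply: ler_sum => f _.
by case: (cd f); rewrite ?andbF //= andbT; case: ifP.
Qed.

End Limits.

Lemma chain_limit (l : seq {group C}) (A : {group C}) :
  path (fun A B : {group C} => B \subset A) A l -> last A l :==: 1%g ->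
  tends (fun n => chain_sum n A l) (gam ^+ size l).
Proof.
have [cd [B [h1 h2 h3 h4 h5]]] := code_asymptotics.
exact: chain_limit_aux h1 h2 h3 h4 h5 _ _.
Qed.

Lemma hit_sum_le3 : eventually (fun n =>
  \sum_(f : {ffun 'I_n -> C} | span f :==: [set: C]) hit_prob q f (fun _ : 'I_n => 0) <= 3).
Proof.
have [cd [B [h1 h2 h3 h4 h5]]] := code_asymptotics.
exact: hit_sum_bound h1 h2 h3.
Qed.

End Chains.

(** * From integer matrices to residues modulo N *)

Section Saturation.
Variables (N n : nat).
Hypothesis N_gt1 : (1 < N)%N.

(** Membership in the image of [M] once the integers prime to [N] are inverted. For nonsingular [M]
    it describes the kernel of the projection to the primary part of the cokernel. *)
Definition sat (M : 'M[int]_n) (v : 'cV[int]_n) : Prop :=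
  exists s w, coprime s N /\ v *+ s = M *m w.

Lemma sat_img M w : sat M (M *m w).
Proof. by exists 1%N, w; rewrite coprime1n. Qed.

Lemma sat0 M : sat M 0.
Proof. by rewrite -(mulmx0 1 M); apply: sat_img. Qed.

Lemma satD M u v : sat M u -> sat M v -> sat M (u + v).
Proof.
move=> [s [w [cs E]]] [t [x [ct F]]]; exists (s * t)%N, (w *+ t + x *+ s).
rewrite coprimeMl cs ct mulrnDl mulmxDr !raddfMn /= -E -F; split=> //.
by rewrite -!mulrnA [(t * s)%N]mulnC.
Qed.

Lemma satZ M (z : int) v : sat M v -> sat M (z *: v).
Proof.
by move=> [s [w [cs E]]]; exists s, (z *: w); split=> //; rewrite scalerMnr E scalemxAr.
Qed.

Lemma sat_sum M (I : finType) (c : I -> 'cV[int]_n) :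
  (forall i, sat M (c i)) -> sat M (\sum_i c i).
Proof. move=> H; apply: big_ind => // [|u v]; [exact: sat0 | exact: satD]. Qed.

Lemma sat_coprime M s v : coprime s N -> sat M (v *+ s) -> sat M v.
Proof.
move=> cs [t [w [ct E]]]; exists (s * t)%N, w; rewrite coprimeMl cs ct.
by rewrite mulrnA.
Qed.

Lemma sat_coprimez M (z : int) v : coprime `|z| N -> sat M (z *: v) -> sat M v.
Proof.
move=> cz H; apply: sat_coprime cz _.
suff : sat M (`|z|%:Z *: v) by rewrite -natz scaler_nat.
case: (intP z) H => [|m|m] //= H.
by have := satZ (-1) H; rewrite scalerA mulN1r opprK.
Qed.

(* The determinant trick: the Nakayama lemma for [N' Z^n] over the localisation of [Z] at [N]. *)
Lemma sat_nakayama M (m N' : nat) : (m * N' = N)%N ->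
    (forall p, prime p -> (p %| N)%N -> (p %| m)%N) ->
    (forall x, exists y, sat M (x *+ N' - y *+ N)) ->
  forall x, sat M (x *+ N').
Proof.
move=> mN pm H x.
have [y Hy] : exists y : 'I_n -> 'cV[int]_n, forall j,
    sat M ((delta_mx j ord0 : 'cV[int]_n) *+ N' - y j *+ N).
  by apply: (fin_all_exists (fun j => H (delta_mx j ord0))).
(* Modulo a prime dividing [N], hence [m], this matrix is the identity, so its determinant is prime
   to [N]; multiplying by its adjugate then gives the claim. *)
pose A : 'M[int]_n := 1%:M - (m%:Z *: \matrix_(i, j) y j i ord0).
have Acol j : sat M (col j A *+ N').
  have -> : col j A *+ N' = (delta_mx j ord0 : 'cV[int]_n) *+ N' - y j *+ N; last exact: Hy.
  rewrite -mN mulrnA -mulrnBl; congr (_ *+ _).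
  apply/matrixP => i k; rewrite (ord1 k) !mxE mulmxnE eqxx andbT.
  by congr (_ - _); rewrite -mulr_natl natz.
have Aall u : sat M ((A *m u) *+ N').
  have -> : A *m u = \sum_j u j ord0 *: col j A.
    apply/matrixP => i k; rewrite (ord1 k) summxE mxE; apply: eq_bigr => l _.
    by rewrite !mxE mulrC.
  rewrite -sumrMnl; apply: sat_sum => j; rewrite scalerMnr; exact: satZ.
have dA : coprime `|\det A| N.
  rewrite /coprime; apply: contraT => g1.
  have g0 : (0 < gcdn `|\det A| N)%N by rewrite gcdn_gt0 (ltnW N_gt1) orbT.
  have gg : (1 < gcdn `|\det A| N)%N by rewrite ltn_neqAle eq_sym g1.
  have pp := pdiv_prime gg; set p := pdiv _ in pp.
  have pg : (p %| gcdn `|\det A| N)%N := pdiv_dvd _.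
  have /andP[pd pN] : (p %| `|\det A|)%N && (p %| N)%N by rewrite -dvdn_gcd.
  have F0 (z : nat) : (p %| z)%N -> (z%:R : 'F_p) = 0.
    by move=> pz; apply/eqP; rewrite -(dvdn_pcharf (pchar_Fp pp)).
  have dA0 : (\det A)%:~R = 0 :> 'F_p.
    rewrite (intEsg (\det A)) rmorphM /= -[X in _ * X]/((`|\det A|%N)%:R) F0 //.
    by rewrite mulr0.
  have : \det (map_mx intr A) = 1 :> 'F_p.
    have -> : map_mx intr A = 1%:M :> 'M['F_p]_n; last exact: det1.
    have m0 : (m%:Z)%:~R = 0 :> 'F_p by apply: F0; apply: pm.
    apply/matrixP => i j; rewrite !mxE rmorphB rmorphM /= m0 mul0r subr0.
    by case: (i == j).
  by rewrite det_map_mx [LHS]dA0 => /esym/eqP; rewrite oner_eq0.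
apply: (sat_coprimez dA).
by have := Aall (\adj A *m x); rewrite mulmxA mul_mx_adj mul_scalar_mx scalerMnr.
Qed.

End Saturation.

Lemma coprime_mul_inv N t : (0 < N)%N -> coprime t N ->
  exists t', forall C : zmodType, (forall x : C, x *+ N = 0) -> forall x : C, x *+ t *+ t' = x.
Proof.
move=> N0 ct; case: (posnP t) ct => [->|t0] ct.
  exists 0%N => C CN x; move: ct; rewrite /coprime gcd0n => /eqP N1.
  by have := CN x; rewrite N1 mulr1n => ->.
exists (egcdn t N).1 => C CN x; case: (egcdnP N t0) => km kn E _ /=.
by rewrite -mulrnA mulnC E (eqP ct) mulrnDr mulrnA CN add0r.
Qed.

Section IntegerActions.
Variable N : nat.
Hypothesis N_gt1 : (1 < N)%N.
Variable n : nat.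

Definition redN (v : 'cV[int]_n) : 'cV['Z_N]_n := map_mx intr v.

Lemma redN_lift (v : 'cV['Z_N]_n) : exists u, redN u = v.
Proof.
exists (\col_i (v i ord0 : nat)%:Z); apply/matrixP => i j; rewrite (ord1 j) !mxE.
by rewrite -pmulrn Zp_natK.
Qed.

Lemma intr_ZpE (z : int) : (z%:~R : 'Z_N) = `|(z %% N)%Z|%:R.
Proof.
have N0 : N%:Z != 0 by rewrite eqz_nat -lt0n ltnW.
rewrite {1}(divz_eq z N) rmorphD rmorphM /=.
have -> : (N%:Z)%:~R = 0 :> 'Z_N by rewrite -pmulrn; apply: (pchar_Zp N_gt1).
by rewrite mulr0 add0r -{1}(gez0_abs (modz_ge0 z N0)).
Qed.

Lemma redN0 v : redN v = 0 -> exists u, v = u *+ N.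
Proof.
move=> /matrixP v0; exists (\col_i (v i ord0 %/ N)%Z); apply/matrixP => i j.
have N0 : N%:Z != 0 by rewrite eqz_nat -lt0n ltnW.
rewrite (ord1 j) mulmxnE mxE; have := v0 i ord0; rewrite !mxE intr_ZpE.
move=> /(congr1 val) /=; rewrite (val_Zp_nat N_gt1) modn_small; last first.
  by rewrite -ltz_nat gez0_abs ?modz_ge0 // ltz_pmod // ltz_nat ltnW.
move=> /eqP; rewrite absz_eq0 => /eqP m0.
by rewrite {1}(divz_eq (v i ord0) N) m0 addr0 -[RHS]mulr_natr natz.
Qed.

Definition cols (M : 'M[int]_n) : {ffun 'I_n -> 'cV['Z_N]_n} :=
  [ffun j => redN (col j M)].

Lemma colspan_cols (M : 'M[int]_n) v : redN v \in colspan (cols M) <->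
  exists w u, v = M *m w + u *+ N.
Proof.
split; last first.
  move=> [w [u ->]].
  have -> : redN (M *m w + u *+ N) = \sum_j cols M j *+ `|(w j ord0 %% N)%Z|.
    apply/matrixP => i k; rewrite summxE mxE (ord1 k) mxE rmorphD /= mulmxnE.
    rewrite rmorphMn /= -[X in _ + X]mulr_natr (pchar_Zp N_gt1) mulr0 addr0 mxE rmorph_sum /=.
    apply: eq_bigr => l _; rewrite ffunE mulmxnE !mxE rmorphM /= (intr_ZpE (w l ord0)).
    by rewrite mulr_natr.
  apply: (big_ind (fun x => x \in colspan (cols M))) => [|x y|j _].
  - exact: group1.
  - by move=> xc yc; apply: (groupM xc yc).
  - by rewrite -FinRing.zmodXgE groupX // mem_colspan.
move=> /gen_prodgP[k [c Hc E]].
have : exists w, redN v = redN (M *m w).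
  rewrite E; elim: k c Hc {E} => [|k IH] c Hc.
    by exists 0; rewrite big_ord0 mulmx0 /redN map_mx0.
  have [w Ew] := IH (fun i => c (lift ord0 i)) (fun i => Hc _).
  have /imsetP[j _ cj] := Hc ord0.
  exists (delta_mx j ord0 + w); rewrite big_ord_recl Ew cj ffunE.
  by rewrite mulmxDr -colE /redN map_mxD.
move=> [w Ew]; have /redN0[u Eu] : redN (v - M *m w) = 0.
  by rewrite /redN map_mxB -!/(redN _) Ew subrr.
by exists w, u; rewrite -Eu addrC subrK.
Qed.

Variable C : finZmodType.
Implicit Type F : 'I_n -> C.

Definition actz F (v : 'cV[int]_n) : C := \sum_i F i *~ v i ord0.

Lemma actzD F u v : actz F (u + v) = actz F u + actz F v.
Proof. by rewrite -big_split; apply: eq_bigr => i _; rewrite mxE mulrzDr. Qed.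

Lemma actz0 F : actz F 0 = 0.
Proof. by rewrite /actz big1 // => i _; rewrite mxE. Qed.

Lemma actzMn F v s : actz F (v *+ s) = actz F v *+ s.
Proof.
elim: s => [|s IH]; first by rewrite !mulr0n actz0.
by rewrite !mulrS actzD IH.
Qed.

Lemma actzB F u v : actz F (u - v) = actz F u - actz F v.
Proof. by apply/eqP; rewrite eq_sym subr_eq -actzD subrK. Qed.

Lemma actz_delta F j : actz F (delta_mx j ord0) = F j.
Proof.
rewrite /actz (bigD1 j) //= mxE !eqxx mulr1z big1 ?addr0 // => i ij.
by rewrite mxE (negPf ij).
Qed.

Lemma eq_actz F F' : F =1 F' -> actz F =1 actz F'.
Proof. by move=> FF v; apply: eq_bigr => i _; rewrite FF. Qed.

Definition pushz F (M : 'M[int]_n) : {ffun 'I_n -> C} := [ffun j => actz F (col j M)].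

Lemma actz_push F M v : actz (pushz F M) v = actz F (M *m v).
Proof.
rewrite /actz; under eq_bigr => j _ do rewrite ffunE.
under [RHS]eq_bigr => i _ do rewrite mxE mulrz_sumr.
rewrite exchange_big; apply: eq_bigr => j _; rewrite /actz mulrz_suml.
by apply: eq_bigr => i _; rewrite mxE mulrzA.
Qed.

Lemma push_push F M M' : pushz (pushz F M) M' = pushz F (M *m M').
Proof.
by apply/ffunP => j; rewrite !ffunE actz_push !colE mulmxA.
Qed.

Hypothesis C_ann : forall p, prime p -> (p %| N)%N -> forall x : C, x *+ (N %/ p) = 0.
Let C_exp := C_exponent N_gt1 C_ann.

Lemma actz_red F v : actz F v = act F (redN v).
Proof.
apply: eq_bigr => i _; rewrite mxE intr_ZpE (val_Zp_nat N_gt1).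
have N0 : N%:Z != 0 by rewrite eqz_nat -lt0n ltnW.
rewrite modn_small; last by rewrite -ltz_nat gez0_abs ?modz_ge0 // ltz_pmod // ltz_nat ltnW.
rewrite {1}(divz_eq (v i ord0) N) mulrzDr mulrC mulrzA -pmulrn C_exp mul0rz add0r.
by rewrite pmulrn gez0_abs // modz_ge0.
Qed.

Lemma actz_coprime F s v : coprime s N -> actz F v *+ s = 0 -> actz F v = 0.
Proof.
move=> cs H; have [t ts] := coprime_mul_inv (ltnW N_gt1) cs.
by rewrite -(ts C C_exp (actz F v)) H mul0rn.
Qed.

Lemma actz_span F v : actz F v \in span F.
Proof. by rewrite actz_red; exact: act_span. Qed.

Lemma span_actz F x : x \in span F -> exists v, actz F v = x.
Proof.
move=> /(span_act N_gt1 C_exp)[v <-]; have [u <-] := redN_lift v.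
by exists u; rewrite actz_red.
Qed.

Definition kerz F (M : 'M[int]_n) : Prop := forall v, actz F v = 0 <-> sat N M v.

End IntegerActions.

Section ChainEvents.
Variable N : nat.
Hypothesis N_gt1 : (1 < N)%N.
Variable C : finZmodType.
Hypothesis C_ann : forall p, prime p -> (p %| N)%N -> forall x : C, x *+ (N %/ p) = 0.
Let C_exp := C_exponent N_gt1 C_ann.
Variables m N' : nat.
Hypothesis mN : (m * N' = N)%N.
Hypothesis m_primes : forall p, prime p -> (p %| N)%N -> (p %| m)%N.
Hypothesis C_N' : forall x : C, x *+ N' = 0.
Variable n : nat.
Local Notation V := 'cV['Z_N]_n.

Definition push (F : 'I_n -> C) (g : {ffun 'I_n -> V}) : {ffun 'I_n -> C} :=
  [ffun j => act F (g j)].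

Fixpoint imgs (F : 'I_n -> C) (gs : seq {ffun 'I_n -> V}) : seq {group C} :=
  if gs is g :: gs' then span (push F g) :: imgs (push F g) gs' else [::].

Fixpoint kers (F : 'I_n -> C) (gs : seq {ffun 'I_n -> V}) : bool :=
  if gs is g :: gs' then (kact N_gt1 C_ann F \subset colspan g) && kers (push F g) gs'
  else true.

Lemma push_cols F M : push F (cols N M) = pushz F M.
Proof. by apply/ffunP => j; rewrite !ffunE (actz_red N_gt1 C_ann). Qed.

Lemma size_imgs F gs : size (imgs F gs) = size gs.
Proof. by elim: gs F => //= g gs IH F; rewrite IH. Qed.

Lemma nth_imgs F (Ms : seq 'M[int]_n) A j : (j < size Ms)%N ->
  nth A (imgs F (map (@cols N n) Ms)) j =
  span (pushz F (\big[mulmx/1%:M]_(M <- take j.+1 Ms) M)).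
Proof.
elim: Ms F j => // M Ms IH F [|j] /= js; rewrite push_cols.
  by rewrite take0 big_cons big_nil mulmx1.
by rewrite IH // big_cons push_push.
Qed.

Lemma mulmx_sat_inj (M M' : 'M[int]_n) u : \det M != 0 -> sat N (M *m M') (M *m u) -> sat N M' u.
Proof.
move=> dM [s [w [cs E]]]; exists s, w; split=> //.
have : \adj M *m (M *m (u *+ s - M' *m w)) = 0.
  by rewrite mulmxBr raddfMn /= E mulmxA subrr mulmx0.
rewrite mulmxA mul_adj_mx mul_scalar_mx => /eqP; rewrite scalemx_eq0 (negPf dM) /=.
by rewrite subr_eq0 => /eqP.
Qed.

Lemma sat_mulr (M M' : 'M[int]_n) v : sat N (M *m M') v -> sat N M v.
Proof. by move=> [s [w [cs E]]]; exists s, (M' *m w); rewrite mulmxA. Qed.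

(** Down the chain, a vector killed by [F] lies in the saturated image up to [N] times some vector.
    Since [N'] kills [C], this applies to [N' Z^n], and [sat_nakayama] puts [N' Z^n], hence also
    [N Z^n], inside the saturated image. *)
Lemma kers_kerz F (Ms : seq 'M[int]_n) :
    last (span F) (imgs F (map (@cols N n) Ms)) = 1%G ->
  kers F (map (@cols N n) Ms) -> kerz N F (\big[mulmx/1%:M]_(M <- Ms) M).
Proof.
elim: Ms F => [|M Ms IH] F /=.
  move=> F1 _ v; rewrite big_nil; split=> _.
    by have := @sat_img N n 1%:M v; rewrite mul1mx.
  by have := actz_span N_gt1 C_ann F v; rewrite F1 inE => /eqP.
move=> L1; rewrite big_cons push_cols in L1 *.
have {}IH := IH _ L1; set M' := \big[_/_]_(_ <- Ms) _ in IH *.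
move=> /andP[/subsetP kF /IH kM] v; split; last first.
  move=> [s [w [cs E]]]; apply: (actz_coprime N_gt1 C_ann cs).
  by rewrite -actzMn E -mulmxA -actz_push; apply/kM; apply: sat_img.
have main u : actz F u = 0 -> exists y, sat N (M *m M') (u - y *+ N).
  move=> Fu; have : redN N u \in kact N_gt1 C_ann F.
    by rewrite (kactE N_gt1 C_ann) -(actz_red N_gt1 C_ann) Fu.
  move=> /kF /(colspan_cols N_gt1)[w [y E]]; exists y; rewrite E addrK.
  have : actz (pushz F M) w = 0.
    by rewrite actz_push -Fu E actzD actzMn C_exp addr0.
  move/kM => [s [z [cs E']]]; exists s, z; split=> //.
  by rewrite -mulmxA -E' raddfMn.
have satN' x : sat N (M *m M') (x *+ N').
  by apply: (sat_nakayama N_gt1 mN m_primes) => y; apply: main; rewrite actzMn C_N'.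
move=> /main[y Hy]; rewrite -[v](subrK (y *+ N)); apply: satD => //.
have -> : y *+ N = y *+ m *+ N' by rewrite -mulrnA mN.
exact: satN'.
Qed.

(** The first factor must be cancelled from a relation for the whole product, which is where nonzero
    determinants enter. *)
Lemma kerz_kers F (Ms : seq 'M[int]_n) : all (fun M => \det M != 0) Ms ->
  kerz N F (\big[mulmx/1%:M]_(M <- Ms) M) -> kers F (map (@cols N n) Ms).
Proof.
have N0 : (0 < N)%N by apply: ltnW.
elim: Ms F => [|M Ms IH] F //= /andP[dM dMs]; rewrite big_cons push_cols.
have {}IH := IH (pushz F M) dMs; set M' := \big[_/_]_(_ <- Ms) _ in IH *.
move=> kMM; apply/andP; split.
  apply/subsetP => v; have [u <-] := redN_lift v; rewrite (kactE N_gt1 C_ann) -(actz_red N_gt1 C_ann).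
  move=> /eqP /kMM[s [w [cs E]]].
  have [t ts] := coprime_mul_inv N0 cs.
  rewrite -(ts _ _ (redN N u)) => [|x]; last by rewrite -FinRing.zmodXgE; apply: cV_exp.
  rewrite -FinRing.zmodXgE groupX //.
  have -> : redN N u *+ s = redN N (M *m (M' *m w)) by rewrite mulmxA -E /redN raddfMn.
  by apply/(colspan_cols N_gt1); exists (M' *m w), 0; rewrite mul0rn addr0.
apply: IH => u; rewrite actz_push; split.
  by move/kMM; apply: mulmx_sat_inj.
move=> [s [w [cs E]]]; apply/kMM; exists s, w; split=> //.
by rewrite -mulmxA -E raddfMn.
Qed.

End ChainEvents.

HB.instance Definition _ (n : nat) := Monoid.isLaw.Build 'M[int]_n 1%:M mulmx
  (@mulmxA int n n n n) (@mul1mx int n n) (@mulmx1 int n n).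

(** * Surjections and exact forms *)

Section Surjections.
Variables C D : finZmodType.
Implicit Type s : {ffun C -> D}.

Lemma SurP s : reflect ((forall x y, s (x + y) = s x + s y) /\ (forall z, exists x, s x = z))
  (s \in Sur C D).
Proof.
rewrite inE; apply: (iffP andP) => -[H1 H2]; split.
- by move=> x y; apply/eqP; move/forallP: H1 => /(_ x)/forallP.
- by move=> z; move/forallP: H2 => /(_ z)/existsP[x /eqP]; exists x.
- by apply/forallP => x; apply/forallP => y; rewrite H1.
- by apply/forallP => z; apply/existsP; have [x <-] := H2 z; exists x.
Qed.

Lemma Sur0 s : s \in Sur C D -> s 0 = 0.
Proof. by move=> /SurP[H _]; apply: (addrI (s 0)); rewrite -H !addr0. Qed.

Lemma SurMz s x z : s \in Sur C D -> s (x *~ z) = s x *~ z.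
Proof.
move=> sS; have /SurP[sD _] := sS.
have sMn (m : nat) : s (x *+ m) = s x *+ m.
  by elim: m => [|m IH]; rewrite ?mulr0n ?Sur0 // !mulrS sD IH.
case: z => m; rewrite ?NegzE; first exact: sMn.
apply/eqP; rewrite !mulrNz -addr_eq0 addrC -[_ *~ m.+1 in X in X + _]/(s x *+ m.+1).
by rewrite -sMn -sD -[_ *~ m.+1]/(x *+ m.+1) subrr Sur0.
Qed.

Lemma Sur_sum s (I : finType) (c : I -> C) : s \in Sur C D ->
  s (\sum_i c i) = \sum_i s (c i).
Proof.
by move=> sS; have /SurP[sD _] := sS; apply: (big_morph s sD (Sur0 sS)).
Qed.

Definition compf (X : finType) s (F : {ffun X -> C}) : {ffun X -> D} := [ffun x => s (F x)].

Lemma actz_compf n s (F : {ffun 'I_n -> C}) v : s \in Sur C D ->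
  actz (compf s F) v = s (actz F v).
Proof.
by move=> sS; rewrite Sur_sum //; apply: eq_bigr => i _; rewrite SurMz // ffunE.
Qed.

(** Taking the generated subgroup gives a group for every function [s]; for a surjection it is the
    usual kernel by [kerfE]. *)
Definition kerf s : {group C} := <<[set x | s x == 0]>>%G.

Lemma kerfE s x : s \in Sur C D -> (x \in kerf s) = (s x == 0).
Proof.
move=> sS; have /SurP[sD _] := sS.
have gS : group_set [set x | s x == 0].
  apply/group_setP; split; first by rewrite inE Sur0.
  by move=> u v; rewrite !inE sD => /eqP -> /eqP ->; rewrite addr0.
by rewrite /kerf /= -[[set x | _]]/(val (Group gS)) genGid inE.
Qed.

End Surjections.

Lemma compf_Sur (C D E : finZmodType) (g : {ffun D -> E}) (s : {ffun C -> D}) :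
  g \in Sur D E -> s \in Sur C D -> compf g s \in Sur C E.
Proof.
move=> /SurP[gD gS] /SurP[sD sS]; apply/SurP; split=> [x y|z]; rewrite ?ffunE ?sD ?gD //.
by have [y <-] := gS z; have [x <-] := sS y; exists x; rewrite ffunE.
Qed.

Section ExactCount.
Variable N : nat.
Hypothesis N_gt1 : (1 < N)%N.
Variable n : nat.

(** For nonsingular [M] this says that [F] induces an isomorphism from the primary part of the
    cokernel onto [C], see [iso_exact]. *)
Definition exact (C : finZmodType) (F : {ffun 'I_n -> C}) (M : 'M[int]_n) : bool :=
  (span F :==: [set: C]) && `[< kerz N F M >].

Definition killed (C : finZmodType) : Prop :=
  forall p, prime p -> (p %| N)%N -> forall x : C, x *+ (N %/ p) = 0.

Lemma span_surj (C : finZmodType) (F : {ffun 'I_n -> C}) : killed C ->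
  span F :==: [set: C] -> forall x, exists v, actz F v = x.
Proof. by move=> Ck /eqP sF x; apply: (span_actz N_gt1 Ck); rewrite sF inE. Qed.

Lemma surj_span (C : finZmodType) (F : {ffun 'I_n -> C}) : killed C ->
  (forall x, exists v, actz F v = x) -> span F :==: [set: C].
Proof.
move=> Ck H; apply/eqP/setP => x; rewrite inE; have [v <-] := H x.
exact: (actz_span N_gt1 Ck).
Qed.

Lemma factor_through (C D : finZmodType) (F : {ffun 'I_n -> C}) (G : {ffun 'I_n -> D}) :
    killed C -> killed D -> span F :==: [set: C] -> span G :==: [set: D] ->
    (forall v, actz F v = 0 -> actz G v = 0) ->
  exists2 s, s \in Sur C D & compf s F = G.
Proof.
move=> Ck Dk sF sG FG.
have [v Hv] := fin_all_exists (span_surj Ck sF).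
have key x u : actz F u = x -> actz G (v x) = actz G u.
  by move=> Fu; apply/eqP; rewrite -subr_eq0 -actzB FG // actzB Hv Fu subrr.
exists [ffun x => actz G (v x)].
  apply/SurP; split=> [x y|z]; first by rewrite !ffunE -actzD; apply: key; rewrite actzD !Hv.
  have [u Gu] := span_surj Dk sG z; exists (actz F u); rewrite ffunE -Gu.
  exact: key.
by apply/ffunP => i; rewrite !ffunE -[RHS]actz_delta; apply: key; rewrite actz_delta.
Qed.

Lemma compf_inj (C D : finZmodType) (F : {ffun 'I_n -> C}) : killed C -> span F :==: [set: C] ->
  {in Sur C D &, injective (fun s => compf s F)}.
Proof.
move=> Ck sF s t sS tS E; apply/ffunP => x; have [v <-] := span_surj Ck sF x.
by rewrite -!actz_compf // E.
Qed.

(** A form exact for [M'] vanishes on the kernel of [F], so it factors through [F] by a unique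
    surjection. *)
Lemma sum_exact (R : nmodType) (C D : finZmodType) (F : {ffun 'I_n -> C}) (M M' : 'M[int]_n)
    (phi : {ffun 'I_n -> D} -> R) :
    killed C -> killed D -> exact F M -> (forall v, sat N M v -> sat N M' v) ->
  \sum_(s in Sur C D | exact (compf s F) M') phi (compf s F) = \sum_(G | exact G M') phi G.
Proof.
move=> Ck Dk /andP[sF /asboolP kF] MM.
pose A := [set s in Sur C D | exact (compf s F) M'].
have -> : \sum_(G | exact G M') phi G = \sum_(G in [set compf s F | s in A]) phi G.
  apply: eq_bigl => G; apply/idP/imsetP; last by move=> [s /setIdP[_ ?] ->].
  move=> /[dup] eG /andP[sG /asboolP kG].
  have [s sS sE] : exists2 s, s \in Sur C D & compf s F = G.
    by apply: factor_through => // v /kF /MM /kG.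
  by exists s => //; rewrite inE sS sE.
rewrite big_imset; first by apply: eq_bigl => s; rewrite [in RHS]inE.
by move=> s t /setIdP[sS _] /setIdP[tS _]; apply: compf_inj.
Qed.

(** Since the kernel of [F] is the saturation of [M], contained in that of [M'], the composite has
    the saturation of [M'] as kernel exactly when [F] maps [M' Z^n] onto the kernel of [s]. *)
Lemma kerz_compf (C D : finZmodType) (F : {ffun 'I_n -> C}) (s : {ffun C -> D}) (M M' : 'M[int]_n) :
    killed C -> killed D -> exact F M -> s \in Sur C D -> (forall v, sat N M v -> sat N M' v) ->
  (span (pushz F M') == kerf s) = exact (compf s F) M'.
Proof.
move=> Ck Dk /andP[sF /asboolP kF] sS MM.
have Ne := C_exponent N_gt1 Ck.
have spanE v : actz F v \in span (pushz F M') <-> exists u, actz F v = actz F (M' *m u).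
  split; last by move=> [u ->]; rewrite -actz_push; apply: (actz_span N_gt1 Ck).
  by move=> /(span_actz N_gt1 Ck)[u <-]; exists u; rewrite actz_push.
apply/eqP/idP => [E|/andP[_ /asboolP kM]].
  apply/andP; split.
    apply: surj_span => // y; have /SurP[_ /(_ y)[x <-]] := sS.
    by have [v <-] := span_surj Ck sF x; exists v; rewrite actz_compf.
  apply/asboolP => v; rewrite actz_compf //; split.
    move=> /eqP; rewrite -kerfE // -E => /spanE[u].
    move=> /eqP; rewrite -subr_eq0 -actzB => /eqP /kF /MM H.
    by rewrite -[v](subrK (M' *m u)); apply: satD => //; apply: sat_img.
  move=> [t [w [ct Ew]]]; rewrite -actz_compf //; apply: (actz_coprime N_gt1 Dk ct).
  rewrite -actzMn Ew actz_compf //; apply/eqP; rewrite -kerfE // -E.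
  by apply/spanE; exists w.
apply/val_inj/setP => x /=; have [v <-] := span_surj Ck sF x.
rewrite -[RHS]/(_ \in kerf s) kerfE // -[LHS]/(_ \in span _); apply/idP/eqP.
  move=> /spanE[u ->]; rewrite -actz_compf //; apply/kM; exact: sat_img.
rewrite -actz_compf // => /kM[t [w [ct Ew]]].
have [t' tt] := coprime_mul_inv (ltnW N_gt1) ct.
rewrite -(tt _ Ne (actz F v)) -FinRing.zmodXgE groupX // -actzMn.
by apply/spanE; exists w; rewrite Ew.
Qed.

End ExactCount.

(** * Summing over towers of surjections *)

Section Towers.
Variable B : nat -> finZmodType.
Hypothesis B0_triv : #|B 0%N| = 1%N.

Lemma B0_eq (x y : B 0%N) : x = y.
Proof. by have /eqP/fintype1P[z Hz] := B0_triv; rewrite (Hz x) (Hz y). Qed.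

(* A list of subgroups [L] of [C] records the kernels of the successive composites
   [C -> B j]; [tower_sum] sums over all ways to continue the tower of surjections
   from [B j] down to [B 0]. *)
Fixpoint tower_sum (R : nmodType) (C : finZmodType) (Q : seq {group C} -> R) (j : nat) :
    {ffun C -> B j} -> seq {group C} -> R :=
  if j is j'.+1 return {ffun C -> B j} -> seq {group C} -> R then
    fun s L => \sum_(g in Sur (B j'.+1) (B j')) tower_sum Q (compf g s) (kerf s :: L)
  else fun s L => Q L.

Section TowerSums.
Variable C : finZmodType.
Implicit Types L : seq {group C}.

Definition flag (A : {group C}) L : Prop :=
  path (fun A B : {group C} => B \subset A) A L /\ last A L = 1%G.

Lemma kerf_sub j (g : {ffun B j.+1 -> B j}) (s : {ffun C -> B j.+1}) :
  g \in Sur (B j.+1) (B j) -> s \in Sur C (B j.+1) -> kerf s \subset kerf (compf g s).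
Proof.
move=> gS sS; apply/subsetP => x.
rewrite (kerfE _ sS) (kerfE _ (compf_Sur gS sS)) ffunE => /eqP ->.
by rewrite (Sur0 gS).
Qed.

Lemma flag_cons j (g : {ffun B j.+1 -> B j}) (s : {ffun C -> B j.+1}) L :
  g \in Sur (B j.+1) (B j) -> s \in Sur C (B j.+1) -> flag (kerf s) L ->
  flag (kerf (compf g s)) (kerf s :: L).
Proof. by move=> gS sS [pL lL]; split=> //=; rewrite kerf_sub. Qed.

Lemma kerf0 (s : {ffun C -> B 0%N}) : s \in Sur C (B 0%N) -> kerf s = [set: C]%G.
Proof.
move=> sS; apply/val_inj/setP => x /=; rewrite inE -[LHS]/(x \in kerf s) kerfE //.
by apply/eqP; apply: B0_eq.
Qed.

Lemma eq_tower_sum (R : nmodType) (Q Q' : seq {group C} -> R) m :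
    (forall L, size L = m -> flag [set: C]%G L -> Q L = Q' L) ->
  forall j (s : {ffun C -> B j}) L, s \in Sur C (B j) -> flag (kerf s) L -> (size L + j)%N = m ->
  tower_sum Q s L = tower_sum Q' s L.
Proof.
move=> QQ; elim=> [|j IH] s L sS fL sz /=.
  by apply: QQ; [rewrite -sz addn0 | rewrite -(kerf0 sS)].
apply: eq_bigr => g gS; apply: IH; [exact: compf_Sur | exact: flag_cons | by rewrite /= addSnnS].
Qed.

Lemma le_tower_sum (R : numDomainType) (Q Q' : seq {group C} -> R) m :
    (forall L, size L = m -> flag [set: C]%G L -> Q L <= Q' L) ->
  forall j (s : {ffun C -> B j}) L, s \in Sur C (B j) -> flag (kerf s) L -> (size L + j)%N = m ->
  tower_sum Q s L <= tower_sum Q' s L.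
Proof.
move=> QQ; elim=> [|j IH] s L sS fL sz /=.
  by apply: QQ; [rewrite -sz addn0 | rewrite -(kerf0 sS)].
apply: ler_sum => g gS; apply: IH; [exact: compf_Sur | exact: flag_cons | by rewrite /= addSnnS].
Qed.

Lemma tower_sum_ge0 (R : numDomainType) (Q : seq {group C} -> R) j (s : {ffun C -> B j}) L :
  (forall L, 0 <= Q L) -> 0 <= tower_sum Q s L.
Proof. by move=> Q0; elim: j s L => [|j IH] s L //=; apply: sumr_ge0 => g _. Qed.

Lemma tower_sum_tends (R : archiRealFieldType) (Q : nat -> seq {group C} -> R) m c :
    (forall L, size L = m -> flag [set: C]%G L -> tends (fun n => Q n L) c) ->
  forall j (s : {ffun C -> B j}) L, s \in Sur C (B j) -> flag (kerf s) L -> (size L + j)%N = m ->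
  tends (fun n => tower_sum (Q n) s L) (\prod_(i < j) #|Sur (B i.+1) (B i)|%:R * c).
Proof.
move=> Qc; elim=> [|j IH] s L sS fL sz /=.
  by rewrite big_ord0 mul1r; apply: Qc; [rewrite -sz addn0 | rewrite -(kerf0 sS)].
have -> : \prod_(i < j.+1) #|Sur (B i.+1) (B i)|%:R * c =
    \sum_(g in Sur (B j.+1) (B j)) (\prod_(i < j) #|Sur (B i.+1) (B i)|%:R * c) :> R.
  by rewrite sumr_const big_ord_recr /= -[RHS]mulr_natl mulrA [X in _ = X * _]mulrC.
apply: tends_sum => g gS.
by apply: IH; [exact: compf_Sur | exact: flag_cons | by rewrite /= addSnnS].
Qed.

Lemma tower_sum_linear (R : pzRingType) (I : finType) (w : I -> R) (Q : I -> seq {group C} -> R)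
    j (s : {ffun C -> B j}) L :
  tower_sum (fun L => \sum_i w i * Q i L) s L = \sum_i w i * tower_sum (Q i) s L.
Proof.
elim: j s L => [|j IH] s L //=.
under eq_bigr do rewrite IH.
by rewrite exchange_big; apply: eq_bigr => i _; rewrite mulr_sumr.
Qed.

End TowerSums.

Section TowerCount.
Variables (R : comPzRingType) (N n : nat).
Hypothesis N_gt1 : (1 < N)%N.
Variable k : nat.
Hypothesis B_ann : forall i, (i <= k)%N -> killed N (B i).
Variable Mp : nat -> 'M[int]_n.
Hypothesis Mp_sat : forall j v, sat N (Mp j.+1) v -> sat N (Mp j) v.
Hypothesis Mp0 : Mp 0 = 1%:M.

Definition exacts j : {set {ffun 'I_n -> B j}} := [set F | exact N F (Mp j)].

(** The number of towers from [B j] down to [B 0] along which [F] stays exact at every level. *)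
Fixpoint tower_count j : {ffun 'I_n -> B j} -> R :=
  if j is j'.+1 return {ffun 'I_n -> B j} -> R then
    fun F => (exact N F (Mp j'.+1))%:R * \sum_(g in Sur (B j'.+1) (B j')) tower_count (compf g F)
  else fun=> 1.

Lemma exact0 (F : {ffun 'I_n -> B 0%N}) : exact N F (Mp 0).
Proof.
apply/andP; split.
  by apply: (surj_span N_gt1 (B_ann (leq0n k))) => x; exists 0; apply: B0_eq.
apply/asboolP => v; rewrite Mp0; split=> _; last exact: B0_eq.
by rewrite -[v]mul1mx; apply: sat_img.
Qed.

Lemma tower_count_supp j (F : {ffun 'I_n -> B j}) :
  tower_count F = (exact N F (Mp j))%:R * tower_count F.
Proof.
case: j F => [|j] F; first by rewrite exact0 mul1r.
by rewrite /=; case: (exact _ _ _); rewrite ?mul1r ?mul0r.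
Qed.

(** By [sum_exact], choosing a surjection that keeps [F] exact is the same as choosing an exact form
    at the next level, whatever [F] is; so the numbers of choices multiply. *)
Lemma tower_countE j (F : {ffun 'I_n -> B j}) : (j <= k)%N -> exact N F (Mp j) ->
  tower_count F = \prod_(i < j) #|exacts i|%:R.
Proof.
elim: j F => [|j IH] F jk eF; first by rewrite big_ord0.
rewrite /= eF mul1r; under eq_bigr do rewrite tower_count_supp mulr_natl mulrb.
rewrite -big_mkcondr /= (sum_exact N_gt1 (@tower_count j) (B_ann jk) (B_ann (ltnW jk)) eF (@Mp_sat j)).
rewrite (eq_bigr (fun=> \prod_(i < j) #|exacts i|%:R)) => [|G eG]; last exact: IH (ltnW jk) eG.
rewrite sumr_const big_ord_recr /= -[LHS]mulr_natl mulrC; congr (_ * _).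
by congr (_%:R); apply: eq_card => G; rewrite inE.
Qed.

(** Exact forms differ by surjective endomorphisms, which are injective because [B j] is finite. *)
Lemma card_exacts j (F : {ffun 'I_n -> B j}) : (j <= k)%N -> exact N F (Mp j) ->
  #|exacts j| = #|Sur (B j) (B j)|.
Proof.
move=> jk eF; have Bk := B_ann jk.
have := sum_exact N_gt1 (fun=> 1%N : nat) Bk Bk eF (fun v H => H).
rewrite /= => E.
have <- : (\sum_(G : {ffun 'I_n -> B j} | exact N G (Mp j)) 1 = #|exacts j|)%N.
  by rewrite -sum1_card; apply: eq_bigl => G; rewrite inE.
rewrite -E -sum1_card; apply: eq_bigl => s.
case: (boolP (s \in Sur _ _)) => //= sS; have /SurP[sD sO] := sS.
have /andP[sF /asboolP kF] := eF.
apply/andP; split.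
  apply: (surj_span N_gt1 Bk) => y; have [x <-] := sO y.
  by have [v <-] := span_surj N_gt1 Bk sF x; exists v; rewrite actz_compf.
have s_inj : injective s.
  have /image_injP H : #|image s predT| == #|B j|.
    by apply/eqP/eq_card => y; have [x <-] := sO y; rewrite image_f.
  by move=> x y; apply: H.
apply/asboolP => v; rewrite actz_compf // -kF; split=> [|->]; last exact: Sur0.
by move=> E0; apply: s_inj; rewrite E0 Sur0.
Qed.

End TowerCount.

Section TowerOfMatrices.
Variables (R : numDomainType) (N : nat).
Hypothesis N_gt1 : (1 < N)%N.
Variables (k m N' n : nat) (Ms : seq 'M[int]_n).
Hypothesis size_Ms : size Ms = k.
Hypothesis mN : (m * N' = N)%N.
Hypothesis m_primes : forall p, prime p -> (p %| N)%N -> (p %| m)%N.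
Hypothesis B_N' : forall i, (i <= k)%N -> forall x : B i, x *+ N' = 0.
Hypothesis B_ann : forall i, (i <= k)%N -> killed N (B i).
Local Notation C := (B k).
Let Ck : killed N C := B_ann (leqnn k).

Definition Mprod j : 'M[int]_n := \big[mulmx/1%:M]_(M <- take j Ms) M.

Local Notation gs := (map (@cols N n) Ms).

Lemma Mprod_sat j v : sat N (Mprod j.+1) v -> sat N (Mprod j) v.
Proof.
case: (ltnP j (size Ms)) => js; last by rewrite /Mprod !take_oversize // (leq_trans js).
rewrite /Mprod (take_nth 1%:M js) -cats1. rewrite big_cat big_seq1 /=; exact: sat_mulr.
Qed.

Lemma Mprod_sat_le i j v : (i <= j)%N -> sat N (Mprod j) v -> sat N (Mprod i) v.
Proof.
elim: j => [|j IH]; first by rewrite leqn0 => /eqP ->.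
by rewrite leq_eqVlt => /orP[/eqP -> //|ij] /Mprod_sat; apply: IH.
Qed.

Lemma Mprod0 : Mprod 0 = 1%:M.
Proof. by rewrite /Mprod take0 big_nil. Qed.

Lemma Mprod_all : Mprod k = \big[mulmx/1%:M]_(M <- Ms) M.
Proof. by rewrite /Mprod -size_Ms take_size. Qed.

(** Depends only on the residues of the matrices modulo [N], unlike [exact_weight]; its expectation
    is a [chain_sum]. *)
Definition flag_weight (L : seq {group C}) : R :=
  \sum_(F : {ffun 'I_n -> C} | span F :==: [set: C]) (kers N_gt1 Ck F gs && (imgs F gs == L))%:R.

Definition exact_weight (L : seq {group C}) : R :=
  \sum_(F : {ffun 'I_n -> C}) (exact N F (Mprod k) && (imgs F gs == L))%:R.

Lemma flag_weight_imp (F : {ffun 'I_n -> C}) L : flag [set: C]%G L -> span F :==: [set: C] ->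
  kers N_gt1 Ck F gs && (imgs F gs == L) -> exact N F (Mprod k) && (imgs F gs == L).
Proof.
move=> [_ lL] sF /andP[kF /[dup] iL /eqP iL']; rewrite iL andbT /exact sF; apply/asboolP.
rewrite Mprod_all; apply: (kers_kerz mN m_primes (B_N' (leqnn k)) _ kF).
by rewrite iL' -lL; congr last; apply/val_inj/eqP.
Qed.

Lemma flag_exact_weight L : all (fun M => \det M != 0) Ms ->
  flag [set: C]%G L -> flag_weight L = exact_weight L.
Proof.
move=> dMs fL; rewrite /flag_weight big_mkcond; apply: eq_bigr => F _.
case: ifP => [sF|]; last by rewrite /exact => ->.
congr ((nat_of_bool _)%:R); apply/idP/idP; first exact: flag_weight_imp.
move=> /andP[/andP[_ /asboolP kF] ->]; rewrite andbT; apply: kerz_kers => //.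
by rewrite -Mprod_all.
Qed.

(** The inequality that holds for all matrices; it bounds the weight on singular ones. *)
Lemma flag_le_exact_weight L : flag [set: C]%G L -> flag_weight L <= exact_weight L.
Proof.
move=> fL; rewrite /flag_weight big_mkcond; apply: ler_sum => F _.
case: ifP => [sF|_]; last exact: ler0n.
have := flag_weight_imp fL sF; case: (_ && _); last by move=> _; exact: ler0n.
by move=> ->.
Qed.

(** Each surjection added to the tower prescribes one more entry of the flag, and by [kerz_compf]
    this prescription says that the composite of [F] with [s] is exact. *)
Lemma tower_sum_exact j (s : {ffun C -> B j}) L : s \in Sur C (B j) -> (j <= k)%N ->
  tower_sum exact_weight s L =
  \sum_(F : {ffun 'I_n -> C}) (exact N F (Mprod k) && (drop j (imgs F gs) == L))%:R
     * tower_count R N Mprod (compf s F).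
Proof.
elim: j s L => [|j IH] s L sS jk /=.
  by apply: eq_bigr => F _; rewrite drop0 mulr1.
under eq_bigr => g gS do rewrite (IH _ _ (compf_Sur gS sS) (ltnW jk)).
rewrite exchange_big; apply: eq_bigr => F _ /=; rewrite -mulr_sumr.
rewrite (drop_nth [set: C]%G) ?size_imgs ?size_map ?size_Ms // eqseq_cons.
rewrite (nth_imgs N_gt1 Ck) ?size_Ms // -/(Mprod j.+1).
have [eF|] := boolP (exact N F (Mprod k)); last by rewrite !mul0r.
rewrite (kerz_compf N_gt1 Ck (B_ann jk) eF sS) /=; last by move=> v; apply: Mprod_sat_le.
have -> : \sum_(g in Sur (B j.+1) (B j)) tower_count R N Mprod (compf (compf g s) F)
  = \sum_(g in Sur (B j.+1) (B j)) tower_count R N Mprod (compf g (compf s F)).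
  by apply: eq_bigr => g _; congr tower_count; apply/ffunP => i; rewrite !ffunE.
by rewrite mulrA -natrM mulnb [X in (nat_of_bool X)%:R]andbC.
Qed.

Let idC : {ffun C -> C} := [ffun x => x].

Lemma idC_Sur : idC \in Sur C C.
Proof. by apply/SurP; split=> [x y|z]; rewrite ?ffunE //; exists z; rewrite ffunE. Qed.

Lemma idC_flag : flag (kerf idC) [::].
Proof.
split=> //=; apply/val_inj/setP => x /=; rewrite -[LHS]/(x \in kerf _) kerfE ?idC_Sur //.
by rewrite ffunE inE.
Qed.

Lemma tower_sum_exact_id : tower_sum exact_weight idC [::] =
  \prod_(i < k) #|exacts N Mprod i.+1|%:R.
Proof.
rewrite tower_sum_exact ?idC_Sur //.
have tE (F : {ffun 'I_n -> C}) : exact N F (Mprod k) ->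
    tower_count R N Mprod F = \prod_(i < k) #|exacts N Mprod i|%:R.
  exact: (tower_countE R N_gt1 B_ann Mprod_sat Mprod0 (leqnn k)).
under eq_bigr => F _.
  rewrite drop_oversize ?size_imgs ?size_map ?size_Ms // eqxx andbT.
  rewrite (_ : compf _ F = F); last by apply/ffunP => i; rewrite !ffunE.
  rewrite mulr_natl mulrb.
  over.
rewrite -big_mkcond (eq_bigr (fun=> \prod_(i < k) #|exacts N Mprod i|%:R)) => [|F eF]; last exact: tE.
rewrite sumr_const -[LHS]mulr_natl mulrC.
have -> : #|[pred F : {ffun 'I_n -> C} | exact N F (Mprod k)]| = #|exacts N Mprod k|.
  by apply: eq_card => F; rewrite !inE.
(* The levels below [k] come from [tower_count] and level [k] from [F] itself; level 0 has exactly
   one exact form, so the range shifts to [1..k]. *)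
transitivity (\prod_(i < k.+1) #|exacts N Mprod i|%:R : R); first by rewrite big_ord_recr.
rewrite big_ord_recl /=.
have -> : #|exacts N Mprod 0| = 1%N.
  rewrite -[RHS](cards1 ([ffun=> 0] : {ffun 'I_n -> B 0%N})); apply: eq_card => F; rewrite !inE.
  rewrite (exact0 N_gt1 B_ann Mprod0); symmetry; apply/eqP/ffunP => i.
  exact: B0_eq.
by rewrite mul1r.
Qed.

Lemma tower_sum_flag : all (fun M => \det M != 0) Ms ->
  tower_sum flag_weight idC [::] = \prod_(i < k) #|exacts N Mprod i.+1|%:R.
Proof.
move=> dMs; rewrite -tower_sum_exact_id.
by apply: (eq_tower_sum (m := k)) idC_Sur idC_flag _ => // L _; apply: flag_exact_weight.
Qed.

Lemma tower_sum_flag_le :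
  tower_sum flag_weight idC [::] <= \prod_(i < k) #|exacts N Mprod i.+1|%:R.
Proof.
rewrite -tower_sum_exact_id.
by apply: (le_tower_sum (m := k)) idC_Sur idC_flag _ => // L _; apply: flag_le_exact_weight.
Qed.

End TowerOfMatrices.

End Towers.

(** * Chain sums as expectations over matrices modulo N *)

Lemma codom_ffun_cons (T : finType) k (a : T) (g : {ffun 'I_k -> T}) :
  codom (ffun_cons a g) = a :: codom g.
Proof.
rewrite !codomE enum_ordSl /= ffun_cons0; congr (_ :: _); rewrite -map_comp.
by apply: eq_map => i /=; rewrite ffun_consS.
Qed.

Section Link.
Variables (R : archiRealFieldType) (N : nat).
Hypothesis N_gt1 : (1 < N)%N.
Variable q : 'Z_N -> R.
Variable C : finZmodType.
Hypothesis C_ann : forall p, prime p -> (p %| N)%N -> forall x : C, x *+ (N %/ p) = 0.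

Definition wmat n (g : {ffun 'I_n -> 'cV['Z_N]_n}) : R := \prod_j wcol q (g j).

(** The next form is determined by the matrix, so only [push F g] survives in the sum over [f']. *)
Lemma chain_probE n k (F : {ffun 'I_n -> C}) (L : seq {group C}) : size L = k ->
  chain_prob N_gt1 q C_ann F L =
  expect (@wmat n) (fun g : {ffun 'I_k -> _} =>
    (kers N_gt1 C_ann F (codom g) && (imgs F (codom g) == L))%:R).
Proof.
elim: k F L => [|k IH] F [|A L] //=.
  move=> _; have g0 : {ffun 'I_0 -> {ffun 'I_n -> 'cV['Z_N]_n}} by apply: ffun0; rewrite card_ord.
  by rewrite (expect_ord0 _ _ g0) (size0nil (etrans (size_codom g0) (card_ord 0))).
move=> [sL]; rewrite expect_ordS.
transitivity (\sum_g wmat g * ((kact N_gt1 C_ann F \subset colspan g) &&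
    (span (push F g) :==: A))%:R * chain_prob N_gt1 q C_ann (push F g) L).
  rewrite /pair_prob /expect.
  under eq_bigr => f' _ do rewrite mulr_suml.
  rewrite exchange_big; apply: eq_bigr => g _ /=.
  under eq_bigr => f' _ do rewrite -mulrA.
  rewrite -mulr_sumr -mulrA; congr (_ * _).
  rewrite big_mkcond (bigD1 (push F g)) //= big1 ?addr0 => [|f' f'g].
    have -> : hits F (push F g) g by apply/hitsP => j; rewrite ffunE.
    by rewrite andTb; case: ifP => _; rewrite ?andbT // andbF mul0r.
  rewrite (_ : hits F f' g = false) ?mul0r ?if_same //.
  apply/negP => /hitsP h; move/eqP: f'g; apply; apply/ffunP => j.
  by rewrite ffunE h.
apply: eq_bigr => g _; rewrite -mulrA; congr (_ * _).
rewrite (IH _ _ sL) -expectZ; apply: eq_expect => h.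
rewrite codom_ffun_cons /= eqseq_cons -natrM mulnb; congr (nat_of_bool _)%:R.
rewrite -!andbA; congr (_ && _); rewrite andbCA; congr (_ && _).
Qed.

End Link.

Section TowerLimit.
Variables (R : archiRealFieldType) (N : nat).
Hypothesis N_gt1 : (1 < N)%N.
Variable q : 'Z_N -> R.
Hypothesis q_ge0 : forall r, 0 <= q r.
Hypothesis q_sum1 : \sum_r q r = 1.
Variable alpha : R.
Hypothesis alpha_gt0 : 0 < alpha.
Hypothesis alpha_half : alpha <= 1 / 2.
Hypothesis q_bal : forall p, prime p -> (p %| N)%N -> forall r : nat,
  \sum_(x : 'Z_N | (x %% p)%N == r) q x <= 1 - alpha.
Variable gam : R.
Hypothesis gamE : forall d : R, 0 < d -> eventually (fun r => `|unit_density R N r - gam| <= d).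
Variables (B : nat -> finZmodType) (k m N' : nat).
Hypothesis B0_triv : #|B 0%N| = 1%N.
Hypothesis mN : (m * N' = N)%N.
Hypothesis m_primes : forall p, prime p -> (p %| N)%N -> (p %| m)%N.
Hypothesis B_N' : forall i, (i <= k)%N -> forall x : B i, x *+ N' = 0.
Hypothesis B_ann : forall i, (i <= k)%N -> killed N (B i).
Let Ck : killed N (B k) := B_ann (leqnn k).

(** The observable whose expectation is computed. Being a function of residues it has a finite
    expectation sum, and [tower_weight_event] relates it to the cokernels. *)
Definition tower_weight n (G : {ffun 'I_k -> {ffun 'I_n -> 'cV['Z_N]_n}}) : R :=
  tower_sum (fun L => \sum_(F : {ffun 'I_n -> B k} | span F :==: [set: B k])
    (kers N_gt1 Ck F (codom G) && (imgs F (codom G) == L))%:R) [ffun x : B k => x] [::].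

Lemma tower_weight_tends :
  tends (fun n => expect (@wmat R N q n) (@tower_weight n))
    (\prod_(i < k) #|Sur (B i.+1) (B i)|%:R * gam ^+ k).
Proof.
apply: (@tends_eq _ (fun n => tower_sum (fun L => chain_sum N_gt1 q Ck n [set: B k]%G L)
    [ffun x : B k => x] [::])).
  exists 0%N => n _; rewrite /expect /tower_weight -tower_sum_linear.
  apply: (eq_tower_sum B0_triv (m := k)) => //; [|exact: idC_Sur | exact: idC_flag].
  move=> L sL _; rewrite /chain_sum.
  under eq_bigr => F _ do rewrite (chain_probE N_gt1 q Ck F sL).
  by rewrite -expect_sum.
apply: (tower_sum_tends B0_triv (m := k)) => //; [|exact: idC_Sur | exact: idC_flag].
move=> L sL [pL lL]; have -> : gam ^+ k = gam ^+ size L by rewrite sL.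
apply: (chain_limit N_gt1 q_ge0 q_sum1 alpha_gt0 alpha_half q_bal Ck gamE pL).
by apply/eqP; rewrite lL.
Qed.

Section Integers.
Variables (n : nat) (A : 'I_k -> 'M[int]_n).

Definition red_mats : {ffun 'I_k -> {ffun 'I_n -> 'cV['Z_N]_n}} := [ffun i => cols N (A i)].

Lemma codom_red_mats : codom red_mats = map (@cols N n) (codom A).
Proof. by rewrite !codomE -map_comp; apply: eq_map => i /=; rewrite ffunE. Qed.

Lemma size_codom_A : size (codom A) = k.
Proof. by rewrite size_codom card_ord. Qed.

Lemma tower_weight_ge0 (G : {ffun 'I_k -> {ffun 'I_n -> 'cV['Z_N]_n}}) : 0 <= tower_weight G.
Proof. by apply: tower_sum_ge0 => L; apply: sumr_ge0 => F _; apply: ler0n. Qed.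

Lemma tower_weightE : (forall i, \det (A i) != 0) ->
  tower_weight red_mats = \prod_(i < k) #|exacts B N (Mprod (codom A)) i.+1|%:R.
Proof.
move=> dA; have dAs : all (fun M => \det M != 0) (codom A).
  by apply/allP => _ /codomP[i ->].
rewrite -(tower_sum_flag B0_triv R N_gt1 size_codom_A mN m_primes B_N' B_ann dAs).
by rewrite /tower_weight codom_red_mats.
Qed.

Lemma tower_weight_le :
  tower_weight red_mats <= \prod_(i < k) #|exacts B N (Mprod (codom A)) i.+1|%:R.
Proof.
apply: le_trans (tower_sum_flag_le B0_triv R N_gt1 size_codom_A mN m_primes B_N' B_ann).
by rewrite /tower_weight codom_red_mats.
Qed.

Lemma Mprod_codom (j : 'I_k) :
  Mprod (codom A) j.+1 = \big[mulmx/1%:M]_(i < k | (i <= j)%N) A i.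
Proof.
pose A' i := oapp A 1%:M (insub i).
have AE (i : 'I_k) : A i = A' i by rewrite /A' valK.
have -> : codom A = [seq A' i | i <- iota 0 k].
  by rewrite -val_enum_ord -map_comp codomE; apply: eq_map => i; apply: AE.
rewrite /Mprod -map_take big_map take_iota (minn_idPl (ltn_ord j)).
under [RHS]eq_bigr => i _ do rewrite AE.
rewrite -(big_mkord (fun i => (i <= j)%N) A') -[iota 0 _]/(index_iota 0 j.+1).
by rewrite (big_nat_widen _ _ k) ?ltn_ord.
Qed.

End Integers.

End TowerLimit.

(** * Singular matrices kill many surjections *)

Section SingularMatrices.
Variables (n : nat) (M : 'M[int]_n).
Hypothesis detM : \det M = 0.

(** Halve an integral vector of the left kernel as long as all its entries are even; its nonzero
    entry [j] shrinks each time. *)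
Lemma odd_left_kernel : exists (v : 'rV[int]_n) j, v *m M = 0 /\ odd `|v ord0 j|.
Proof.
have /eqP/det0P[v v0 vM] := detM.
have [j vj] : exists j, v ord0 j != 0.
  apply/existsP; apply: contraNT v0; rewrite negb_exists => /forallP H.
  by apply/eqP/rowP => j; rewrite mxE; apply/eqP; have := H j; rewrite negbK.
have [b hb] : exists b, (`|v ord0 j| < b)%N by exists `|v ord0 j|.+1.
elim: b v vM vj hb {v0} => // b IH v vM vj hb.
have [/existsP[i io]|/existsPn ev] := boolP [exists i, odd `|v ord0 i|]; first by exists v, i.
pose w : 'rV[int]_n := \row_i (v ord0 i %/ 2)%Z.
have vw : v = 2 *: w.
  apply/rowP => i; rewrite !mxE mulrC divzK //.
  by rewrite dvdzE dvdn2 ev.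
have wM : w *m M = 0.
  by move/eqP: vM; rewrite vw -scalemxAl scalemx_eq0 /= => /eqP.
have wj : v ord0 j = 2 * w ord0 j by rewrite {1}vw mxE.
by apply: (IH w wM); move: vj hb; rewrite wj; move: (w ord0 j) => z; lia.
Qed.

Variable e : nat.
Local Notation C := 'Z_(2 ^ e.+1).
Local Notation N := (2 ^ e.+2)%N.

Let C_gt1 : (1 < 2 ^ e.+1)%N. Proof. by rewrite -{1}(expn0 2) ltn_exp2l. Qed.
Lemma two_pow_gt1 : (1 < N)%N. Proof. by rewrite -{1}(expn0 2) ltn_exp2l. Qed.

Lemma two_pow_ann p : prime p -> (p %| N)%N -> forall x : C, x *+ (N %/ p) = 0.
Proof.
move=> pp; rewrite Euclid_dvdX // => /andP[p2 _] x.
have -> : p = 2%N by apply/eqP; rewrite -dvdn_prime2.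
have -> : (N %/ 2 = 2 ^ e.+1)%N by rewrite expnS mulKn.
by rewrite -mulr_natr (pchar_Zp C_gt1) mulr0.
Qed.

Lemma odd_Zp_unit (z : int) : odd `|z| -> (z%:~R : C) \is a GRing.unit.
Proof.
have U m : odd m -> (m%:R : C) \is a GRing.unit.
  by move=> mo; rewrite (unitZpE _ C_gt1) coprimeXl // coprime2n.
by case: z => m zo; [exact: U | rewrite NegzE mulrNz unitrN; exact: U].
Qed.

(** The odd multiples of that vector, read modulo [2 ^ e.+1], give [2 ^ e] distinct forms killed by
    [M]; they are onto because an odd entry is a unit. *)
Lemma singular_hits : (2 ^ e <= \sum_(f : {ffun 'I_n -> C} | span f :==: [set: C])
  hits f (fun _ : 'I_n => 0%R) (cols N M))%N.
Proof.
have [v [j [vM vo]]] := odd_left_kernel.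
have ju := odd_Zp_unit vo.
pose f (t : 'I_(2 ^ e)) : {ffun 'I_n -> C} := [ffun i => (v ord0 i)%:~R * (t.*2.+1)%:R].
have f_inj : injective f.
  move=> s t /ffunP /(_ j); rewrite !ffunE => /(mulrI ju) /(congr1 val) /=.
  have lt (u : 'I_(2 ^ e)) : (u.*2.+1 < 2 ^ e.+1)%N.
    by rewrite expnS mul2n ltn_Sdouble.
  rewrite !(val_Zp_nat C_gt1) !modn_small // => -[/double_inj]; exact: val_inj.
have fS t : span (f t) :==: [set: C].
  apply/eqP/setP => x; rewrite inE.
  have fu : f t j \is a GRing.unit.
    by rewrite ffunE unitrM ju (unitZpE _ C_gt1) coprimeXl // coprime2n /= odd_double.
  have -> : x = f t j *+ (x / f t j : C).
    by rewrite -[RHS]mulr_natr Zp_natK mulrC divrK.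
  by rewrite -FinRing.zmodXgE groupX // mem_gen // imset_f.
have fh t : hits (f t) (fun _ : 'I_n => 0%R) (cols N M).
  apply/hitsP => l; rewrite ffunE -(actz_red two_pow_gt1 two_pow_ann) /actz.
  transitivity (((v *m M) ord0 l)%:~R * (t.*2.+1)%:R : C); last by rewrite vM mxE mul0r.
  rewrite mxE rmorph_sum /= mulr_suml; apply: eq_bigr => i _.
  by rewrite !mxE ffunE rmorphM /= -mulrzr mulrAC.
rewrite -{1}(card_ord (2 ^ e)) -(card_imset predT f_inj) -sum1_card.
rewrite [leqLHS]big_mkcond [leqRHS]big_mkcond; apply: leq_sum => g _.
by case: imsetP => // -[t _ ->]; rewrite fS fh.
Qed.

End SingularMatrices.

(** * Primary parts of cokernels *)

Lemma coprime_torsion_eq0 (V : zmodType) (x : V) s m : coprime s m ->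
  x *+ s = 0 -> x *+ m = 0 -> x = 0.
Proof.
have [->|s0] := posnP s.
  by rewrite /coprime gcd0n => /eqP -> _; rewrite mulr1n.
move=> /eqP csm xs xm; case: (egcdnP m s0) => a b E _.
have : x *+ (a * s) = 0 by rewrite mulnC mulrnA xs mul0rn.
by rewrite E csm mulrnDr mulnC mulrnA xm mul0rn add0r.
Qed.

Lemma mulrn_mod (V : zmodType) (x : V) m : x *+ m = 0 -> forall a, x *+ a = x *+ (a %% m).
Proof. by move=> xm a; rewrite {1}(divn_eq a m) mulrnDr mulnC mulrnA xm mul0rn add0r. Qed.

Lemma coprime_no_prime s N : (0 < N)%N ->
  (forall p, prime p -> (p %| N)%N -> ~ (p %| s)%N) -> coprime s N.
Proof.
move=> N0 H; rewrite /coprime; apply: contraT => g1.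
have gg : (1 < gcdn s N)%N by rewrite ltn_neqAle eq_sym g1 gcdn_gt0 N0 orbT.
have := pdiv_dvd (gcdn s N); rewrite dvdn_gcd => /andP[ps pN].
by case: (H _ (pdiv_prime gg) pN ps).
Qed.

Section Cokernels.
Variables (n : nat) (M : 'M[int]_n).

Definition cl (v : 'cV[int]_n) : Cok M := (\pi_(Cok M) v)%qT.

Lemma clD u v : cl (u + v) = cl u + cl v.
Proof. exact: Quotient.pi_add. Qed.

Lemma cl_eq0 v : cl v = 0 <-> exists w, v = M *m w.
Proof.
have E0 : (\pi_(Cok M) (0 : 'cV[int]_n))%qT = 0 by rewrite piE.
have E : v \in mximage M <-> cl v = 0.
  rewrite -[X in X \in _]subr0 Quotient.idealrBE /cl -E0; split=> [/eqP //|->].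
  exact: eqxx.
split=> [/E /asboolP //|H]; apply/E; exact/asboolP.
Qed.

Lemma cl0 : cl 0 = 0.
Proof. by apply/cl_eq0; exists 0; rewrite mulmx0. Qed.

Lemma clMn v s : cl (v *+ s) = cl v *+ s.
Proof.
by elim: s => [|s IH]; rewrite ?mulr0n ?cl0 // !mulrS clD IH.
Qed.

Lemma cl_sum (I : finType) (c : I -> 'cV[int]_n) : cl (\sum_i c i) = \sum_i cl (c i).
Proof. exact: (big_morph cl clD cl0). Qed.

Lemma cl_surj (x : Cok M) : exists v, cl v = x.
Proof. by exists (repr x); rewrite /cl reprK. Qed.

Lemma cl_det v : cl v *+ `|\det M| = 0.
Proof.
rewrite -clMn; apply/cl_eq0.
have E : M *m (\adj M *m v) = \det M *: v by rewrite mulmxA mul_mx_adj mul_scalar_mx.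
case: (intP (\det M)) E => [|d|d] E /=.
- by exists 0; rewrite mulr0n mulmx0.
- by exists (\adj M *m v); rewrite E -natz scaler_nat.
by exists (- (\adj M *m v)); rewrite mulmxN E scaleNr opprK -natz scaler_nat.
Qed.

Variable P : {fset nat}.
Variable N : nat.
Hypothesis N_gt0 : (0 < N)%N.
Hypothesis P_prime : forall p, p \in P -> prime p.
Hypothesis N_primes : forall p, prime p -> (p %| N)%N = (p \in P).
Hypothesis detM : \det M != 0.

Local Notation PP := (primary_part (Cok M) P).

(** [D] kills the cokernel. An integer [c p], congruent to 1 modulo the [p]-part of [D] and to 0
    modulo the rest, acts as the projection to the [p]-primary component. A class whose components
    all vanish is killed by the sum of the [c p], which is prime to [N]. *)
Lemma primary_projection : exists pr : 'cV[int]_n -> PP,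
  [/\ {morph pr : u v / u + v}, (forall y, exists v, pr v = y) &
      forall v, pr v = 0 <-> sat N M v].
Proof.
(* The factor [N] makes every [p] in [P] divide [D], even if it does not divide the determinant. *)
pose D := (`|\det M| * N)%N.
have D0 : (0 < D)%N by rewrite muln_gt0 N_gt0 absz_gt0 detM.
have clD0 v : cl v *+ D = 0 by rewrite /D mulrnA cl_det mul0rn.
have CD0 (x : Cok M) : x *+ D = 0 by have [v <-] := cl_surj x.
pose dp (p : nat) := (D`_p)%N; pose dq (p : nat) := (D`_p^')%N.
have dpq p : (dp p * dq p)%N = D by apply: partnC.
have copr p : coprime (dp p) (dq p) by apply: coprime_partC.
pose c (p : nat) := chinese (dp p) (dq p) 1 0.
have c1 p : (c p %% dp p = 1 %% dp p)%N by rewrite /c (chinese_modl (copr p)).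
have c0 p : (dq p %| c p)%N by rewrite /dvdn /c (chinese_modr (copr p)) mod0n.
have cD p : (D %| c p * dp p)%N by rewrite -(dpq p) mulnC dvdn_mul.
have pD p : p \in P -> (p %| dp p)%N.
  move=> pP; have pp := P_prime pP; rewrite -{1}(part_pnat_id (pnat_id pp)).
  by apply: partn_dvd => //; rewrite dvdn_mull // N_primes.
have qp p q : prime p -> p != q -> (dp p %| dq q)%N.
  move=> pp pq; rewrite /dp -(partn_part (rho := q^') D) ?dvdn_part // => r.
  by rewrite !inE => /eqP ->.
have mem v : [ffun p : P => cl v *+ c (val p)] \in @primary_family (Cok M) P.
  apply/forallP => p; rewrite ffunE; apply/asboolP; exists (logn (val p) D).
  by rewrite -mulrnA -p_part; have /dvdnP[t ->] := cD (val p); rewrite mulrnA CD0.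
exists (fun v => PrimaryPart (mem v)); split.
- move=> u v; apply/val_inj/ffunP => p; by rewrite [RHS]ffunE /= !ffunE clD mulrnDl.
- move=> y; pose yv := primary_part_val y.
  have yD (p : P) : yv p *+ dp (val p) = 0.
    have /forallP /(_ p) /asboolP[e ye] := primary_part_valP y.
    have pp := P_prime (valP p).
    apply: (@coprime_torsion_eq0 _ _ (val p ^ e) (dq (val p))).
    - by rewrite coprimeXl // (pnat_coprime (pnat_id pp)) // part_pnat.
    - by rewrite mulrnAC ye mul0rn.
    - by rewrite -mulrnA dpq CD0.
  have [v Hv] : exists v : P -> 'cV[int]_n, forall p, cl (v p) = yv p.
    exact: (fin_all_exists (fun p => cl_surj (yv p))).
  exists (\sum_p v p); apply/val_inj/ffunP => p; rewrite ffunE cl_sum -sumrMnl.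
  rewrite (bigD1 p) //= big1 ?addr0 => [|q qp'].
    by rewrite Hv (mulrn_mod (yD p)) c1 -(mulrn_mod (yD p)).
  have /dvdnP[t ->] : (dp (val q) %| c (val p))%N.
    apply: dvdn_trans (c0 _); apply: qp; [exact: P_prime (valP q) | by []].
  by rewrite Hv mulnC mulrnA yD mul0rn.
move=> v; split.
  move=> /(congr1 val) /ffunP E.
  have {}E (p : P) : cl v *+ c (val p) = 0 by have := E p; rewrite !ffunE.
  pose s := (\sum_(p : P) c (val p))%N.
  have : cl v *+ s = 0 by rewrite /s -sumrMnr big1.
  rewrite -clMn => /cl_eq0[w Ew]; exists s, w; split=> //.
  apply: coprime_no_prime => // p pp pN ps.
  have pP : p \in P by rewrite -N_primes.
  move: ps; rewrite /s (bigD1 [` pP]%fset) //= dvdn_addl; last first.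
    apply: dvdn_sum => q qp'.
    apply: dvdn_trans (c0 _); apply: dvdn_trans (pD _ pP) _; apply: qp => //.
    by rewrite eq_sym.
  move=> pc; have := c1 p => /(congr1 (modn^~ p)).
  rewrite !modn_dvdm ?pD // (eqP pc) modn_small ?prime_gt1 //.
move=> [s [w [cs E]]]; apply/val_inj/ffunP => p; rewrite !ffunE /=.
have sv : cl v *+ s = 0 by rewrite -clMn E; apply/cl_eq0; exists w.
have pp := P_prime (valP p).
apply: (@coprime_torsion_eq0 _ _ s (dp (val p))).
- rewrite /dp p_part coprimeXr //; apply: coprime_dvdr cs.
  by rewrite N_primes // (valP p).
- by rewrite mulrnAC sv mul0rn.
by rewrite -mulrnA; have /dvdnP[t ->] := cD (val p); rewrite mulrnA CD0.
Qed.

End Cokernels.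

Section IsoExact.
Variables (n : nat) (M : 'M[int]_n) (P : {fset nat}) (N : nat).
Hypothesis N_gt1 : (1 < N)%N.
Hypothesis P_prime : forall p, p \in P -> prime p.
Hypothesis N_primes : forall p, prime p -> (p %| N)%N = (p \in P).
Hypothesis detM : \det M != 0.
Variable C : finZmodType.
Hypothesis C_ann : killed N C.

Local Notation PP := (primary_part (Cok M) P).

Lemma morph_actz (G : zmodType) (pr : 'cV[int]_n -> G) (f : {additive G -> C}) v :
  {morph pr : u v / u + v} ->
  actz (fun i => f (pr (delta_mx i ord0))) v = f (pr v).
Proof.
move=> prD; pose g v := f (pr v).
have gD : {morph g : u v / u + v} by move=> u w; rewrite /g prD raddfD.
have g0 : g 0 = 0 by apply: (addrI (g 0)); rewrite -gD !addr0.
have gN u : g (- u) = - g u by apply/eqP; rewrite -addr_eq0 -gD addNr g0.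
have gMn u s : g (u *+ s) = g u *+ s.
  by elim: s => [|s IH]; rewrite ?mulr0n ?g0 // !mulrS gD IH.
have gZ u (z : int) : g (z *: u) = g u *~ z.
  case: z => s; first by rewrite -natz scaler_nat gMn natz.
  by rewrite NegzE scaleNr gN mulrNz -natz scaler_nat gMn natz.
rewrite -[RHS]/(g v) {2}(matrix_sum_delta v).
rewrite (big_morph g gD g0); apply: eq_bigr => i _.
by rewrite big_ord1 gZ.
Qed.

(** The projection to the primary part and an exact [F] are surjections with the same kernel, so
    either factors through the other. *)
Lemma iso_exact : zmod_isomorphic PP C <-> exists F : {ffun 'I_n -> C}, exact N F M.
Proof.
have [pr [prD pr_surj pr_ker]] := primary_projection (ltnW N_gt1) P_prime N_primes detM.
have pr0 : pr 0 = 0 by apply: (addrI (pr 0)); rewrite -prD !addr0.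
have prB u v : pr (u - v) = pr u - pr v.
  by apply/eqP; rewrite eq_sym subr_eq -prD subrK.
split.
  move=> [f [g fK gK]].
  exists [ffun i => f (pr (delta_mx i ord0))].
  have E v : actz [ffun i => f (pr (delta_mx i ord0))] v = f (pr v).
    by rewrite -morph_actz //; apply: eq_actz => i; rewrite ffunE.
  apply/andP; split.
    apply: (surj_span N_gt1 C_ann) => x; have [v Ev] := pr_surj (g x).
    by exists v; rewrite E Ev gK.
  apply/asboolP => v; rewrite E -pr_ker; split=> [|->]; last exact: raddf0.
  by move=> E0; rewrite -[pr v]fK E0 -(raddf0 f) fK.
move=> [F /andP[sF /asboolP kF]].
have [v Hv] := choice pr_surj.
have key u y : pr u = y -> actz F (v y) = actz F u.
  move=> uy; apply/eqP; rewrite -subr_eq0 -actzB; apply/eqP/kF/pr_ker.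
  by rewrite prB Hv uy subrr.
pose f y := actz F (v y).
have fB : zmod_morphism f.
  by move=> x y; rewrite /f -actzB; apply: key; rewrite prB !Hv.
pose fA := GRing.isZmodMorphism.Build PP C f fB.
pose fh : {additive PP -> C} := HB.pack f fA.
have [w Hw] := fin_all_exists (span_surj N_gt1 C_ann sF).
exists fh; exists (fun x => pr (w x)) => [y|x] /=.
  apply/eqP; rewrite -subr_eq0 -[y in _ - y]Hv -prB; apply/eqP/pr_ker/kF.
  by rewrite actzB Hw subrr.
by rewrite /f (key (w x)).
Qed.

End IsoExact.

Lemma card_Aut_Sur (C : finZmodType) : #|Aut [set: C]| = #|Sur C C|.
Proof.
rewrite -(card_imset (mem (Aut [set: C])) (f := fun a : {perm C} => [ffun x => a x])); last first.
  by move=> a b /ffunP E; apply/permP => x; have := E x; rewrite !ffunE.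
apply: eq_card => s; apply/imsetP/idP.
  move=> [a]; rewrite inE => /andP[_ /morphicP aM] ->; apply/SurP; split=> [x y|z].
    by rewrite !ffunE; apply: aM; rewrite inE.
  by exists ((a^-1)%g z); rewrite ffunE permKV.
move=> /SurP[sD sO].
have s_inj : injective s.
  have /image_injP H : #|image s predT| == #|C|.
    by apply/eqP/eq_card => y; have [x <-] := sO y; rewrite image_f.
  by move=> x y; apply: H.
exists (perm s_inj); last by apply/ffunP => x; rewrite ffunE permE.
rewrite inE; apply/andP; split; first by apply/subsetP => x _; rewrite inE.
by apply/morphicP => x y _ _; rewrite !permE sD.
Qed.

Section TowerValues.
Variables (R : archiRealFieldType) (N : nat).
Hypothesis N_gt1 : (1 < N)%N.
Variables (B : nat -> finZmodType) (k m N' : nat).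
Hypothesis B0_triv : #|B 0%N| = 1%N.
Hypothesis mN : (m * N' = N)%N.
Hypothesis m_primes : forall p, prime p -> (p %| N)%N -> (p %| m)%N.
Hypothesis B_N' : forall i, (i <= k)%N -> forall x : B i, x *+ N' = 0.
Hypothesis B_ann : forall i, (i <= k)%N -> killed N (B i).
Variable P : {fset nat}.
Hypothesis P_prime : forall p, p \in P -> prime p.
Hypothesis N_primes : forall p, prime p -> (p %| N)%N = (p \in P).

Definition cok_event n (A : 'I_k -> 'M[int]_n) : Prop := forall j : 'I_k,
  zmod_isomorphic (primary_part (Cok (\big[mulmx/1%:M]_(i < k | (i <= j)%N) A i)) P) (B j.+1).

Definition aut_count : R := \prod_(i < k) #|Aut [set: B i.+1]|%:R.

Lemma card_exacts_le n (A : 'I_k -> 'M[int]_n) (i : 'I_k) :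
  (#|exacts B N (Mprod (codom A)) i.+1| <= #|Aut [set: B i.+1]|)%N.
Proof.
rewrite card_Aut_Sur; have [->|[F]] := set_0Vmem (exacts B N (Mprod (codom A)) i.+1).
  by rewrite cards0.
by rewrite inE => eF; rewrite (card_exacts N_gt1 B_ann _ eF).
Qed.

Lemma red_mats_lift n (G : {ffun 'I_k -> {ffun 'I_n -> 'cV['Z_N]_n}}) :
  exists A : 'I_k -> 'M[int]_n, red_mats N A = G.
Proof.
have [u Hu] := fin_all_exists (fun ij : 'I_k * 'I_n => redN_lift (G ij.1 ij.2)).
exists (fun i => \matrix_(a, j) u (i, j) a ord0); apply/ffunP => i; rewrite ffunE.
apply/ffunP => j; rewrite ffunE -(Hu (i, j)); congr redN.
by apply/matrixP => a b; rewrite (ord1 b) !mxE.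
Qed.

(** Every array of residues lifts to integer matrices, for which [tower_weight_le] bounds the weight
    by numbers of exact forms, singular matrices included. *)
Lemma tower_weight_bounds n (G : {ffun 'I_k -> {ffun 'I_n -> 'cV['Z_N]_n}}) :
  0 <= tower_weight R N_gt1 B_ann G <= aut_count.
Proof.
rewrite tower_weight_ge0 /=; have [A <-] := red_mats_lift G.
apply: le_trans (tower_weight_le R N_gt1 B0_triv mN m_primes B_N' B_ann A) _.
apply: ler_prod => i _; rewrite ler0n ler_nat; exact: card_exacts_le.
Qed.

(** For each level an exact form exists precisely when the cokernel has the prescribed primary part,
    and then there are as many as automorphisms. *)
Lemma tower_weight_event n (A : 'I_k -> 'M[int]_n) : (forall i, \det (A i) != 0) ->
  tower_weight R N_gt1 B_ann (red_mats N A) = if `[< cok_event A >] then aut_count else 0.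
Proof.
move=> dA; rewrite (tower_weightE R N_gt1 B0_triv mN m_primes B_N' B_ann dA).
have dM (j : 'I_k) : \det (Mprod (codom A) j.+1) != 0.
  rewrite Mprod_codom; apply: (big_ind (fun M : 'M[int]_n => \det M != 0)) => //.
    by rewrite det1 oner_neq0.
  by move=> X Y dX dY; rewrite det_mulmx mulf_neq0.
have iso (j : 'I_k) := iso_exact N_gt1 P_prime N_primes (dM j) (B_ann (ltn_ord j)).
case: asboolP => [ev|nev].
  apply: eq_bigr => j _; congr (_%:R); rewrite card_Aut_Sur.
  have := ev j; rewrite -Mprod_codom => /iso[F eF].
  exact: (card_exacts N_gt1 B_ann (ltn_ord j) eF).
have [j] : exists j : 'I_k, #|exacts B N (Mprod (codom A)) j.+1| == 0%N.
  apply/existsP; apply: contra_notT nev; rewrite negb_exists => /forallP H j.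
  rewrite -Mprod_codom; apply/iso; have := H j; rewrite -lt0n => /card_gt0P[F].
  by rewrite inE => eF; exists F.
by move=> /eqP E; rewrite (bigD1 j) //= E mul0r.
Qed.

Lemma aut_count_gt0 : 0 < aut_count.
Proof.
apply: prodr_gt0 => i _; rewrite ltr0n; apply/card_gt0P; exists 1%g; exact: group1.
Qed.

End TowerValues.

(** * Density of invertible matrices *)

Lemma card_unitmx_GL p r : (0 < r)%N -> card_unitmx p r = #|'GL_r['F_p]%g|.
Proof.
case: r => // r _; rewrite /card_unitmx cardsT card_sub.
by apply: eq_card => X; rewrite !inE.
Qed.

Lemma card_unitmxE (R : realFieldType) p r : prime p ->
  (card_unitmx p r)%:R / (p ^ (r * r))%:R = \prod_(i < r) (1 - p%:R^-1 * p%:R^-1 ^+ i) :> R.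
Proof.
move=> pp; have p0 : p%:R != 0 :> R by rewrite pnatr_eq0 -lt0n prime_gt0.
case: r => [|r].
  rewrite big_ord0 muln0 expn0 divr1 (_ : card_unitmx p 0 = 1%N) //.
  rewrite /card_unitmx -[RHS](cards1 (0 : 'M['F_p]_0)); apply: eq_card => X.
  by rewrite !inE [X]flatmx0 eqxx unitmxE det_mx00 unitr1.
rewrite card_unitmx_GL // card_GL // card_Fp // natrM natr_prod.
(* The order of the linear group is [p ^ 'C(r.+1, 2)] times the product of the [p ^ i - 1]; this
   splitting of the exponent cancels the power and pairs each factor with its [p ^ i]. *)
have -> : (r.+1 * r.+1 = 'C(r.+1, 2) + \sum_(1 <= i < r.+2) i)%N.
  have -> : (\sum_(1 <= i < r.+2) i = 'C(r.+2, 2))%N by rewrite -bin2_sum [RHS]big_ltn.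
  by have := mul_bin_left r.+1 1; rewrite (binS r.+1 1) bin1; nia.
rewrite expnD expn_sum natrM natr_prod invfM mulrACA mulfV ?mul1r; last first.
  by rewrite natrX expf_neq0.
rewrite -prodfV -big_split /= big_add1 big_mkord; apply: eq_bigr => i _.
rewrite natrB ?expn_gt0 ?prime_gt0 // natrX mulrBl mulfV ?expf_neq0 //.
by rewrite mul1r -exprS exprVn.
Qed.

Lemma unit_densityE (R : archiRealFieldType) N r (P : {fset nat}) : (0 < N)%N ->
    (forall p, p \in P -> prime p) -> (forall p, prime p -> (p %| N)%N = (p \in P)) ->
  unit_density R N r = \prod_(p <- P) \prod_(i < r) (1 - p%:R^-1 * p%:R^-1 ^+ i).
Proof.
move=> N0 Pp NP.
have -> : unit_density R N r = \prod_(p : 'I_N.+1 | (val p) \in P) \prod_(i < r) (1 - (val p)%:R^-1 * (val p)%:R^-1 ^+ i).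
  rewrite /unit_density /prN; apply: eq_big => [p|p /andP[pp _]]; last exact: card_unitmxE.
  case: (boolP (prime p)) => [pp|np] /=; first by rewrite NP.
  by symmetry; apply/negP => /Pp; apply/negP.
rewrite -(big_mkord (fun p => p \in P) (fun p => \prod_(i < r) (1 - p%:R^-1 * p%:R^-1 ^+ i))).
rewrite -big_filter; apply: perm_big; apply: uniq_perm.
- by rewrite filter_uniq // iota_uniq.
- exact: fset_uniq.
move=> p; rewrite mem_filter mem_index_iota /= ltnS.
case: (boolP (p \in P)) => //= pP; rewrite dvdn_leq // NP //; exact: Pp.
Qed.

Lemma tends_prod (R : archiRealFieldType) (T : eqType) (s : seq T) (u : T -> nat -> R) (l : T -> R) :
  (forall t, t \in s -> tends (u t) (l t)) ->
  tends (fun n => \prod_(t <- s) u t n) (\prod_(t <- s) l t).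
Proof.
elim: s => [|t s IH] H.
  by rewrite big_nil; apply: tends_eq (tends_cst 1); exists 0%N => n _; rewrite big_nil.
rewrite big_cons; apply: (@tends_eq _ (fun n => u t n * \prod_(t <- s) u t n)).
  by exists 0%N => n _; rewrite big_cons.
apply: tends_mul; first by apply: H; rewrite mem_head.
by apply: IH => x xs; apply: H; rewrite inE xs orbT.
Qed.

From mathcomp Require Import automorphism all_classical all_reals all_analysis.

Import numFieldNormedType.Exports.

Local Open Scope classical_set_scope.
Local Open Scope ring_scope.

(** * Passage to the reals and to random variables *)

Lemma tendsP (R : realType) (u : nat -> R) (l : R) : tends u l <-> u @ \oo --> l.
Proof.
split=> [H|H].
  apply/cvgrPdist_le => e e0; have [n0 Hn] := H e e0.
  by exists n0 => // n /= nn; rewrite distrC; apply: Hn.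
move=> d d0; move/cvgrPdist_le: H => /(_ d d0)[n0 _ Hn]; exists n0 => n nn.
by rewrite distrC; apply: Hn.
Qed.

(** All factors lie between 0 and 1, so the partial products are nonincreasing and bounded below,
    and the limit defining [qpochhammer] exists. *)
Lemma tends_qpochhammer (R : realType) (a q : R) : 0 <= a <= 1 -> 0 <= q <= 1 ->
  tends (fun m => \prod_(i < m) (1 - a * q ^+ i)) (qpochhammer a q).
Proof.
move=> /andP[a0 a1] /andP[q0 q1]; apply/tendsP.
have f01 i : 0 <= 1 - a * q ^+ i <= 1.
  rewrite subr_ge0 gerBl mulr_ge0 ?exprn_ge0 // andbT.
  by apply: mulr_ile1 => //; [exact: exprn_ge0 | exact: exprn_ile1].
apply: nonincreasing_is_cvgn.
  apply/nonincreasing_seqP => m; rewrite big_ord_recr /= ler_piMr //.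
    by apply: prodr_ge0 => i _; case/andP: (f01 i).
  by case/andP: (f01 m).
exists 0 => _ [m _ <-]; apply: prodr_ge0 => i _; by case/andP: (f01 i).
Qed.

Lemma unit_density_tends (R : realType) N (P : {fset nat}) : (0 < N)%N ->
    (forall p, p \in P -> prime p) -> (forall p, prime p -> (p %| N)%N = (p \in P)) ->
  tends (unit_density R N) (\prod_(p <- P) qpochhammer (p%:R^-1) (p%:R^-1)).
Proof.
move=> N0 Pp NP.
apply: (@tends_eq _ (fun r => \prod_(p <- P) \prod_(i < r) (1 - p%:R^-1 * p%:R^-1 ^+ i))).
  by exists 0%N => r _; rewrite (unit_densityE _ _ N0 Pp NP).
apply: tends_prod => p pP; have p1 : 0 <= (p%:R : R)^-1 <= 1.
  by rewrite invr_ge0 ler0n invf_le1 ?ltr0n ?ler1n prime_gt0 ?Pp.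
exact: tends_qpochhammer.
Qed.

Section FiniteValued.
Context {R : realType} {d : measure_display} {T : measurableType d}.
Variable Pr : probability T R.
Variables (F : finType) (Y : T -> F).
Hypothesis mY : forall y, measurable [set w | Y w = y].

Lemma prob_seq (s : seq F) : uniq s -> measurable [set w | Y w \in s] /\
  Pr [set w | Y w \in s] = (\sum_(y <- s) fine (Pr [set w | Y w = y]))%:E.
Proof.
elim: s => [_|y s IH /= /andP[ys us]].
  have -> : [set w | Y w \in [::]] = set0 by apply/seteqP; split.
  by rewrite measure0 big_nil.
have [ms E] := IH us.
have -> : [set w | Y w \in y :: s] = [set w | Y w = y] `|` [set w | Y w \in s].
  apply/seteqP; split=> w /=; rewrite inE.
    by move=> /orP[/eqP|]; [left | right].
  by move=> [->|->]; rewrite ?eqxx ?orbT.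
split; first exact: measurableU.
rewrite measureU //; last first.
  by apply/seteqP; split=> w //= [-> ]; rewrite (negPf ys).
rewrite big_cons EFinD; congr (_ + _)%E; last exact: E.
by rewrite fineK // fin_num_measure.
Qed.

Lemma prob_pred (S : pred F) : measurable [set w | S (Y w)] /\
  Pr [set w | S (Y w)] = (\sum_(y | S y) fine (Pr [set w | Y w = y]))%:E.
Proof.
have [mS E] := prob_seq (enum_uniq S).
have ES : [set w | S (Y w)] = [set w | Y w \in enum S].
  by apply/seteqP; split=> w /=; rewrite mem_enum.
by rewrite ES E big_enum.
Qed.

End FiniteValued.

Section Residues.
Context {R : realType} {d0 : measure_display} {T0 : measurableType d0}.
Variable P0 : probability T0 R.
Variable xi : {RV P0 >-> int}.

Definition residue_law (N : nat) (r : 'Z_N) : R := fine (P0 [set w | (xi w)%:~R = r]).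

Lemma RV_meas {d : measure_display} {T : measurableType d} (Pr : probability T R)
  (X : {RV Pr >-> int}) (A : set int) : measurable (X @^-1` A).
Proof. exact: (measurable_funPTI X). Qed.

Lemma residue_law_ge0 N (r : 'Z_N) : 0 <= residue_law r.
Proof. exact: fine_ge0. Qed.

Lemma residue_fiber N (r : 'Z_N) : measurable [set w | (xi w)%:~R = r].
Proof. exact: (RV_meas xi [set z | z%:~R = r]). Qed.

Lemma residue_law_sum N : \sum_(r : 'Z_N) residue_law r = 1.
Proof.
have [_ /esym] := prob_pred P0 (@residue_fiber N) predT.
have -> : [set w | predT ((xi w)%:~R : 'Z_N)] = setT by apply/seteqP; split.
by rewrite probability_setT => -[].
Qed.

Lemma residue_law_balanced N alpha : (1 < N)%N -> balanced alpha xi -> alpha <= 1 / 2 ->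
  forall p, prime p -> (p %| N)%N -> forall r : nat,
  \sum_(x : 'Z_N | (x %% p)%N == r) residue_law x <= 1 - alpha.
Proof.
move=> N1 bal a12 p pp pN r; have p0 := prime_gt0 pp.
(* For [r >= p] the class is empty and the bound reads [0 <= 1 - alpha]. *)
have [rp|pr] := ltnP r p; last first.
  rewrite big_pred0 ?subr_ge0 ?(le_trans a12) // => [|x].
    by rewrite ler_pdivrMr // mul1r ler1n.
  by apply/negbTE; rewrite neq_ltn (leq_trans _ pr) // ltn_mod.
have [_ E] := prob_pred P0 (@residue_fiber N) (fun x : 'Z_N => (x %% p)%N == r).
rewrite -lee_fin -E; apply: le_trans (bal p pp).
have -> : [set w | (((xi w)%:~R : 'Z_N) %% p)%N == r] = [set w | (xi w = r%:Z %[mod p%:Z])%Z].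
  have key (z : int) : ((z%:~R : 'Z_N) %% p)%N = r <-> (z = r%:Z %[mod p%:Z])%Z.
    rewrite (intr_ZpE N1) (val_Zp_nat N1).
    have N0 : N%:Z != 0 by rewrite eqz_nat -lt0n ltnW.
    rewrite [(_ %% N)%N]modn_small; last by rewrite -ltz_nat gez0_abs ?modz_ge0 // ltz_pmod // ltz_nat ltnW.
    have -> : (z = r%:Z %[mod p%:Z])%Z <-> (`|(z %% N)%Z|%:Z = r%:Z %[mod p%:Z])%Z.
      rewrite gez0_abs ?modz_ge0 //.
      have /dvdnP[t Nt] := pN.
      have -> // : ((z %% N)%Z %% p = z %% p)%Z.
      by rewrite {2}(divz_eq z N) [X in (_ * X%:Z)%R]Nt PoszM mulrA modzMDl.
    rewrite !modz_nat (modn_small rp); split=> [->//|[]//].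
  by apply/seteqP; split=> w /= => [/eqP/key | /key/eqP].
exact: (le_bigmax _ (fun r : 'I_p => P0 [set w | (xi w = r%:Z %[mod p%:Z])%Z]) (Ordinal rp)).
Qed.

End Residues.

Section RandomMatrices.
Context {R : realType} {d0 : measure_display} {T0 : measurableType d0}.
Variable P0 : probability T0 R.
Variable xi : {RV P0 >-> int}.
Context {d : measure_display} {T : measurableType d}.
Variable Pr : probability T R.
Variables k n : nat.
Variable X : 'I_k -> 'I_n -> 'I_n -> {RV Pr >-> int}.
Hypothesis X_distr : forall i a b, identically_distributed (X i a b) xi.
Hypothesis X_indep : mutually_independent (fun t : 'I_k * 'I_n * 'I_n => X t.1.1 t.1.2 t.2).

Definition mats (w : T) (i : 'I_k) : 'M[int]_n := \matrix_(a, b) X i a b w.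

(** There are countably many arrays of integers, so every event about them is a countable union of
    elementary ones. *)
Lemma meas_mats (Phi : ('I_k -> 'M[int]_n) -> Prop) : measurable [set w | Phi (mats w)].
Proof.
pose mat_of (u : {ffun 'I_k * 'I_n * 'I_n -> int}) (i : 'I_k) : 'M[int]_n :=
  \matrix_(a, b) u (i, a, b).
have -> : [set w | Phi (mats w)] = \bigcup_(u in [set: {ffun 'I_k * 'I_n * 'I_n -> int}]) [set w |
    (forall t : 'I_k * 'I_n * 'I_n, X t.1.1 t.1.2 t.2 w = u t) /\ Phi (mat_of u)].
  apply/seteqP; split=> w /=.
    move=> Pw; exists [ffun t : 'I_k * 'I_n * 'I_n => X t.1.1 t.1.2 t.2 w] => //=.
    split=> [t|]; first by rewrite ffunE.
    have -> // : mat_of [ffun t : 'I_k * 'I_n * 'I_n => X t.1.1 t.1.2 t.2 w] = mats w.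
    by apply/funext => i; apply/matrixP => a b; rewrite !mxE ffunE.
  move=> [u _ [Hu Pu]]; have -> // : mats w = mat_of u.
  by apply/funext => i; apply/matrixP => a b; rewrite !mxE -Hu.
apply: countable_bigcupT_measurable => [|u]; first exact: countableP.
have [Pu|nPu] := pselect (Phi (mat_of u)); last first.
  by rewrite (_ : [set w | _] = set0) //; apply/seteqP; split=> w //= [].
have -> : [set w | (forall t : 'I_k * 'I_n * 'I_n, X t.1.1 t.1.2 t.2 w = u t) /\ Phi (mat_of u)] =
    \bigcap_(t in [set: 'I_k * 'I_n * 'I_n]) (X t.1.1 t.1.2 t.2 @^-1` [set u t]).
  by apply/seteqP; split=> w /=; [move=> [H _] t _; apply: H | move=> H; split=> // t; apply: H].
by apply: fin_bigcap_measurable => [|t _]; [exact: finite_finset | exact: RV_meas].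
Qed.

Lemma prob_residues N (J : {set 'I_k * 'I_n * 'I_n}) (u : 'I_k * 'I_n * 'I_n -> 'Z_N) :
  Pr [set w | forall t, t \in J -> (X t.1.1 t.1.2 t.2 w)%:~R = u t] =
  (\prod_(t in J) residue_law xi (u t))%:E.
Proof.
pose A t : set int := [set z | z%:~R = u t].
have -> : [set w | forall t, t \in J -> (X t.1.1 t.1.2 t.2 w)%:~R = u t] =
    \bigcap_(t in [set` J]) (X t.1.1 t.1.2 t.2 @^-1` A t) by [].
rewrite (X_indep J (A := A)) // (big_morph EFin EFinM erefl); apply: eq_bigr => t _.
rewrite /residue_law fineK ?fin_num_measure //; last exact: residue_fiber.
exact: (X_distr t.1.1 t.1.2 t.2 (A := A t)).
Qed.

Local Notation V N := ('cV['Z_N]_n).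

Lemma red_matsP N w (G : {ffun 'I_k -> {ffun 'I_n -> V N}}) : red_mats N (mats w) = G <->
  forall t : 'I_k * 'I_n * 'I_n, (X t.1.1 t.1.2 t.2 w)%:~R = G t.1.1 t.2 t.1.2 ord0.
Proof.
split=> [<- t|H]; first by rewrite !ffunE !mxE.
apply/ffunP => i; apply/ffunP => b; apply/matrixP => a z; rewrite (ord1 z) !ffunE !mxE.
exact: (H (i, a, b)).
Qed.

Lemma prob_mats N (G : {ffun 'I_k -> {ffun 'I_n -> V N}}) :
  fine (Pr [set w | red_mats N (mats w) = G]) = \prod_i wmat (@residue_law _ _ _ _ xi N) (G i).
Proof.
have -> : [set w | red_mats N (mats w) = G] =
    [set w | forall t : 'I_k * 'I_n * 'I_n, t \in [set: 'I_k * 'I_n * 'I_n]%SET ->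
      (X t.1.1 t.1.2 t.2 w)%:~R = G t.1.1 t.2 t.1.2 ord0].
  apply/seteqP; split=> w /=; first by move=> /red_matsP H t _; apply: H.
  by move=> H; apply/red_matsP => t; apply: H; rewrite inE.
rewrite (prob_residues [set: _]%SET (fun t => G t.1.1 t.2 t.1.2 ord0)) /=.
rewrite (eq_bigl predT) => [|t]; last by rewrite inE.
rewrite -(pair_bigA _ (fun ia b => residue_law xi (G ia.1 b ia.2 ord0))) /=.
rewrite -(pair_bigA _ (fun i a => \prod_b residue_law xi (G i b a ord0))) /=.
apply: eq_bigr => i _; rewrite exchange_big; apply: eq_bigr => b _ //=.
Qed.

Lemma prob_mat N (i : 'I_k) (g : {ffun 'I_n -> V N}) :
  fine (Pr [set w | cols N (mats w i) = g]) = wmat (@residue_law _ _ _ _ xi N) g.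
Proof.
pose J := [set t : 'I_k * 'I_n * 'I_n | t.1.1 == i]%SET.
have -> : [set w | cols N (mats w i) = g] =
    [set w | forall t : 'I_k * 'I_n * 'I_n, t \in J ->
      (X t.1.1 t.1.2 t.2 w)%:~R = g t.2 t.1.2 ord0].
  apply/seteqP; split=> w /=.
    by move=> <- t; rewrite inE => /eqP <-; rewrite !ffunE !mxE.
  move=> H; apply/ffunP => b; apply/matrixP => a z; rewrite (ord1 z) !ffunE !mxE.
  by apply: (H (i, a, b)); rewrite inE.
rewrite (prob_residues J (fun t => g t.2 t.1.2 ord0)) /=.
rewrite (eq_bigl (fun t => t.1.1 == i)) => [|t]; last by rewrite inE.
rewrite big_mkcond /=.
rewrite -(pair_bigA _ (fun ia b => if ia.1 == i then residue_law xi (g b ia.2 ord0) else 1)) /=.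
rewrite -(pair_bigA _ (fun j a => \prod_b (if j == i then residue_law xi (g b a ord0) else 1))) /=.
rewrite (bigD1 i) //= [X in _ * X]big1 ?mulr1 => [|j ji].
  by rewrite exchange_big; apply: eq_bigr => b _ /=; apply: eq_bigr => a _; rewrite eqxx.
by rewrite big1 // => a _; rewrite big1 // => b _; rewrite (negPf ji).
Qed.

Lemma mat_fiber N i g : measurable [set w | cols N (mats w i) = g].
Proof. exact: (meas_mats (fun A => cols N (A i) = g)). Qed.

End RandomMatrices.

(** * Comparing the event with the weight *)

Section Comparison.
Context {R : realType} {d0 : measure_display} {T0 : measurableType d0}.
Variable P0 : probability T0 R.
Variable xi : {RV P0 >-> int}.
Context {d : measure_display} {T : measurableType d}.
Variable Pr : probability T R.
Variables k n : nat.
Variable X : 'I_k -> 'I_n -> 'I_n -> {RV Pr >-> int}.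
Hypothesis X_distr : forall i a b, identically_distributed (X i a b) xi.
Hypothesis X_indep : mutually_independent (fun t : 'I_k * 'I_n * 'I_n => X t.1.1 t.1.2 t.2).

Local Notation mats := (mats X).
Local Notation law N := (@residue_law _ _ _ _ xi N).

(** Markov's inequality for the number [h] of surjections killed by the matrix. *)
Lemma prob_singular e (i : 'I_k) :
  \sum_(f : {ffun 'I_n -> 'Z_(2 ^ e.+1)} | span f :==: [set: 'Z_(2 ^ e.+1)]%SET)
     hit_prob (law (2 ^ e.+2)) f (fun _ : 'I_n => 0) <= 3 ->
  fine (Pr [set w | \det (mats w i) = 0]) <= 3 / 2 ^+ e.
Proof.
move=> H3; pose q := law (2 ^ e.+2).
pose h (g : {ffun 'I_n -> 'cV['Z_(2 ^ e.+2)]_n}) : nat :=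
  (\sum_(f : {ffun 'I_n -> 'Z_(2 ^ e.+1)} | span f :==: [set: 'Z_(2 ^ e.+1)]%SET)
     hits f (fun _ : 'I_n => 0%R) g)%N.
have [mS E] := prob_pred Pr (mat_fiber X (N := 2 ^ e.+2) i) (fun g => (2 ^ e <= h g)%N).
have le1 : fine (Pr [set w | \det (mats w i) = 0]) <= \sum_(g | (2 ^ e <= h g)%N) wmat q g.
  rewrite -lee_fin fineK ?fin_num_measure //; last first.
    exact: (meas_mats X (fun A => \det (A i) = 0)).
  rewrite (eq_bigr (fun g => fine (Pr [set w | cols (2 ^ e.+2) (mats w i) = g]))) => [|g _].
    rewrite -E; apply: le_measure; rewrite ?inE //.
      exact: (meas_mats X (fun A => \det (A i) = 0)).
    by move=> w /= dw; apply: singular_hits.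
  by rewrite (prob_mat X_distr X_indep).
apply: le_trans le1 _; rewrite ler_pdivlMr ?exprn_gt0 //.
apply: le_trans H3; rewrite mulr_suml.
apply: le_trans (_ : \sum_g wmat q g * (h g)%:R <= _).
  rewrite big_mkcond; apply: ler_sum => g _.
  have w0 : 0 <= wmat q g.
    by apply: prodr_ge0 => j _; apply: prodr_ge0 => a _; apply: residue_law_ge0.
  case: ifP => [hg|_]; last by rewrite mulr_ge0.
  by rewrite ler_wpM2l // -natrX ler_nat.
rewrite /hit_prob /expect exchange_big /=; apply: ler_sum => g _.
by rewrite -mulr_sumr /wmat natr_sum.
Qed.

Variable N : nat.
Local Notation MG := {ffun 'I_k -> {ffun 'I_n -> 'cV['Z_N]_n}}.
Variables (t : MG -> R) (K : R) (ev : ('I_k -> 'M[int]_n) -> Prop).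
Hypothesis K_gt0 : 0 < K.
Hypothesis t_bounds : forall G, 0 <= t G <= K.
Hypothesis t_event : forall A, (forall i, \det (A i) != 0) ->
  t (red_mats N A) = if `[< ev A >] then K else 0.

(** Divided by [K], the weight is the indicator of the event on nonsingular matrices and lies
    between 0 and 1 on all others. *)
Lemma expect_close :
  `|fine (Pr [set w | ev (mats w)]) - expect (@wmat _ _ (law N) n) t / K| <=
    \sum_i fine (Pr [set w | \det (mats w i) = 0]).
Proof.
(* The event depends on integers and the weight on residues; recording both, together with the
   singularity of each matrix, gives one variable with finitely many values. *)
pose Y w : MG * bool * {ffun 'I_k -> bool} :=
  (red_mats N (mats w), `[< ev (mats w) >], [ffun i => \det (mats w i) == 0]).
have mY y : measurable [set w | Y w = y].
  exact: (meas_mats X (fun A =>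
    (red_mats N A, `[< ev A >], [ffun i => \det (A i) == 0]) = y)).
pose p y := fine (Pr [set w | Y w = y]).
have p0 y : 0 <= p y by apply: fine_ge0.
have pr_pred (S : pred (MG * bool * {ffun 'I_k -> bool})) :
    fine (Pr [set w | S (Y w)]) = \sum_(y | S y) p y.
  by have [_ ->] := prob_pred Pr mY S.
have -> : [set w | ev (mats w)] = [set w | (Y w).1.2].
  by apply/seteqP; split=> w /= /asboolP.
have dE i : [set w | \det (mats w i) = 0] = [set w | (Y w).2 i].
  by apply/seteqP; split=> w /=; rewrite ffunE => /eqP.
under [leRHS]eq_bigr do rewrite dE.
rewrite (pr_pred (fun y => y.1.2)).
under [leRHS]eq_bigr => i _ do rewrite (pr_pred (fun y => y.2 i)) big_mkcond.
rewrite exchange_big /=.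
have -> : expect (@wmat _ _ (law N) n) t = \sum_y p y * t y.1.1.
  rewrite (partition_big (fun y => y.1.1) predT) //=; apply: eq_bigr => G _.
  rewrite -(prob_mats X_distr X_indep).
  have -> : [set w | red_mats N (mats w) = G] = [set w | (Y w).1.1 == G].
    by apply/seteqP; split=> w /= /eqP.
  rewrite (pr_pred (fun y => y.1.1 == G)) mulr_suml.
  by apply: eq_bigr => y /eqP ->.
rewrite big_mkcond mulr_suml -sumrB.
apply: le_trans (ler_norm_sum _ _ _) _; apply: ler_sum => y _.
have [y0|[w Yw]] : [set w | Y w = y] = set0 \/ exists w, Y w = y.
  by have [->|/set0P[w Hw]] := eqVneq [set w | Y w = y] set0; [left | right; exists w].
  have -> : p y = 0 by rewrite /p y0 measure0.
  rewrite mul0r mul0r if_same subrr normr0; apply: sumr_ge0 => i _.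
  by case: ifP.
have [/existsP[i yi]|/existsPn nd] := boolP [exists i, y.2 i].
  apply: le_trans (_ : p y <= _); last first.
    rewrite (bigD1 i) //= yi lerDl; apply: sumr_ge0 => j _.
    by case: ifP.
  have /andP[t0 tK] := t_bounds y.1.1.
  have a0 : 0 <= p y * t y.1.1 / K by rewrite !mulr_ge0 // invr_ge0 ltW.
  have a1 : p y * t y.1.1 / K <= p y.
    by rewrite -mulrA ler_piMr // ler_pdivrMr // mul1r.
  rewrite ler_norml; case: ifP => _.
    by apply/andP; split; have := p0 y; lra.
  by apply/andP; split; have := p0 y; lra.
have dw i : \det (mats w i) != 0 by have := nd i; rewrite -Yw ffunE.
have -> : y.1.2 = `[< ev (mats w) >] by rewrite -Yw.
have -> : y.1.1 = red_mats N (mats w) by rewrite -Yw.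
rewrite t_event //; case: asboolP => _.
  by rewrite mulfK ?gt_eqF // subrr normr0; apply: sumr_ge0 => i _; case: ifP.
by rewrite mulr0 mul0r subrr normr0; apply: sumr_ge0 => i _; case: ifP.
Qed.

End Comparison.

Section TrivialPrimes.

Lemma trivial_eq (C : finZmodType) : #|C| = 1%N -> forall x y : C, x = y.
Proof. by move=> /eqP/fintype1P[z Hz] x y; rewrite (Hz x) (Hz y). Qed.

Lemma card_Sur_trivial (C D : finZmodType) : #|C| = 1%N -> #|D| = 1%N -> #|Sur C D| = 1%N.
Proof.
move=> C1 D1; apply/eqP; rewrite eqn_leq; apply/andP; split.
  by apply: leq_trans (max_card _) _; rewrite card_ffun D1 exp1n.
apply/card_gt0P; exists [ffun=> 0]; apply/SurP; split=> [x y|z]; first by rewrite !ffunE addr0.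
by exists 0; apply: trivial_eq.
Qed.

(** The empty set of primes is treated apart because the modulus built from it would be 1. *)
Lemma trivial_primary_iso (G : zmodType) (C : finZmodType) : #|C| = 1%N ->
  zmod_isomorphic (primary_part G fset0) C.
Proof.
move=> C1; have fB : zmod_morphism (fun _ : primary_part G fset0 => 0 : C).
  by move=> x y; rewrite subr0.
pose fA := GRing.isZmodMorphism.Build (primary_part G fset0) C (fun=> 0) fB.
pose f : {additive primary_part G fset0 -> C} := HB.pack (fun _ : primary_part G fset0 => 0 : C) fA.
exists f; exists (fun=> 0) => x; last exact: trivial_eq.
by apply/val_inj/ffunP => p; have := valP p; rewrite in_fset0.
Qed.

End TrivialPrimes.

Section Limit.
Variables (R : realType) (k : nat).
Variables (alpha : R) (halpha0 : 0 < alpha) (halpha1 : alpha <= 1 / 2).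
Variables (d0 : measure_display) (T0 : measurableType d0) (P0 : probability T0 R).
Variables (xi : {RV P0 >-> int}) (hxi : balanced alpha xi).
Variables (d : nat -> measure_display) (T : forall n : nat, measurableType (d n)).
Variable Pr : forall n : nat, probability (T n) R.
Variable M : forall n : nat, 'I_k -> 'I_n -> 'I_n -> {RV (Pr n) >-> int}.
Hypothesis M_distr : forall n : nat, (1 <= n)%N -> forall (i : 'I_k) (a b : 'I_n),
  identically_distributed (M i a b) xi.
Hypothesis M_indep : forall n : nat, (1 <= n)%N ->
  mutually_independent (fun t : 'I_k * 'I_n * 'I_n => M t.1.1 t.1.2 t.2).

Local Notation law N := (@residue_law _ _ _ _ xi N).

(** Count surjections onto the integers modulo [2 ^ m.+1] with [3 / 2 ^ m] below the tolerance. The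
    prime 2 serves independently of [P], since balance is assumed at every prime. *)
Lemma singular_tends (i : 'I_k) :
  tends (fun n => fine (Pr n [set w | \det (mats (@M n) w i) = 0])) 0.
Proof.
move=> e e0; have [m Hm] : exists m : nat, 3 / 2 ^+ m <= e.
  have [m0 Hm] : exists m : nat, 3 / e < m%:R.
    by exists (Num.bound (3 / e)); apply: archi_boundP; rewrite divr_ge0 // ltW.
  exists m0; rewrite ler_pdivrMr ?exprn_gt0 // mulrC -ler_pdivrMr //.
  apply: le_trans (ltW Hm) _; rewrite -natrX ler_nat; exact/ltnW/ltn_expl.
have two_primes p : prime p -> (p %| 2 ^ m.+2)%N = (p \in [fset 2%N]%fset).
  by move=> pp; rewrite Euclid_dvdX // andbT dvdn_prime2 // inE.
have two_prime p : p \in [fset 2%N]%fset -> prime p by rewrite inE => /eqP ->.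
have gam := @unit_density_tends R _ _ (ltnW (two_pow_gt1 m)) two_prime two_primes.
have := hit_sum_le3 (two_pow_gt1 m) (@residue_law_ge0 _ _ _ _ xi _) (residue_law_sum xi _)
  halpha0 halpha1 (residue_law_balanced (two_pow_gt1 m) hxi halpha1) (@two_pow_ann m) gam.
move=> /eventuallyI /(_ (eventually_ge 1)).
apply: eventually_impl => n [H3 n1]; rewrite subr0 ger0_norm ?fine_ge0 //.
by apply: le_trans Hm; apply: (prob_singular (M_distr n1) (M_indep n1)).
Qed.

Variable B : nat -> finZmodType.
Hypothesis hB0 : #|B 0%N| = 1%N.
Variable P : {fset nat}.
Hypothesis hPprime : forall p : nat, p \in P -> prime p.
Hypothesis hPB : forall (i : nat) (p : nat), (1 <= i <= k)%N -> prime p ->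
  (p %| #|B i|)%N -> p \in P.

Lemma cok_event_tends : P != fset0 ->
  tends (fun n => fine (Pr n [set w | cok_event B P (mats (@M n) w)]))
    (\prod_(i < k) #|Sur (B i.+1) (B i)|%:R *
     (\prod_(p <- P) qpochhammer (p%:R^-1) (p%:R^-1)) ^+ k / aut_count R B k).
Proof.
move=> P0'.
(* [N'] kills every [B i], and [m] supplies one more factor of each prime in [P], so [N %/ p] still
   kills every [B i]. *)
pose m := (\prod_(p <- P) p)%N; pose N' := (\prod_(i < k) #|B i.+1|)%N; pose N := (m * N')%N.
have N'0 : (0 < N')%N.
  by apply: prodn_gt0 => i; apply/card_gt0P; exists 0.
have m0 : (0 < m)%N.
  rewrite /m big_seq; apply: (big_ind (fun x => 0 < x)%N) => // [x y|p pP].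
    by rewrite muln_gt0 => -> ->.
  exact: prime_gt0 (hPprime pP).
have m_dvd p : p \in P -> (p %| m)%N.
  by move=> pP; rewrite /m (big_fsetD1 p) //= dvdn_mulr.
have N_gt1 : (1 < N)%N.
  have /fset0Pn[p pP] := P0'; have pp := prime_gt1 (hPprime pP).
  apply: leq_trans pp _; apply: dvdn_leq; first by rewrite muln_gt0 m0.
  by rewrite dvdn_mulr // m_dvd.
have N_primes p : prime p -> (p %| N)%N = (p \in P).
  move=> pp; apply/idP/idP => [|pP]; last by rewrite dvdn_mulr // m_dvd.
  rewrite /N Euclid_dvdM // => /orP[|].
    rewrite /m big_seq; elim/big_rec: _ => [|q x qP IH]; first by rewrite Euclid_dvd1.
    rewrite Euclid_dvdM // => /orP[|/IH //]; have pq := hPprime qP.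
    by rewrite dvdn_prime2 // => /eqP ->.
  rewrite /N'; elim/big_rec: _ => [|i x _ IH]; first by rewrite Euclid_dvd1.
  rewrite Euclid_dvdM // => /orP[pB|/IH //].
  by apply: (hPB _ pp pB); rewrite /= ltn_ord.
have m_primes p : prime p -> (p %| N)%N -> (p %| m)%N.
  by move=> pp; rewrite N_primes // => /m_dvd.
have B_N' i : (i <= k)%N -> forall x : B i, x *+ N' = 0.
  case: i => [_ x|i ik x]; first exact: trivial_eq.
  rewrite /N' (bigD1 (Ordinal ik)) //= mulrnA.
  have -> : x *+ #|B i.+1| = 0.
    by rewrite -FinRing.zmodXgE -cardsT; apply: (expg_cardG (G := [set: B i.+1]%G)); rewrite inE.
  by rewrite mul0rn.
have B_ann i : (i <= k)%N -> killed N (B i).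
  move=> ik p pp pN x; have /dvdnP[t mt] := m_primes p pp pN.
  rewrite /N mt mulnAC mulnK ?prime_gt0 // mulnC mulrnA B_N' // mul0rn //.
have gam := @unit_density_tends R _ _ (ltnW N_gt1) hPprime N_primes.
have tw := tower_weight_tends N_gt1 (@residue_law_ge0 _ _ _ _ xi N) (residue_law_sum xi N)
  halpha0 halpha1 (residue_law_balanced N_gt1 hxi halpha1) gam hB0 B_ann.
have K0 := aut_count_gt0 R B k.
have det0 : tends (fun n => \sum_i fine (Pr n [set w | \det (mats (@M n) w i) = 0])) 0.
  have := tends_sum (P := predT) (fun i _ => singular_tends i).
  by rewrite big1.
have tK := tends_mul tw (tends_cst (aut_count R B k)^-1).
set L := (X in tends _ X) in tK *.
have diff0 : tends (fun n => fine (Pr n [set w | cok_event B P (mats (@M n) w)]) -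
    expect (@wmat _ _ (law N) n) (@tower_weight R N N_gt1 B k B_ann n) / aut_count R B k) 0.
  apply: tends_squeeze0 det0; apply: eventually_impl (eventually_ge 1) => n n1; rewrite subr0.
  apply: (expect_close (M_distr n1) (M_indep n1) K0).
    exact: (tower_weight_bounds R N_gt1 hB0 (erefl N) m_primes B_N' B_ann).
  exact: (tower_weight_event R N_gt1 hB0 (erefl N) m_primes B_N' B_ann hPprime N_primes).
have := tends_add diff0 tK; rewrite add0r; apply: tends_eq.
by exists 0%N => n _; rewrite subrK.
Qed.

End Limit.

Theorem theorem1p2 (R : realType) (k : nat) (hk : (1 <= k)%N)
  (alpha : R) (halpha0 : 0 < alpha) (halpha1 : alpha <= 1 / 2)
  (d0 : measure_display) (T0 : measurableType d0) (P0 : probability T0 R)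
  (xi : {RV P0 >-> int}) (hxi : balanced alpha xi)
  (d : nat -> measure_display) (T : forall n : nat, measurableType (d n))
  (Pr : forall n : nat, probability (T n) R)
  (M : forall n : nat, 'I_k -> 'I_n -> 'I_n -> {RV (Pr n) >-> int})
  (M_distr : forall n : nat, (1 <= n)%N -> forall (i : 'I_k) (a b : 'I_n),
     identically_distributed (M n i a b) xi)
  (M_indep : forall n : nat, (1 <= n)%N ->
     mutually_independent
       (fun t : 'I_k * 'I_n * 'I_n => M n t.1.1 t.1.2 t.2))
  (B : nat -> finZmodType) (hB0 : #|B 0%N| = 1%N)
  (P : {fset nat}) (hPprime : forall p : nat, p \in P -> prime p)
  (hPB : forall (i : nat) (p : nat), (1 <= i <= k)%N -> prime p ->
     (p %| #|B i|)%N -> p \in P) :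
  Pr n [set w : T n | forall j : 'I_k,
     zmod_isomorphic
       (primary_part
          (Cok (\big[mulmx/1%:M]_(i < k | (i <= j)%N)
                  (\matrix_(a, b) M n i a b w))) P)
       (B j.+1)]
    @[n --> \oo]
  --> ((\prod_(p <- P) qpochhammer (p%:R^-1) (p%:R^-1) ^+ k)
       * \prod_(1 <= i < k.+1)
           (#|Sur (B i) (B i.-1)|%:R / #|Aut [set: B i]%SET|%:R) : R)%:E.
Proof.
set L := (X in X%:E).
have meas n := meas_mats (M n) (cok_event B P (n := n)).
suff uL : tends (fun n => fine (Pr n [set w | cok_event B P (mats (M n) w)])) L.
  apply/fine_cvgP; split; last exact/tendsP.
  by apply: nearW => n; apply: fin_num_measure; apply: meas.
(* With [P] empty all the groups are trivial, the event is certain and the limit is 1; otherwise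
   [cok_event_tends] applies. *)
have [P0'|P_neq0] := eqVneq P fset0; last first.
  have -> : L = \prod_(i < k) #|Sur (B i.+1) (B i)|%:R *
      (\prod_(p <- P) qpochhammer (p%:R^-1) (p%:R^-1)) ^+ k / aut_count R B k.
    by rewrite /L prodrXl big_add1 big_mkord /= prodf_div mulrCA mulrA.
  exact: (cok_event_tends halpha0 halpha1 hxi M_distr M_indep hB0 hPprime hPB P_neq0).
have B1 i : (i <= k)%N -> #|B i| = 1%N.
  case: i => [//|i] ik; apply/eqP; rewrite eqn_leq; apply/andP; split; last first.
    by apply/card_gt0P; exists 0.
  rewrite leqNgt; apply/negP => B1.
  have := hPB i.+1 (pdiv #|B i.+1|); rewrite ik pdiv_prime // pdiv_dvd P0' => /(_ isT isT isT).
  by rewrite in_fset0.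
have -> : L = 1.
  rewrite /L P0' big_nil mul1r big_add1 big_mkord big1 // => i _.
  have Bi := B1 i (ltnW (ltn_ord i)); have Bi1 := B1 i.+1 (ltn_ord i).
  by rewrite card_Aut_Sur /= !card_Sur_trivial // divr1.
apply: tends_eq (tends_cst 1); exists 0%N => n _.
have -> : [set w | cok_event B P (mats (M n) w)] = setT.
  apply/seteqP; split=> // w _ j; rewrite P0'; apply: trivial_primary_iso.
  exact: B1.
by rewrite probability_setT.
Qed.
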